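(* For every fixed integer $\ell\ge 5$, the function $\hat p(n)=n^{-1/m_2(C_\ell)}=n^{-(\ell-2)/(\ell-1)}$ is a threshold for the property that every proper edge colouring of $G(n,p)$ contains a rainbow copy of $C_\ell$. That is, for every $p=p(n)\in[0,1]$: if $p\gg n^{-(\ell-2)/(\ell-1)}$ then $\Pr\big[G(n,p)\overset{\mathrm{rb}}{\longrightarrow}C_\ell\big]\to 1$ as $n\to\infty$, and if $p\ll n^{-(\ell-2)/(\ell-1)}$ then $\Pr\big[G(n,p)\overset{\mathrm{rb}}{\longrightarrow}C_\ell\big]\to 0$ as $n\to\infty$. Furthermore, $\hat p(n)=n^{-3/4}$ is a threshold for $C_4$: if $p\gg n^{-3/4}$ then $\Pr\big[G(n,p)\overset{\mathrm{rb}}{\longrightarrow}C_4\big]\to 1$, and if $p\ll n^{-3/4}$ then $\Pr\big[G(n,p)\overset{\mathrm{rb}}{\longrightarrow}C_4\big]\to 0$.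
   Context: All graphs are finite and simple. $C_\ell$ is the cycle on $\ell$ vertices. $G(n,p)$ is the binomial random graph on $n$ labelled vertices, in which each pair of vertices is an edge independently with probability $p=p(n)$. For graphs $G$ and $H$, write $G\overset{\mathrm{rb}}{\longrightarrow}H$ if for every proper edge colouring of $G$ (adjacent edges receive distinct colours, with any number of colours allowed) there is a rainbow copy of $H$ in $G$, i.e. a subgraph of $G$ isomorphic to $H$ all of whose edges have distinct colours. The maximum 2-density of a graph $H$ is $m_2(H)=\max\{(e(J)-1)/(v(J)-2): J\subseteq H,\ v(J)\ge 3\}$, where $e(J)$, $v(J)$ are the numbers of edges and vertices of $J$; one has $m_2(C_\ell)=(\ell-1)/(\ell-2)$. A function $\hat p=\hat p(n)$ is a threshold for a property if $G(n,p)$ has the property with probability tending to $1$ when $p\gg\hat p$ (i.e. $p/\hat p\to\infty$) and fails to have it with probability tending to $1$ when $p\ll\hat p$ (i.e. $p/\hat p\to 0$). *)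

(* Defs.v *)
From HB Require Import structures.
From mathcomp Require Export all_boot all_order all_algebra.
From mathcomp Require Export all_classical all_reals all_analysis.

Set Implicit Arguments.
Unset Strict Implicit.
Unset Printing Implicit Defensive.

Import Order.TTheory GRing.Theory Num.Theory.
Import numFieldNormedType.Exports.

Local Open Scope ring_scope.

Definition graph_axiom (T : finType) (VE : {set T} * {set {set T}}) : bool :=
  [forall e in VE.2, (e \subset VE.1) && (#|e| == 2%N)].

(* A finite simple graph whose vertex set is a subset of T; edges are
   2-element sets of vertices. *)
Record graph (T : finType) := Graph {
  graph_val : {set T} * {set {set T}};
  _ : graph_axiom graph_val }.

HB.instance Definition _ (T : finType) := [isSub for @graph_val T].
HB.instance Definition _ (T : finType) := [Finite of graph T by <:].

Definition verts (T : finType) (G : graph T) : {set T} := (graph_val G).1.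
Definition edges (T : finType) (G : graph T) : {set {set T}} := (graph_val G).2.

Definition subgraph (T : finType) (J G : graph T) : bool :=
  (verts J \subset verts G) && (edges J \subset edges G).

(* Only the values of f on the vertices of G matter. *)
Definition isomorphic (T S : finType) (G : graph T) (H : graph S) : Prop :=
  exists f : T -> S,
    [/\ {in verts G &, injective f},
        [set f x | x in verts G] = verts H &
        [set [set f x | x in (e : {set T})] | e in edges G] = edges H].

Definition cycle_edges (l : nat) : {set {set 'I_l}} :=
  [set [set i; ordS i] | i : 'I_l & ordS i != i].

Lemma cycle_graph_axiom (l : nat) : graph_axiom ([set: 'I_l], cycle_edges l).
Proof.
apply/forall_inP => /= e /imsetP[i]; rewrite inE => ni ->.
by rewrite finset.subsetT cards2 (eq_sym i) ni.
Qed.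

(* The cycle 0 - 1 - ... - (l-1) - 0; meaningful for l >= 3 (ordS is the
   successor modulo l, and ordS i != i only fails for l = 1). *)
Definition cycle_graph (l : nat) : graph 'I_l := Graph (cycle_graph_axiom l).

(* Colourings are total functions on sets of vertices, of which only the values
   on the edges of G matter; the set K of colours is arbitrary. *)
Definition proper_colouring (T : finType) (K : Type) (G : graph T)
    (c : {set T} -> K) : Prop :=
  forall e f : {set T}, e \in edges G -> f \in edges G ->
    e != f -> e :&: f != finset.set0 -> c e <> c f.

Definition rainbow (T : finType) (K : Type) (J : graph T)
    (c : {set T} -> K) : Prop :=
  {in edges J &, injective c}.

Definition rb_arrow (T S : finType) (G : graph T) (H : graph S) : Prop :=
  forall (K : Type) (c : {set T} -> K), proper_colouring G c ->
    exists J : graph T, [/\ subgraph J G, isomorphic J H & rainbow J c].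

Definition two_density (R : realType) (T : finType) (J : graph T) : R :=
  (#|edges J|%:R - 1) / (#|verts J|%:R - 2).

(* The maximum is seeded with J = H, which is itself a legitimate J as soon as
   v(H) >= 3, so that no spurious value enters the maximum. *)
Definition max_two_density (R : realType) (T : finType) (H : graph T) : R :=
  \big[Num.max/two_density R H]_(J : graph T |
      subgraph J H && (3 <= #|verts J|)%N) two_density R J.

(* Pr[G(n,p) has property P]: a sum over the graphs on the whole vertex set
   'I_n, each pair of vertices being independently an edge with probability p. *)
Definition gnp_prob (R : realType) (n : nat) (p : R)
    (P : graph 'I_n -> Prop) : R :=
  \sum_(G : graph 'I_n | (verts G == [set: 'I_n]) && `[< P G >])
    \prod_(e : {set 'I_n} | #|e| == 2%N) bernoulli_pmf p (e \in edges G).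

Definition is_threshold (R : realType) (phat : nat -> R)
    (P : forall n : nat, graph 'I_n -> Prop) : Prop :=
  forall p : nat -> R, (forall n, 0 <= p n <= 1) ->
    ((p n / phat n @[n --> \oo] --> +oo)%classic ->
       (gnp_prob (p n) (P n) @[n --> \oo] --> (1 : R))%classic) /\
    ((p n / phat n @[n --> \oo] --> (0 : R))%classic ->
       (gnp_prob (p n) (P n) @[n --> \oo] --> (0 : R))%classic).

(* Main.v *)
(** Both 0-statements. Call a set of edges colourable if it has a proper colouring without a
    rainbow C_l. In a minimal non-colourable set E, give fresh colours to any few classes of
    disjoint edges: some l-cycle inside E meets these classes and uses at most one edge of
    each. This excludes sparse configurations, and a discharging argument yields
    3 e(E) >= 4 v(E). It also makes E reachable from one l-cycle by successively adding
    l-cycles that contain an old and a new edge. Put M = max(l,5) and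
    p = eps n^(-(M-2)/(M-1)). In expectation each addition costs a factor O(eps), since k
    new vertices come with more than k new edges. So the exploration is unlikely to last
    log n steps, and just as unlikely to stop earlier at a set with (M-1)v <= (M-2)e, as E is.
    For l = 4 the value M = 5 gives the exponent 3/4.

    1-statement for l >= 5. Given a proper colouring, distribute its colours at random into
    q groups. With positive probability the edges of each group are well spread, so that from
    half of the vertices u paths with prescribed groups lead to order (np)^(l-2) distinct
    vertices, and a positive proportion of the pairs uz are joined by a path on l-1 edges such
    that an edge uz with a colour of one of the last groups closes a rainbow C_l. These pairs
    depend on the groups of O(n^2 p) edges only, so a union bound over all groupings shows
    that G(n,p) has many edges among them.

    1-statement for l = 4. Every proper colouring of K_{2,4} has a rainbow C_4, and K_{2,4}
    appears by the second moment method. *)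

Require Import Defs.
From mathcomp Require Import ring lra zify.
From mathcomp Require Import fintype finset.

Set Implicit Arguments.
Unset Strict Implicit.
Unset Printing Implicit Defensive.

Import Order.TTheory GRing.Theory Num.Theory.
Import numFieldNormedType.Exports.

Local Open Scope ring_scope.

(** For M >= 5 one has 3(M-1) <= 4(M-2), so the single inequality 3 e(E) >= 4 v(E) serves every l.
    For l = 4 its ratio 4/3 is attained by K_{2,4}, with 8 edges on 6 vertices; this is why M cannot
    be 4 there.

    The exploration needs about log n steps because one step gains only a constant factor, while the
    expected number of starting cycles may be of order n^2. The clusters then have O(log n)
    vertices, and choosing old vertices on a new cycle costs powers of log n. This is affordable
    because every step with such a choice also gains a power of n^(-1/(M-1)).

    In the 1-statement there are far too many proper colourings for a union bound over them. A
    constant number q of groups leaves q^t cases for t edges. The inner layers are smaller than U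
    and Z by a large constant factor, so that the t edges used to build paths are few compared with
    the order n^2 p closing edges, whose randomness has to beat q^t. It is the colours, not the
    edges, that are grouped at random: edges at a vertex have distinct colours, so their groups are
    independent. *)

(** * Finite product measures and Chernoff bounds *)

Section ProductMeasure.
Variables (R : realType) (X : finType).

(* Expectation of f when the coordinates are independent with law w. *)
Definition Ex (Y : finType) (w : Y -> R) (f : {ffun X -> Y} -> R) : R :=
  \sum_(o : {ffun X -> Y}) (\prod_x w (o x)) * f o.

Definition law (Y : finType) (w : Y -> R) : Prop :=
  (forall y, 0 <= w y) /\ \sum_y w y = 1.

Lemma Ex_prod (Y : finType) (w : Y -> R) (h : X -> Y -> R) :
  Ex w (fun o => \prod_x h x (o x)) = \prod_x \sum_y w y * h x y.
Proof.
rewrite /Ex (bigA_distr_bigA (fun x y => w y * h x y)) /=.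
by apply: eq_bigr => o _; rewrite big_split.
Qed.

(** Used as a coupling twice: with [orb] it gives monotonicity in p, and with an [op] that selects
    one of the two samples according to the coordinate it exposes the random graph in two
    independent rounds. *)
Lemma Ex_two_copies (Y1 Y2 Y : finType) (w1 : Y1 -> R) (w2 : Y2 -> R)
    (w : Y -> R) (op : X -> Y1 -> Y2 -> Y) (f : {ffun X -> Y} -> R) :
  (forall x y, \sum_(z : Y1 * Y2 | op x z.1 z.2 == y) w1 z.1 * w2 z.2 = w y) ->
  Ex w1 (fun o1 => Ex w2 (fun o2 => f [ffun x => op x (o1 x) (o2 x)])) = Ex w f.
Proof.
move=> Hw; rewrite /Ex.
pose W (z : {ffun X -> Y1 * Y2}) := \prod_x (w1 (z x).1 * w2 (z x).2).
transitivity (\sum_(z : {ffun X -> Y1 * Y2})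
    W z * f [ffun x => op x (z x).1 (z x).2]).
  transitivity (\sum_(oo : {ffun X -> Y1} * {ffun X -> Y2})
     ((\prod_x w1 (oo.1 x)) * (\prod_x w2 (oo.2 x))) *
       f [ffun x => op x (oo.1 x) (oo.2 x)]).
    rewrite -(pair_bigA _ (fun (o1 : {ffun X -> Y1}) (o2 : {ffun X -> Y2}) => (\prod_x w1 (o1 x)) * (\prod_x w2 (o2 x))
       * f [ffun x => op x (o1 x) (o2 x)])) /=.
    apply: eq_bigr => o1 _; rewrite big_distrr /=; apply: eq_bigr => o2 _.
    by rewrite mulrA.
  pose g (z : {ffun X -> Y1 * Y2}) : {ffun X -> Y1} * {ffun X -> Y2} :=
    ([ffun x => (z x).1], [ffun x => (z x).2]).
  rewrite (reindex g) /=.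
    apply: eq_bigr => z _; rewrite /W -big_split /=.
    congr (_ * f _); first by apply: eq_bigr => x _; rewrite !ffunE.
    by apply/ffunP => x; rewrite !ffunE.
  exists (fun oo : {ffun X -> Y1} * {ffun X -> Y2} =>
      [ffun x => (oo.1 x, oo.2 x)]).
    by move=> z _; apply/ffunP => x; rewrite !ffunE; case: (z x).
  case=> o1 o2 _; rewrite /g.
  by congr (_, _); apply/ffunP => x; rewrite !ffunE.
rewrite (partition_big (fun z : {ffun X -> Y1 * Y2} =>
    [ffun x => op x (z x).1 (z x).2]) xpredT) //=.
apply: eq_bigr => o _.
rewrite (eq_bigr (fun z => W z * f o)); last by move=> z /eqP ->.
rewrite -big_distrl /=; congr (_ * _).
rewrite (eq_bigr (fun x => \sum_(z : Y1 * Y2 | op x z.1 z.2 == o x)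
   w1 z.1 * w2 z.2)); last by move=> x _; rewrite Hw.
rewrite (bigA_distr_big_dep (fun x z => op x z.1 z.2 == o x)
   (fun x (z : Y1 * Y2) => w1 z.1 * w2 z.2)) /=.
apply: eq_bigl => z; apply/eqP/familyP => [<- x|H].
  by rewrite unfold_in /= ffunE.
by apply/ffunP => x; rewrite !ffunE; apply/eqP; move: (H x); rewrite unfold_in.
Qed.

Section OneLaw.
Variables (Y : finType) (w : Y -> R).
Hypothesis lw : law w.

Lemma weight_ge0 (o : {ffun X -> Y}) : 0 <= \prod_x w (o x).
Proof. by apply: prodr_ge0 => x _; apply: lw.1. Qed.

Lemma Ex_le (f g : {ffun X -> Y} -> R) : (forall o, f o <= g o) -> Ex w f <= Ex w g.
Proof. by move=> fg; apply: ler_sum => o _; rewrite ler_wpM2l ?weight_ge0. Qed.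

Lemma eq_Ex (f g : {ffun X -> Y} -> R) : f =1 g -> Ex w f = Ex w g.
Proof. by move=> fg; apply: eq_bigr => o _; rewrite fg. Qed.

Lemma ExZ (c : R) f : Ex w (fun o => c * f o) = c * Ex w f.
Proof. by rewrite /Ex big_distrr /=; apply: eq_bigr => o _; rewrite mulrCA. Qed.

Lemma Ex_sum (I : Type) (r : seq I) (P : pred I) (F : I -> {ffun X -> Y} -> R) :
  Ex w (fun o => \sum_(i <- r | P i) F i o) = \sum_(i <- r | P i) Ex w (F i).
Proof.
rewrite /Ex exchange_big /=; apply: eq_bigr => o _.
by rewrite big_distrr.
Qed.

Lemma ExD f g : Ex w (fun o => f o + g o) = Ex w f + Ex w g.
Proof. by rewrite /Ex -big_split /=; apply: eq_bigr => o _; rewrite mulrDr. Qed.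

Lemma Ex_cst (c : R) : Ex w (fun _ => c) = c.
Proof.
rewrite /Ex -big_distrl /= -(bigA_distr_bigA (fun _ => w)) /=.
by rewrite big1 ?mul1r // => x _; apply: lw.2.
Qed.

Lemma Ex_ge0 f : (forall o, 0 <= f o) -> 0 <= Ex w f.
Proof. by move=> f0; apply: sumr_ge0 => o _; rewrite mulr_ge0 ?weight_ge0. Qed.

Lemma Ex_exists (f : {ffun X -> Y} -> bool) : Ex w (fun o => (f o)%:R) < 1 ->
  exists o, ~~ f o.
Proof.
move=> H; apply/existsP; apply: contraTT H => /existsPn H.
rewrite -leNgt -{1}(Ex_cst 1); apply: Ex_le => o.
by have := H o; rewrite negbK => ->.
Qed.

Lemma markov (f : {ffun X -> Y} -> R) (a : R) : 0 < a -> (forall o, 0 <= f o) ->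
  Ex w (fun o => (a <= f o)%R%:R) <= Ex w f / a.
Proof.
move=> a0 f0; rewrite mulrC -ExZ; apply: Ex_le => o.
case: (leP a (f o)) => H /=; last by rewrite mulr_ge0 ?invr_ge0 ?f0 ?ltW.
by rewrite mulrC ler_pdivlMr ?mul1r.
Qed.

Lemma Ex_exp_count (S : {set X}) (A : pred Y) (b : R) :
  Ex w (fun o : {ffun X -> Y} => b ^+ #|[set x in S | A (o x)]|) =
  (1 + (b - 1) * \sum_(y | A y) w y) ^+ #|S|.
Proof.
pose h (x : X) (y : Y) := if (x \in S) && A y then b else 1.
transitivity (Ex w (fun o => \prod_x h x (o x))).
  apply: eq_Ex => o; rewrite /h -big_mkcond /= prodr_const.
  by congr (_ ^+ _); apply: eq_card => x; rewrite !inE unfold_in.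
rewrite Ex_prod (bigID (mem S)) /= [X in _ * X]big1 ?mulr1; last first.
  move=> x xS; rewrite -[RHS]lw.2; apply: eq_bigr => y _.
  by rewrite /h (negbTE xS) mulr1.
rewrite (eq_bigr (fun=> 1 + (b - 1) * \sum_(y | A y) w y)) ?prodr_const //.
move=> x xS; rewrite -{1}lw.2 (bigID A) [in RHS](bigID A) /=.
rewrite (eq_bigr (fun y => w y * b)); last by move=> y Ay; rewrite /h xS Ay.
rewrite [X in _ + X = _](eq_bigr w); last first.
  by move=> y /negbTE Ay; rewrite /h xS Ay mulr1.
by rewrite -big_distrl /=; ring.
Qed.

Lemma expR1_ge2 : 2 <= expR 1 :> R.
Proof. by have := expR_ge1Dx (1 : R); lra. Qed.

Lemma expR1_le4 : expR 1 <= 4 :> R.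
Proof.
have h := expR_ge1Dx (- 2^-1 : R).
have e : expR (2^-1 : R) * expR (- 2^-1) = 1 by rewrite -expRD subrr expR0.
have p := expR_gt0 (2^-1 : R).
have : expR (2^-1 : R) <= 2 by nra.
have -> : (1 : R) = 2^-1 + 2^-1 by lra.
rewrite expRD; nra.
Qed.

Lemma exp_pow_le (t : R) k : 0 <= 1 + t -> (1 + t) ^+ k <= expR (t * k%:R).
Proof.
move=> t0; rewrite expRM_natr.
by rewrite lerXn2r ?nnegrE ?expR_ge0 // expR_ge1Dx.
Qed.

Lemma prob_pred_bounds (A : pred Y) : 0 <= \sum_(y | A y) w y <= 1.
Proof.
rewrite sumr_ge0 /=; last by move=> y _; apply: lw.1.
rewrite -[leRHS]lw.2 [leRHS](bigID A) /= lerDl sumr_ge0 // => y _.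
exact: lw.1.
Qed.

(** Markov's inequality for [expR (-1)] to the power of the count. Since [expR (-1)] is at most 1/2,
    this moment is at most [expR (- (a / 2))], which outweighs the factor [expR (a / 4)]. *)
Lemma lower_tail (S : {set X}) (A : pred Y) (a : R) :
  a <= (\sum_(y | A y) w y) * #|S|%:R ->
  Ex w (fun o => (#|[set x in S | A (o x)]|%:R <= a / 4)%R%:R) <= expR (- (a / 4)).
Proof.
set rho := \sum_(y | A y) w y => Ha.
have /andP[rho0 rho1] : 0 <= rho <= 1 := prob_pred_bounds A.
have b2 : expR (-1 : R) <= 2^-1.
  by rewrite expRN lef_pV2 ?posrE ?expR_gt0 // expR1_ge2.
have b0 := expR_gt0 (-1 : R).
apply: (@le_trans _ _ (expR (a / 4) *
   Ex w (fun o => expR (-1) ^+ #|[set x in S | A (o x)]|))).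
  rewrite -ExZ; apply: Ex_le => o.
  case: (leP _ (a / 4)) => H /=; last by rewrite mulr_ge0 ?expR_ge0 ?exprn_ge0.
  rewrite -expRM_natl -expRD -[leLHS]expR0 ler_expR.
  by rewrite mulrN1 subr_ge0.
rewrite Ex_exp_count -/rho.
apply: (@le_trans _ _ (expR (a / 4) * expR (- (2^-1 * rho) * #|S|%:R))).
  rewrite ler_wpM2l ?expR_ge0 //.
  apply: le_trans (exp_pow_le _ _); last by nra.
  rewrite lerXn2r ?nnegrE //; nra.
rewrite -expRD ler_expR; nra.
Qed.

(** The same with base [expR 1], which is at most 4: the moment is at most [expR (3 * a)], against
    the factor [expR (- (4 * a))]. *)
Lemma upper_tail (S : {set X}) (A : pred Y) (a : R) :
  (\sum_(y | A y) w y) * #|S|%:R <= a ->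
  Ex w (fun o => (4 * a <= #|[set x in S | A (o x)]|%:R)%R%:R) <= expR (- a).
Proof.
set rho := \sum_(y | A y) w y => Ha.
have /andP[rho0 rho1] : 0 <= rho <= 1 := prob_pred_bounds A.
have e4 := expR1_le4; have e2 := expR1_ge2.
apply: (@le_trans _ _ (expR (- (4 * a)) *
   Ex w (fun o => expR 1 ^+ #|[set x in S | A (o x)]|))).
  rewrite -ExZ; apply: Ex_le => o.
  case: (leP (4 * a)) => H /=; last by rewrite mulr_ge0 ?expR_ge0 ?exprn_ge0 ?expR_ge0.
  rewrite -expRM_natl -expRD -[leLHS]expR0 ler_expR.
  by rewrite mulr1 addrC subr_ge0.
rewrite Ex_exp_count -/rho.
apply: (@le_trans _ _ (expR (- (4 * a)) * expR (3 * rho * #|S|%:R))).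
  rewrite ler_wpM2l ?expR_ge0 //.
  apply: le_trans (exp_pow_le _ _); last by nra.
  rewrite lerXn2r ?nnegrE //; nra.
rewrite -expRD ler_expR; nra.
Qed.

End OneLaw.
End ProductMeasure.

(** * The random graph as a product measure *)

Section RandomGraph.
Variable R : realType.

Lemma bernoulli_law (p : R) : 0 <= p <= 1 -> law (bernoulli_pmf p).
Proof.
move=> p01; split=> [y|]; first exact: bernoulli_pmf_ge0.
by rewrite big_bool /= /bernoulli_pmf; ring.
Qed.

Lemma bernoulli_true (p : R) : \sum_(y | id y) bernoulli_pmf p y = p.
Proof. by rewrite (big_pred1 true) //; case. Qed.

Lemma Ex_bernoulli_mono (X : finType) (p p' : R) (f : {ffun X -> bool} -> R) :
  0 <= p -> p <= p' -> p' <= 1 ->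
  (forall o o' : {ffun X -> bool}, (forall x, o x -> o' x) -> f o <= f o') ->
  Ex (bernoulli_pmf p) f <= Ex (bernoulli_pmf p') f.
Proof.
move=> p0 pp' p1 fmono.
have [pe|pn1] := eqVneq p 1.
  have -> // : p' = p by apply/eqP; rewrite eq_le pp' andbT pe.
have plt : 0 < 1 - p by rewrite subr_gt0 lt_neqAle pn1 (le_trans pp').
(* Sprinkling: a second round with probability [r] satisfies (1 - p)(1 - r) = 1 - p'. *)
pose r := (p' - p) / (1 - p).
have r01 : 0 <= r <= 1.
  rewrite /r divr_ge0 ?subr_ge0 ?(ltW plt) //=; last by rewrite -subr_ge0 ltW.
  by rewrite ler_pdivrMr // mul1r lerD2r.
have rE : r * (1 - p) = p' - p by rewrite /r divfK ?gt_eqF.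
rewrite -(@Ex_two_copies _ _ _ _ _ (bernoulli_pmf p) (bernoulli_pmf r)
  (bernoulli_pmf p') (fun _ => orb)); last first.
  move=> _ y; rewrite big_mkcond -(pair_bigA _ (fun a b =>
     if (a || b) == y then bernoulli_pmf p a * bernoulli_pmf r b else 0)) /=.
  by rewrite big_bool !big_bool /bernoulli_pmf /=; case: y => /=; nra.
have pl : law (bernoulli_pmf p) by apply: bernoulli_law; rewrite p0 (le_trans pp').
apply: (Ex_le pl) => o1; rewrite -{1}(Ex_cst X (bernoulli_law r01) (f o1)).
apply: (Ex_le (bernoulli_law r01)) => o2.
by apply: fmono => x; rewrite ffunE => ->.
Qed.

Section GraphOf.
Variable T : finType.

Lemma graph_of_axiom (o : {ffun {set T} -> bool}) :
  graph_axiom ([set: T], [set e : {set T} | o e & #|e| == 2%N]).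
Proof.
by apply/forall_inP => /= e; rewrite inE => /andP[_ ->]; rewrite finset.subsetT.
Qed.

Definition graph_of (o : {ffun {set T} -> bool}) : graph T :=
  Graph (graph_of_axiom o).

Lemma graph_ext (G H : graph T) :
  verts G = verts H -> edges G = edges H -> G = H.
Proof.
case: G H => [[V E] hG] [[V' E'] hH]; rewrite /verts /edges /= => ? ?.
by apply: val_inj => /=; subst.
Qed.

Lemma edge_card2 (G : graph T) (e : {set T}) : e \in edges G -> #|e| = 2%N.
Proof. by case: G => [[V E] h] /= /(forall_inP h) /andP[_ /eqP]. Qed.

Lemma edge_sub_verts (G : graph T) (e : {set T}) :
  e \in edges G -> e \subset verts G.
Proof. by case: G => [[V E] h] /= /(forall_inP h) /andP[]. Qed.

Lemma mem_edges_graph_of o e :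
  (e \in edges (graph_of o)) = o e && (#|e| == 2%N).
Proof. by rewrite /edges /= inE. Qed.

End GraphOf.

(** The sample space has a coordinate for every set of vertices, not only for pairs. The outcomes
    giving a fixed graph form a product set that leaves the other coordinates free, and these sum to
    1. *)
Lemma gnp_probE n (p : R) (P : graph 'I_n -> Prop) : 0 <= p <= 1 ->
  gnp_prob p P = Ex (bernoulli_pmf p) (fun o => `[< P (graph_of o) >]%:R).
Proof.
move=> p01; rewrite /gnp_prob /Ex.
rewrite (partition_big (@graph_of 'I_n) (fun G => verts G == [set: 'I_n])) //=.
rewrite big_mkcondr /=; apply: eq_bigr => G /eqP vG.
transitivity (\sum_(o | graph_of o == G)
   (\prod_x bernoulli_pmf p (o x)) * `[< P G >]%:R); last first.
  by apply: eq_bigr => o /eqP ->.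
rewrite -big_distrl /=; case: asboolP => PG; last by rewrite mulr0.
rewrite mulr1.
rewrite (eq_bigl (fun o : {ffun {set 'I_n} -> bool} => o \in family (fun e : {set 'I_n} =>
   [pred b : bool | (#|e| == 2%N) ==> (b == (e \in edges G))]))); last first.
  move=> o; apply/eqP/familyP => [<- e | H].
    by rewrite inE mem_edges_graph_of; case: (#|e| == 2%N); rewrite ?andbT ?eqxx.
  apply: graph_ext; first by rewrite vG.
  apply/setP => e; rewrite mem_edges_graph_of.
  have := H e; rewrite inE; case: (boolP (#|e| == 2%N)) => [e2 /eqP -> | e2 _].
    by rewrite andbT.
  by rewrite andbF; apply/esym/negP => /edge_card2 /eqP; rewrite (negbTE e2).
rewrite -(bigA_distr_big_dep (fun (e : {set 'I_n}) (b : bool) =>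
   (#|e| == 2%N) ==> (b == (e \in edges G))) (fun _ => bernoulli_pmf p)) /=.
rewrite [RHS](bigID (fun e : {set 'I_n} => #|e| == 2%N)) /=.
rewrite [X in _ = _ * X]big1 ?mulr1.
  by apply: eq_bigr => e e2; rewrite (big_pred1 (e \in edges G)) // => b; rewrite e2.
move=> e /negbTE e2; rewrite -[RHS](bernoulli_law p01).2.
by apply: eq_bigl => b; rewrite e2.
Qed.

Lemma gnp_prob_bounds n (p : R) (P : graph 'I_n -> Prop) : 0 <= p <= 1 ->
  0 <= gnp_prob p P <= 1.
Proof.
move=> p01; rewrite gnp_probE //; have l := bernoulli_law p01.
rewrite Ex_ge0 //= -[leRHS](Ex_cst {set 'I_n} l 1); apply: (Ex_le l) => o.
by case: asbool.
Qed.

Lemma subgraph_trans (T : finType) (G H K : graph T) :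
  subgraph G H -> subgraph H K -> subgraph G K.
Proof.
move=> /andP[a b] /andP[c d]; apply/andP.
by split; [apply: fintype.subset_trans a c | apply: fintype.subset_trans b d].
Qed.

Lemma rb_arrow_subgraph (T S : finType) (G G' : graph T) (H : graph S) :
  subgraph G G' -> rb_arrow G H -> rb_arrow G' H.
Proof.
move=> sGG' GH K c cp; have [e f eG fG ne|J [JG iJ rJ]] := GH K c.
  have /andP[_ /fintype.subsetP sE] := sGG'.
  by apply: cp => //; apply: sE.
by exists J; split=> //; apply: subgraph_trans sGG'.
Qed.

Lemma gnp_rb_mono n (S : finType) (H : graph S) (p p' : R) :
  0 <= p -> p <= p' -> p' <= 1 ->
  gnp_prob p (fun G : graph 'I_n => rb_arrow G H) <=
  gnp_prob p' (fun G : graph 'I_n => rb_arrow G H).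
Proof.
move=> p0 pp' p1.
rewrite !gnp_probE ?p0 ?p1 ?(le_trans p0) ?(le_trans _ p1) //.
apply: Ex_bernoulli_mono => // o o' oo'; rewrite ler_nat.
case: asboolP => // h; case: asboolP => //; case.
apply: rb_arrow_subgraph h; rewrite /subgraph /= subxx /=.
apply/fintype.subsetP => e; rewrite !mem_edges_graph_of => /andP[/oo' -> ->] //.
Qed.

End RandomGraph.

(** Source of the strict inequalities in the edge counts: a nonempty proper set of positions on a
    cycle has an exit, so it touches more edges than it has elements and spans fewer. *)
Lemma ordS_closed_setT l (V : {set 'I_l}) : V != set0 ->
  (forall i, i \in V -> ordS i \in V) -> V = setT.
Proof.
case/set0Pn => i iV VS; apply/setP => j; rewrite !inE.
have iterV k : iter k (@ordS l) i \in V by elim: k => //= k; apply: VS.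
have iter_val k : iter k (@ordS l) i = ((i + k) %% l)%N :> nat.
  elim: k => [|k IH] /=; first by rewrite addn0 modn_small.
  by rewrite IH -[(_ %% l).+1]addn1 modnDml addn1 addnS.
rewrite -(_ : iter (j + (l - i))%N (@ordS l) i = j); first exact: iterV.
apply: val_inj; rewrite /= iter_val addnCA subnKC ?(ltnW (ltn_ord i)) //.
by rewrite modnDr modn_small.
Qed.

(** * Minimal non-colourable edge sets *)

Section Critical.
Local Open Scope nat_scope.
Variables (T : finType) (CC : pred {set {set T}}).

Definition nbr (E : {set {set T}}) (x : T) : {set T} := [set y | [set x; y] \in E].

Definition two_sets (E : {set {set T}}) : Prop := forall e, e \in E -> #|e| = 2.

(** Colours are natural numbers so that even and odd numbers can serve as two disjoint palettes when
    colourings are glued. *)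
Definition colourable (E : {set {set T}}) : Prop :=
  exists c : {set T} -> nat,
    (forall e f, e \in E -> f \in E -> e != f -> e :&: f != set0 -> c e <> c f) /\
    (forall C, CC C -> C \subset E ->
       exists e f, [/\ e \in C, f \in C, e != f & c e = c f]).

Definition critical (E : {set {set T}}) : Prop :=
  ~ colourable E /\ forall E' : {set {set T}}, E' \proper E -> colourable E'.

Lemma exists_critical E : ~ colourable E ->
  exists2 E' : {set {set T}}, E' \subset E & critical E'.
Proof.
move=> nE; pose P (E' : {set {set T}}) := ~~ `[< colourable E' >].
have PE : P E by apply/asboolPn.
have [E' mE sE] := @minset_exists _ P E PE; exists E' => //.
have [PE' minE] := minsetP mE; split; first exact/asboolPn.
move=> F /properP[sF [e eE eF]]; apply/asboolP/negPn/negP => PF.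
by move: eF; rewrite (minE F PF sF) eE.
Qed.

Section OneCritical.
Variable E : {set {set T}}.
Hypothesis E2 : two_sets E.
Hypothesis critE : critical E.
Hypothesis CC_regular : forall C x, CC C -> nbr C x != set0 -> #|nbr C x| = 2.
Hypothesis CC_triangle : forall C x y z, CC C ->
  [set x; y] \in C -> [set y; z] \in C -> [set x; z] \in C -> False.

(* Colour E outside F properly without rainbow member of CC, and F by fresh colours
   as prescribed by d: some member of CC is then rainbow, and it must meet F. *)
Lemma critical_fresh (F : {set {set T}}) (d : {set T} -> nat) :
  F \subset E -> F != set0 ->
  (forall e f, e \in F -> f \in F -> e != f -> e :&: f != set0 -> d e <> d f) ->
  exists C, [/\ CC C, C \subset E, C :&: F != set0 &
    forall e f, e \in C :&: F -> f \in C :&: F -> d e = d f -> e = f].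
Proof.
move=> sFE F0 dF; case: critE => nE crit.
have /crit[c [cp cn]] : E :\: F \proper E.
  rewrite properEneq subsetDl andbT; apply: contraNneq F0 => EF.
  apply/eqP/setP => e; rewrite inE; apply/negP => eF.
  by have := subsetP sFE e eF; rewrite -EF inE eF.
apply: contrapT => /forallNP H; apply: nE.
pose c' e := if e \in F then (d e).*2 else (c e).*2.+1.
have parity m n : m.*2 = n.*2.+1 -> False by move=> /(congr1 odd); rewrite /= !odd_double.
exists c'; split => [e f eE fE ef ef0|C CCC sCE].
  rewrite /c'; case: ifP => eF; case: ifP => fF.
  - by move=> /double_inj; apply: dF.
  - by move/parity.
  - by move/esym/parity.
  - by move=> [/double_inj]; apply: cp => //; rewrite inE ?eF ?fF.
have [CF0|CF0] := eqVneq (C :&: F) set0.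
  have sC : C \subset E :\: F.
    apply/subsetP => e eC; rewrite inE (subsetP sCE) // andbT; apply/negP => eF.
    by have := in_set0 e; rewrite -CF0 inE eC eF.
  have [e [f [eC fC ef cef]]] := cn C CCC sC; exists e, f; split=> //.
  have [/setDP[_ /negbTE eF] /setDP[_ /negbTE fF]] := (subsetP sC e eC, subsetP sC f fC).
  by rewrite /c' eF fF cef.
apply: contrapT => K; apply: (H C); split=> // e f.
rewrite !inE => /andP[eC eF] /andP[fC fF] def.
apply/eqP/negPn/negP => ef; apply: K; exists e, f; split=> //.
by rewrite /c' eF fF def.
Qed.

Definition same_pair (p q : T * T) :=
  ((p.1 == q.1) && (p.2 == q.2)) || ((p.1 == q.2) && (p.2 == q.1)).
Definition disj_pair (p q : T * T) :=
  [&& p.1 != q.1, p.1 != q.2, p.2 != q.1 & p.2 != q.2].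
Definition edge_of (p : T * T) : {set T} := [set p.1; p.2].

Lemma edge_of_inj p q : edge_of p = edge_of q -> same_pair p q.
Proof.
case: p q => [a b] [c d] /setP H; rewrite /same_pair /=.
have := H a; have := H b; have := H c; have := H d; rewrite !inE !eqxx ?orbT /=.
rewrite (eq_sym d a) (eq_sym d b) (eq_sym c a) (eq_sym c b).
by case: (a == c); case: (a == d); case: (b == c); case: (b == d).
Qed.

Lemma disj_edge p q : disj_pair p q -> edge_of p :&: edge_of q = set0.
Proof.
case: p q => [a b] [c d] /and4P[/= ac ad bc bd]; apply/eqP; rewrite setI_eq0.
rewrite /edge_of /= disjoints_subset subUset !sub1set !inE.
by rewrite (negbTE ac) (negbTE ad) (negbTE bc) (negbTE bd).
Qed.

Lemma same_pair_sym p q : same_pair p q = same_pair q p.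
Proof.
rewrite /same_pair (eq_sym q.1) (eq_sym q.2) (eq_sym q.1) (eq_sym q.2).
by rewrite (andbC (p.2 == q.1)).
Qed.

Lemma disj_pair_sym p q : disj_pair p q = disj_pair q p.
Proof.
rewrite /disj_pair (eq_sym q.1) (eq_sym q.2) (eq_sym q.1) (eq_sym q.2).
by do 4!case: (_ != _).
Qed.

Lemma pairwise_in (I : eqType) (r : rel I) (s : seq I) : symmetric r ->
  pairwise r s -> {in s &, forall p q, p != q -> r p q}.
Proof.
move=> rs; elim: s => //= x s IH /andP[/allP xs /IH{}IH] p q.
rewrite !inE => /predU1P[->|ps] /predU1P[->|qs]; rewrite ?eqxx // => pq.
- exact: xs.
- by rewrite rs xs.
- exact: IH.
Qed.

Lemma in_pairwise (I : eqType) (r : rel I) (s : seq I) : uniq s ->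
  {in s &, forall p q, p != q -> r p q} -> pairwise r s.
Proof.
elim: s => //= x s IH /andP[xs us] H; apply/andP; split.
  apply/allP => y ys; apply: H; rewrite ?mem_head ?inE ?ys ?orbT //.
  by apply: contraNneq xs => ->.
by apply: IH => // p q ps qs; apply: H; rewrite inE ?ps ?qs orbT.
Qed.

Lemma uniq_flatten_mem (I : eqType) (L : seq (seq I)) K K' p :
  uniq (flatten L) -> K \in L -> K' \in L -> p \in K -> p \in K' -> K = K'.
Proof.
elim: L => //= K0 L IH; rewrite cat_uniq => /and3P[_ /hasPn dis /IH{}IH].
have disL K1 : K1 \in L -> p \in K1 -> p \in K0 -> False.
  by move=> h1 h2; apply/negP/dis/flattenP; exists K1.
rewrite !inE => /predU1P[->|KL] /predU1P[->|KL'] pK pK' //.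
- by case: (disL K').
- by case: (disL K).
- exact: IH.
Qed.

(* Each inner list of L is a class of disjoint edges that share one fresh colour. *)
Lemma critical_classes (L : seq (seq (T * T))) :
  flatten L != [::] -> all (fun p => edge_of p \in E) (flatten L) ->
  pairwise (fun p q => ~~ same_pair p q) (flatten L) ->
  all (pairwise disj_pair) L ->
  exists C, [/\ CC C, C \subset E, has (fun p => edge_of p \in C) (flatten L) &
    all (pairwise (fun p q => ~~ ((edge_of p \in C) && (edge_of q \in C)))) L].
Proof.
move=> L0 /allP sL diffL /allP disL.
have uL : uniq (flatten L).
  rewrite uniq_pairwise; apply: sub_pairwise diffL => p q; apply: contraNneq => ->.
  by rewrite /same_pair !eqxx.
have diff p q : p \in flatten L -> q \in flatten L -> edge_of p = edge_of q -> p = q.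
  move=> pL qL /edge_of_inj pq; apply/eqP; apply: contraLR pq => pq.
  apply: (pairwise_in (r := fun p q => ~~ same_pair p q)) diffL _ _ pL qL pq => x y.
  by rewrite same_pair_sym.
have inL K p : K \in L -> p \in K -> p \in flatten L.
  by move=> KL pK; apply/flattenP; exists K.
(* The fresh colour of an edge is the position of its class in [L]. *)
pose M e := find (fun K => e \in map edge_of K) L.
pose F : {set {set T}} := [set e in map edge_of (flatten L)].
have FP p : p \in flatten L -> has (fun K => edge_of p \in map edge_of K) L.
  move=> /flattenP[K KL pK]; apply/hasP; exists K => //; exact: map_f.
have mapE p K : p \in flatten L -> K \in L ->
    (edge_of p \in map edge_of K) = (p \in K).
  move=> pL KL; apply/mapP/idP => [[q qK pq]|pK]; last by exists p.
  by rewrite (diff p q) // (inL K).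
have MK p : p \in flatten L -> p \in nth [::] L (M (edge_of p)).
  move=> pL; rewrite -mapE //; first exact: (nth_find [::] (FP p pL)).
  by rewrite mem_nth // -has_find FP.
have [||e f|C [CCC sCE CF0 inj]] := @critical_fresh F M.
- by apply/subsetP => e; rewrite inE => /mapP[p /sL h ->].
- case E0: (flatten L) L0 => [//|p r] _.
  by apply/set0Pn; exists (edge_of p); rewrite inE E0 map_f ?mem_head.
- rewrite !inE => /mapP[p pL ->] /mapP[q qL ->] ef ef0 MM.
  have KL : nth [::] L (M (edge_of p)) \in L by rewrite mem_nth // -has_find FP.
  have pK := MK p pL; have qK := MK q qL; rewrite -MM in qK.
  move/negP: ef0; apply; apply/eqP/disj_edge.
  apply: pairwise_in (disL _ KL) _ _ pK qK _; first exact: disj_pair_sym.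
  by apply: contraNneq ef => ->.
exists C; split=> //.
  have /set0Pn[e] := CF0; rewrite !inE => /andP[eC /mapP[p pL ep]].
  by apply/hasP; exists p => //; rewrite -ep.
apply/allP => K KL; apply: in_pairwise.
  by apply: (@subseq_uniq _ K _ _ uL); move: KL; elim: (L) => //= K1 L1 IH;
    rewrite inE => /predU1P[->|/IH h]; [exact: prefix_subseq |
    apply: subseq_trans h (suffix_subseq _ _)].
move=> p q pK qK; apply: contraNN => /andP[pC qC].
have [pL qL] := (inL _ _ KL pK, inL _ _ KL qK).
have := inj (edge_of p) (edge_of q); rewrite !inE pC qC !map_f // => /(_ isT isT).
move=> /(_ _)/diff -> //; apply: eq_in_find => K' K'L.
rewrite !mapE //; apply/idP/idP => h.
  by rewrite -(uniq_flatten_mem uL KL K'L pK h).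
by rewrite -(uniq_flatten_mem uL KL K'L qK h).
Qed.

Lemma pairC (a b : T) : [set a; b] = [set b; a].
Proof. exact: setUC. Qed.

Lemma mem_nbr x y : (y \in nbr E x) = ([set x; y] \in E).
Proof. by rewrite inE. Qed.

Lemma nbr_sym x y : (y \in nbr E x) = (x \in nbr E y).
Proof. by rewrite !inE pairC. Qed.

Lemma nbr_neq x y : y \in nbr E x -> x != y.
Proof. by rewrite inE => /E2; rewrite cards2; case: (x != y). Qed.

(** The degree of [x] in [C], summed along a list of all neighbours of [x] in [E]; 2-regularity
    leaves the values 0 and 2. In this form each reducibility argument below becomes a propositional
    check on which of the few named edges belong to [C], done by [boolcases]. *)
Definition even_inc (C : {set {set T}}) (x : T) (s : seq T) :=
  let k := sumn [seq ([set x; y] \in C : nat) | y <- s] in (k == 0) || (k == 2).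

Lemma circuit_degree C x (s : seq T) : CC C -> C \subset E -> uniq s ->
  nbr E x =i s -> even_inc C x s.
Proof.
move=> CCC sCE us Ns; rewrite /even_inc.
have -> : sumn [seq ([set x; y] \in C : nat) | y <- s] = #|nbr C x|.
  rewrite sumn_count -size_filter -(card_uniqP _) ?filter_uniq //.
  apply: eq_card => y; rewrite mem_filter /= inE -Ns inE.
  by apply/andP/idP => [[]|h] //; split=> //; apply: (subsetP sCE).
have [->|/(CC_regular CCC) ->] := eqVneq (nbr C x) set0; by rewrite ?cards0.
Qed.

Lemma mem_pair_set (a b : T) : [set a; b] =i [:: a; b].
Proof. by move=> z; rewrite !inE. Qed.
Lemma mem_triple_set (a b c : T) : [set a; b; c] =i [:: a; b; c].
Proof. by move=> z; rewrite !inE orbA. Qed.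

Ltac vneq :=
  rewrite /= /same_pair /disj_pair ?inE /=;
  repeat match goal with
  | H : is_true (?a != ?b) |- context [?a == ?b] => rewrite (negbTE H)
  | H : is_true (?a != ?b) |- context [?b == ?a] => rewrite (eq_sym b a) (negbTE H)
  end; rewrite /= ?andbT ?andbF ?orbF //=.

Ltac config L C CCC sCE hit cls :=
  have [| | | |C [CCC sCE hit cls]] := @critical_classes L;
  [ by [] | rewrite /edge_of /= | by vneq | by vneq | ].

Ltac boolcases :=
  repeat match goal with |- context [?e \in ?C] => case: (e \in C) end.

Lemma min_degree x y : y \in nbr E x -> 2 <= #|nbr E x|.
Proof.
rewrite mem_nbr => xyE.
config [:: [:: (x, y)]] C CCC sCE hit cls; first by rewrite xyE.
move: hit; rewrite /= orbF /edge_of /= => xyC.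
rewrite -(CC_regular CCC (x := x)); last by apply/set0Pn; exists y; rewrite inE.
by apply/subset_leq_card/subsetP => z; rewrite !inE => /(subsetP sCE).
Qed.

Lemma other_nbr x y : #|nbr E x| = 2 -> y \in nbr E x ->
  exists2 z, nbr E x = [set y; z] & [/\ y != z, x != z & x \in nbr E z].
Proof.
move=> N2 yx; have /cards2P[a [b [ab Nx]]] : #|nbr E x| == 2 by rewrite N2.
have := yx; rewrite Nx !inE => /orP[]/eqP ?; subst y.
  have bx : b \in nbr E x by rewrite Nx !inE eqxx orbT.
  by exists b => //; split=> //; [apply: nbr_neq | rewrite nbr_sym].
have ax : a \in nbr E x by rewrite Nx !inE eqxx.
exists a; first by rewrite setUC.
by split; [rewrite eq_sym | apply: nbr_neq | rewrite nbr_sym].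
Qed.

(** Let u and v be the other neighbours of x and y. If they differ, the edges xu and yv get one
    fresh colour, but a cycle using either of them runs u x y v and uses both. If they coincide, a
    fresh colour on xy alone forces the triangle x y u. *)
Lemma no_adjacent_deg2 x y : y \in nbr E x -> #|nbr E x| = 2 -> #|nbr E y| = 2 ->
  False.
Proof.
move=> yx x2 y2; have xy := yx; rewrite nbr_sym in xy.
have nxy := nbr_neq yx.
have [u Nx [yu xu ux]] := other_nbr x2 yx.
have [v Ny [xv yv vy]] := other_nbr y2 xy.
rewrite mem_nbr in ux; rewrite mem_nbr in vy; rewrite mem_nbr in xy.
have [uv|uv] := eqVneq u v.
  subst v; config [:: [:: (x, y)]] C CCC sCE hit cls; first by rewrite pairC xy.
  have hx : even_inc C x [:: y; u] by apply: circuit_degree => //; [vneq | rewrite Nx; apply: mem_pair_set].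
  have hy : even_inc C y [:: x; u] by apply: circuit_degree => //; [vneq | rewrite Ny; apply: mem_pair_set].
  have tri := CC_triangle (x := x) (y := y) (z := u) CCC.
  move: hit hx hy tri; rewrite /even_inc /edge_of /= (pairC y x); boolcases => // _ _ _ h.
  exact: h.
config [:: [:: (x, u); (y, v)]] C CCC sCE hit cls; first by rewrite pairC ux pairC vy.
have hx : even_inc C x [:: y; u] by apply: circuit_degree => //; [vneq | rewrite Nx; apply: mem_pair_set].
have hy : even_inc C y [:: x; v] by apply: circuit_degree => //; [vneq | rewrite Ny; apply: mem_pair_set].
by move: hit cls hx hy; rewrite /even_inc /edge_of /= (pairC y x); boolcases.
Qed.

Ltac degree h C x s N :=
  have h : even_inc C x s by
    apply: circuit_degree => //; [by vneq | by move=> ?; rewrite N !inE ?orbA].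

Lemma other_nbr_deg2 x y : #|nbr E x| = 2 -> y \in nbr E x ->
  exists z, [/\ nbr E x = [set y; z], y != z, x != z, [set x; z] \in E &
    #|nbr E z| != 2].
Proof.
move=> x2 yx; have [z Nx [yz xz zx]] := other_nbr x2 yx; exists z; split=> //.
  by rewrite pairC -mem_nbr.
by apply/eqP => z2; apply: (@no_adjacent_deg2 x z) => //; rewrite nbr_sym.
Qed.

Lemma card_neq x y : #|nbr E x| = 2 -> #|nbr E y| != 2 -> x != y.
Proof. by move=> x2; apply: contraNneq => <-; rewrite x2. Qed.

(** A cycle meeting the configuration passes through v and leaves by two of a, b, c; having degree
    2, these also contribute their outer edges. The classes pair inner with outer edges cyclically,
    so any two of a, b, c supply both edges of some class. *)
Lemma deg3_not_three v a b c : nbr E v = [set a; b; c] -> a != b -> a != c -> b != c ->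
  #|nbr E a| = 2 -> #|nbr E b| = 2 -> #|nbr E c| = 2 -> False.
Proof.
move=> Nv ab ac bc a2 b2 c2.
have [va vb vc] : [/\ [set v; a] \in E, [set v; b] \in E & [set v; c] \in E].
  by rewrite -!mem_nbr Nv !inE !eqxx !orbT.
have [a' [Na va' aa' Ea a'2]] := @other_nbr_deg2 a v a2 ltac:(by rewrite nbr_sym mem_nbr).
have [b' [Nb vb' bb' Eb b'2]] := @other_nbr_deg2 b v b2 ltac:(by rewrite nbr_sym mem_nbr).
have [c' [Nc vc' cc' Ec c'2]] := @other_nbr_deg2 c v c2 ltac:(by rewrite nbr_sym mem_nbr).
have [nva nvb nvc] : [/\ v != a, v != b & v != c].
  by split; apply: nbr_neq; rewrite mem_nbr.
have [ab' ac' ba'] := And3 (card_neq a2 b'2) (card_neq a2 c'2) (card_neq b2 a'2).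
have [bc' ca' cb'] := And3 (card_neq b2 c'2) (card_neq c2 a'2) (card_neq c2 b'2).
config [:: [:: (v, a); (b, b')]; [:: (v, b); (c, c')]; [:: (v, c); (a, a')]] C CCC sCE hit cls.
  by rewrite va vb vc Ea Eb Ec.
degree hv C v [:: a; b; c] Nv; degree ha C a [:: v; a'] Na.
degree hb C b [:: v; b'] Nb; degree hc C c [:: v; c'] Nc.
by move: hit cls hv ha hb hc;
  rewrite /even_inc /edge_of /= (pairC a v) (pairC b v) (pairC c v); boolcases.
Qed.

(* The remaining configuration is not reducible: it is the bad vertex of the
   discharging below. *)
Lemma deg3_two v a b w : nbr E v = [set a; b; w] -> a != b -> a != w -> b != w ->
  #|nbr E a| = 2 -> #|nbr E b| = 2 -> #|nbr E w| != 2 ->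
  exists u, [/\ nbr E a = [set v; u], nbr E b = [set v; u], u != w, u != v &
    #|nbr E u| != 2].
Proof.
move=> Nv ab aw bw a2 b2 w2.
have [va vb vw] : [/\ [set v; a] \in E, [set v; b] \in E & [set v; w] \in E].
  by rewrite -!mem_nbr Nv !inE !eqxx !orbT.
have [a' [Na va' aa' Ea a'2]] := @other_nbr_deg2 a v a2 ltac:(by rewrite nbr_sym mem_nbr).
have [b' [Nb vb' bb' Eb b'2]] := @other_nbr_deg2 b v b2 ltac:(by rewrite nbr_sym mem_nbr).
have [nva nvb nvw] : [/\ v != a, v != b & v != w].
  by split; apply: nbr_neq; rewrite mem_nbr.
have [ab' ba'] := conj (card_neq a2 b'2) (card_neq b2 a'2).
have [ea|na] := eqVneq a' w; have [eb|nb] := eqVneq b' w.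
- exfalso; subst a' b'.
  config [:: [:: (v, a); (b, w)]] C CCC sCE hit cls; first by rewrite va Eb.
  degree hv C v [:: a; b; w] Nv; degree ha C a [:: v; w] Na; degree hb C b [:: v; w] Nb.
  have ta := CC_triangle (x := v) (y := a) (z := w) CCC.
  have tb := CC_triangle (x := v) (y := b) (z := w) CCC.
  move: hit cls hv ha hb ta tb; rewrite /even_inc /edge_of /= (pairC a v) (pairC b v).
  by boolcases => // _ _ _ _ _ h1 h2; first [case: (h1 isT isT isT) | case: (h2 isT isT isT)].
- exfalso; subst a'.
  config [:: [:: (a, w); (v, b)]; [:: (b, b'); (v, w)]] C CCC sCE hit cls.
    by rewrite Ea vb Eb vw.
  degree hv C v [:: a; b; w] Nv; degree ha C a [:: v; w] Na; degree hb C b [:: v; b'] Nb.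
  have ta := CC_triangle (x := v) (y := a) (z := w) CCC.
  move: hit cls hv ha hb ta; rewrite /even_inc /edge_of /= (pairC a v) (pairC b v).
  by boolcases => // _ _ _ _ _ h1; case: (h1 isT isT isT).
- exfalso; subst b'.
  config [:: [:: (b, w); (v, a)]; [:: (a, a'); (v, w)]] C CCC sCE hit cls.
    by rewrite va Ea Eb vw.
  degree hv C v [:: a; b; w] Nv; degree ha C a [:: v; a'] Na; degree hb C b [:: v; w] Nb.
  have ta := CC_triangle (x := v) (y := b) (z := w) CCC.
  move: hit cls hv ha hb ta; rewrite /even_inc /edge_of /= (pairC a v) (pairC b v).
  by boolcases => // _ _ _ _ _ h1; case: (h1 isT isT isT).
have [eab|nab] := eqVneq a' b'.
  by subst b'; exists a'; split=> //; rewrite eq_sym.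
exfalso.
config [:: [:: (v, w); (a, a'); (b, b')]] C CCC sCE hit cls; first by rewrite vw Ea Eb.
degree hv C v [:: a; b; w] Nv; degree ha C a [:: v; a'] Na; degree hb C b [:: v; b'] Nb.
by move: hit cls hv ha hb; rewrite /even_inc /edge_of /= (pairC a v) (pairC b v); boolcases.
Qed.

(** A cycle meeting the configuration either is v a u b or runs w v a u z or w v b u z (closing up
    at once if w = z). The classes are chosen so that each possibility contains two edges of one
    class. *)
Lemma twin_not_deg3 v a b w u z : nbr E v = [set a; b; w] -> a != b -> a != w -> b != w ->
  nbr E a = [set v; u] -> nbr E b = [set v; u] -> u != w -> u != v ->
  a != z -> b != z -> nbr E u = [set a; b; z] -> False.
Proof.
move=> Nv ab aw bw Na Nb uw uv az bz Nu.
have [va vb vw] : [/\ [set v; a] \in E, [set v; b] \in E & [set v; w] \in E].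
  by rewrite -!mem_nbr Nv !inE !eqxx !orbT.
have [ua ub uz] : [/\ [set u; a] \in E, [set u; b] \in E & [set u; z] \in E].
  by rewrite -!mem_nbr Nu !inE !eqxx !orbT.
have [nva nvb nvw] : [/\ v != a, v != b & v != w].
  by split; apply: nbr_neq; rewrite mem_nbr.
have [nua nub nuz] : [/\ u != a, u != b & u != z].
  by split; apply: nbr_neq; rewrite mem_nbr.
have nvz : v != z.
  apply/eqP => e; have : u \in nbr E v by rewrite mem_nbr pairC e.
  by rewrite Nv !inE; apply/negP; rewrite !negb_or nua nub uw.
(* If w = z, the edges vw and uz meet and cannot share a colour, so another pairing is needed. *)
have [wz|wz] := eqVneq w z.
  subst z; config [:: [:: (v, a); (u, b)]; [:: (v, b); (u, w)]; [:: (v, w); (u, a)]] C CCC sCE hit cls.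
    by rewrite va ub vb uz vw ua.
  degree hv C v [:: a; b; w] Nv; degree ha C a [:: v; u] Na; degree hb C b [:: v; u] Nb.
  degree hu C u [:: a; b; w] Nu.
  by move: hit cls hv ha hb hu; rewrite /even_inc /edge_of /= (pairC a v) (pairC b v)
    (pairC a u) (pairC b u); boolcases.
config [:: [:: (v, w); (u, z)]; [:: (u, a); (v, b)]] C CCC sCE hit cls.
  by rewrite vw uz ua vb.
degree hv C v [:: a; b; w] Nv; degree ha C a [:: v; u] Na; degree hb C b [:: v; u] Nb.
degree hu C u [:: a; b; z] Nu.
by move: hit cls hv ha hb hu; rewrite /even_inc /edge_of /= (pairC a v) (pairC b v)
  (pairC a u) (pairC b u); boolcases.
Qed.

(** If d' differs from w, the disjoint edges vw, uc, dd' share one colour and va, ub another: a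
    cycle here is v a u b, or else it uses two of the three exits at w, c, d. The case of c' is
    symmetric. If c' = d' = w, the exits meet in w and three classes are needed. *)
Lemma twin_not_deg4 v a b w u c d : nbr E v = [set a; b; w] ->
  a != b -> a != w -> b != w -> #|nbr E w| != 2 -> #|nbr E u| != 2 ->
  nbr E a = [set v; u] -> nbr E b = [set v; u] -> u != w -> u != v ->
  nbr E u = [set a; b; c; d] -> a != c -> a != d -> b != c -> b != d -> c != d ->
  #|nbr E c| = 2 -> #|nbr E d| = 2 -> False.
Proof.
move=> Nv ab aw bw w2 u2 Na Nb uw uv Nu ac ad bc bd cd c2 d2.
have [va vb vw] : [/\ [set v; a] \in E, [set v; b] \in E & [set v; w] \in E].
  by rewrite -!mem_nbr Nv !inE !eqxx !orbT.
have [[ua ub] [uc ud]] : ([set u; a] \in E /\ [set u; b] \in E) /\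
    ([set u; c] \in E /\ [set u; d] \in E).
  by rewrite -!mem_nbr Nu !inE !eqxx !orbT.
have [nva nvb nvw] : [/\ v != a, v != b & v != w].
  by split; apply: nbr_neq; rewrite mem_nbr.
have [[nua nub] [nuc nud]] : (u != a /\ u != b) /\ (u != c /\ u != d).
  by do !split; apply: nbr_neq; rewrite mem_nbr.
have v3 : #|nbr E v| = 3.
  have us : uniq [:: a; b; w] by vneq.
  by rewrite Nv (eq_card (mem_triple_set a b w)) (card_uniqP us).
have [cv dv] : c != v /\ d != v by split; apply: card_neq; rewrite ?v3.
have [cw dw] := conj (card_neq c2 w2) (card_neq d2 w2).
have [c' [Nc uc' cc' Ec c'2]] := @other_nbr_deg2 c u c2 ltac:(by rewrite nbr_sym mem_nbr).
have [d' [Nd ud' dd' Ed d'2]] := @other_nbr_deg2 d u d2 ltac:(by rewrite nbr_sym mem_nbr).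
have [a2 b2] : #|nbr E a| = 2 /\ #|nbr E b| = 2.
  by rewrite Na Nb !cards2 eq_sym uv.
have [[ac' ad'] [bc' bd']] := conj (conj (card_neq a2 c'2) (card_neq a2 d'2))
  (conj (card_neq b2 c'2) (card_neq b2 d'2)).
have [cd' dc'] := conj (card_neq c2 d'2) (card_neq d2 c'2).
have [vc' vd'] : v != c' /\ v != d'.
  split; apply/eqP => e.
    have : c \in nbr E v by rewrite mem_nbr e pairC.
    by rewrite Nv !inE; apply/negP; vneq.
  have : d \in nbr E v by rewrite mem_nbr e pairC.
  by rewrite Nv !inE; apply/negP; vneq.
have [ed|nd] := eqVneq w d'; last first.
  config [:: [:: (v, w); (u, c); (d, d')]; [:: (v, a); (u, b)]] C CCC sCE hit cls.
    by rewrite vw uc Ed va ub.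
  degree hv C v [:: a; b; w] Nv; degree ha C a [:: v; u] Na; degree hb C b [:: v; u] Nb.
  degree hu C u [:: a; b; c; d] Nu; degree hd C d [:: u; d'] Nd.
  by move: hit cls hv ha hb hu hd; rewrite /even_inc /edge_of /= (pairC a v) (pairC b v)
    (pairC a u) (pairC b u) (pairC d u); boolcases.
have [ec|nc] := eqVneq w c'; last first.
  config [:: [:: (v, w); (u, d); (c, c')]; [:: (v, a); (u, b)]] C CCC sCE hit cls.
    by rewrite vw ud Ec va ub.
  degree hv C v [:: a; b; w] Nv; degree ha C a [:: v; u] Na; degree hb C b [:: v; u] Nb.
  degree hu C u [:: a; b; c; d] Nu; degree hc C c [:: u; c'] Nc.
  by move: hit cls hv ha hb hu hc; rewrite /even_inc /edge_of /= (pairC a v) (pairC b v)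
    (pairC a u) (pairC b u) (pairC c u); boolcases.
subst c' d'.
config [:: [:: (v, a); (u, b); (d, w)]; [:: (v, w); (u, c)]; [:: (u, d); (c, w)]] C CCC sCE hit cls.
  by rewrite va ub Ed vw uc ud Ec.
degree hv C v [:: a; b; w] Nv; degree ha C a [:: v; u] Na; degree hb C b [:: v; u] Nb.
degree hu C u [:: a; b; c; d] Nu; degree hd C d [:: u; w] Nd; degree hc C c [:: u; w] Nc.
by move: hit cls hv ha hb hu hd hc; rewrite /even_inc /edge_of /= (pairC a v) (pairC b v)
  (pairC a u) (pairC b u) (pairC c u) (pairC d u); boolcases.
Qed.

(** By minimality both [S] and its complement in [E] are colourable. Glued with disjoint palettes,
    the two colourings leave only a member of [CC] meeting both parts as a possible rainbow one, and
    there must be one. *)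
Lemma critical_connected (S : {set {set T}}) : S != set0 -> S \proper E ->
  exists C, [/\ CC C, C \subset E, C :&: S != set0 & ~~ (C \subset S)].
Proof.
move=> S0 SE; case: critE => nE crit.
have [c [cp cn]] := crit S SE.
have [|d [dp dn]] := crit (E :\: S).
  rewrite properEneq subsetDl andbT; apply: contraNneq S0 => ES.
  apply/eqP/setP => e; rewrite inE; apply/negP => eS.
  by have := subsetP (proper_sub SE) e eS; rewrite -ES inE eS.
apply: contrapT => /forallNP H; apply: nE.
pose c' e := if e \in S then (c e).*2 else (d e).*2.+1.
have parity m n : m.*2 = n.*2.+1 -> False by move=> /(congr1 odd); rewrite /= !odd_double.
exists c'; split => [e f eE fE ef ef0|C CCC sCE].
  rewrite /c'; case: ifP => eF; case: ifP => fF.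
  - by move=> /double_inj; apply: cp.
  - by move/parity.
  - by move/esym/parity.
  - by move=> [/double_inj]; apply: dp => //; rewrite inE ?eF ?fF.
have [CS|nCS] := boolP (C \subset S).
  have [e [f [eC fC ef cef]]] := cn C CCC CS; exists e, f; split=> //.
  by rewrite /c' !(subsetP CS) // cef.
have [CS0|CS0] := eqVneq (C :&: S) set0; last by case: (H C).
have sC : C \subset E :\: S.
  by rewrite subsetD sCE -setI_eq0 CS0 eqxx.
have [e [f [eC fC ef cef]]] := dn C CCC sC; exists e, f; split=> //.
have [/setDP[_ /negbTE eF] /setDP[_ /negbTE fF]] := (subsetP sC e eC, subsetP sC f fC).
by rewrite /c' eF fF cef.
Qed.

Lemma card3_set (S : {set T}) : #|S| = 3 ->
  exists a b c, [/\ a != b, a != c & b != c] /\ S = [set a; b; c].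
Proof.
have [[|a [|b [|c [|d r]]]] //= us] := cards_eqP; move=> _; exists a, b, c.
move: us; rewrite !inE negb_or andbT => /andP[/andP[ab ac] bc]; split=> //.
by apply/setP => x; rewrite !inE orbA.
Qed.

Lemma handshake : \sum_x #|nbr E x| = 2 * #|E|.
Proof.
transitivity (\sum_x \sum_(e in E) (x \in e : nat)).
  apply: eq_bigr => x _; rewrite -big_mkcondr sum1_card.
  rewrite -(@card_in_imset _ _ (fun y => [set x; y])) => [|y z /nbr_neq xy /nbr_neq xz].
    apply: eq_card => e; apply/imsetP/andP => [[y yx ->]|[eE xe]].
      by rewrite -mem_nbr yx !inE eqxx.
    have /cards2P[a [b [_ eab]]] : #|e| == 2 by rewrite E2.
    move: xe; rewrite eab !inE => /orP[]/eqP ?; subst x.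
      by exists b; rewrite // mem_nbr -eab.
    by exists a; rewrite 1?pairC // mem_nbr pairC -eab.
  move=> /setP/(_ y); rewrite !inE eqxx orbT eq_sym (negbTE xy) /=.
  by move/esym/eqP.
rewrite exchange_big /= (eq_bigr (fun=> 2)) ?sum_nat_const 1?mulnC // => e eE.
by rewrite -(E2 eE) -sum1_card [RHS]big_mkcond /=; apply: eq_bigr => x _; case: (x \in e).
Qed.

(* Discharging: x starts with charge 3 deg x - 8, where sum_x deg x = 2|E|, and gives 1
   to each neighbour of degree 2. A bad vertex, short of 1 afterwards, gets it from
   a vertex u, its twin, that is adjacent to both of its neighbours of degree 2. *)
Let A := [set x | #|nbr E x| == 2].
Let alpha x := #|nbr E x :&: A|.
Let bad v := (#|nbr E v| == 3) && (alpha v == 2).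
Let twin u v := (u != v) && (nbr E v :&: A \subset nbr E u).
Let beta u := #|[set v | bad v && twin u v]|.

Lemma inA x : (x \in A) = (#|nbr E x| == 2). Proof. by rewrite inE. Qed.

Lemma bad_split v : bad v -> exists a b w, [/\ nbr E v = [set a; b; w],
  nbr E v :&: A = [set a; b], [/\ a != b, a != w & b != w],
  #|nbr E a| = 2 /\ #|nbr E b| = 2 & #|nbr E w| != 2].
Proof.
move=> /andP[/eqP v3 /eqP a2].
have /cards2P[a [b [ab NA]]] : #|nbr E v :&: A| == 2 by rewrite -/(alpha v) a2.
have /setIP[av aA] : a \in nbr E v :&: A by rewrite NA !inE eqxx.
have /setIP[bv bA] : b \in nbr E v :&: A by rewrite NA !inE eqxx orbT.
have : #|nbr E v :\: A| == 1 by rewrite cardsD v3 -/(alpha v) a2.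
case/cards1P => w Nw; exists a, b, w.
have /setDP[wv wA] : w \in nbr E v :\: A by rewrite Nw inE.
rewrite !inA in aA bA wA; split=> //.
- by rewrite -(setID (nbr E v) A) NA Nw.
- by split=> //; apply: card_neq => //; apply/eqP.
- by split; apply/eqP.
Qed.

Lemma bad_has_twin v : bad v -> exists u, twin u v.
Proof.
move=> /bad_split[a [b [w [Nv NA [ab aw bw] [a2 b2] w2]]]].
have [u [Na Nb uw uv u2]] := deg3_two Nv ab aw bw a2 b2 w2.
exists u; rewrite /twin uv NA; apply/subsetP => x.
by rewrite !inE pairC => /orP[]/eqP->; rewrite -mem_nbr ?Na ?Nb !inE eqxx orbT.
Qed.

Lemma twin_split u v : bad v -> twin u v -> exists a b w, [/\
  nbr E v = [set a; b; w], [/\ a != b, a != w & b != w],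
  #|nbr E w| != 2 /\ #|nbr E u| != 2,
  (nbr E a = [set v; u] /\ nbr E b = [set v; u]) & u != w /\ u != v].
Proof.
move=> /bad_split[a [b [w [Nv NA [ab aw bw] [a2 b2] w2]]]] /andP[uv sN].
have [u' [Na Nb uw uv' u2]] := deg3_two Nv ab aw bw a2 b2 w2.
have : a \in nbr E u by apply: (subsetP sN); rewrite NA !inE eqxx.
rewrite nbr_sym Na !inE (negbTE uv) /= => /eqP ?; subst u'.
by exists a, b, w.
Qed.

(** A neighbour of u of degree 2 has only one further neighbour, hence serves at most one bad vertex
    with twin u, while every such bad vertex takes two of them. *)
Lemma double_beta_le u : 2 * beta u <= alpha u.
Proof.
rewrite /beta mulnC -sum_nat_const.
rewrite (eq_bigr (fun v => \sum_(a in nbr E u :&: A) (a \in nbr E v : nat))); last first.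
  move=> v; rewrite inE => /andP[bv /andP[_ sN]]; have /andP[_ /eqP <-] := bv.
  rewrite -big_mkcondr sum1_card /alpha; apply: eq_card => a.
  rewrite [RHS]unfold_in /= !inE; apply/andP/andP => [[av aA]|[/andP[_ aA] av]] //.
  by rewrite av aA andbT -mem_nbr; split=> //; apply: (subsetP sN); rewrite !inE av.
rewrite exchange_big /= /alpha -sum1_card; apply: leq_sum => a /setIP[au aA].
rewrite inA in aA; move/eqP in aA.
have [z Na [uz az zx]] := other_nbr aA ltac:(by rewrite nbr_sym; apply: au).
rewrite -big_mkcondr sum1_card -(cards1 z); apply/subset_leq_card/subsetP => v.
move=> vin; have {vin} : (v \in [set v | bad v && twin u v]) && (a \in nbr E v) := vin.
rewrite inE => /andP[/andP[_ /andP[uv _]]].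
by rewrite nbr_sym Na !inE eq_sym (negbTE uv).
Qed.

Lemma alpha_le x : alpha x <= #|nbr E x|.
Proof. exact/subset_leq_card/subsetIl. Qed.

(** Here [alpha x] and [beta x] are the charges given away. From degree 4 on, [double_beta_le]
    suffices except for degree 4 with [alpha x = 4]. There, as in degree 3, the reducible
    configurations force [beta x = 0]; in degree 3 they also exclude [alpha x = 3]. *)
Lemma local_charge x : nbr E x != set0 ->
  8 + alpha x + beta x <= 3 * #|nbr E x| + 2 * (x \in A) + bad x.
Proof.
move=> /set0Pn[y yx]; have d2 := min_degree yx; have b2 := double_beta_le x.
have al := alpha_le x; rewrite inA.
have [deg2|deg_n2] := eqVneq #|nbr E x| 2.
  have a0 : alpha x = 0.
    apply/eqP; rewrite cards_eq0; apply/eqP/setP => z; rewrite !inE.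
    apply/negP => /andP[xz /eqP z2].
    by apply: (@no_adjacent_deg2 x z) => //; rewrite mem_nbr.
  by rewrite deg2 /=; lia.
have [deg3|deg_n3] := eqVneq #|nbr E x| 3.
  have a3 : alpha x <> 3.
    move=> a3; have NA : nbr E x :&: A = nbr E x.
      by apply/eqP; rewrite eqEcard subsetIl deg3 -/(alpha x) a3.
    have : #|nbr E x| == 3 by apply/eqP.
    case/eqP/card3_set => a [b [c [[ab ac bc] Nx]]].
    have h z : z \in nbr E x -> #|nbr E z| = 2.
      by rewrite -NA => /setIP[_]; rewrite inA => /eqP.
    apply: (@deg3_not_three x a b c) => //.
    - by apply: h; rewrite Nx !inE eqxx.
    - by apply: h; rewrite Nx !inE eqxx orbT.
    - by apply: h; rewrite Nx !inE eqxx !orbT.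
  have beta0 : beta x = 0.
    apply/eqP; rewrite cards_eq0; apply/eqP/setP => v; rewrite !inE.
    apply/negP => /andP[bv tv].
    have [a [b [w [Nv [ab aw bw] [w2 u2] [Na Nb] [uw uv]]]]] := twin_split bv tv.
    have [ax bx] : a \in nbr E x /\ b \in nbr E x.
      by rewrite !(nbr_sym x) Na Nb !inE eqxx orbT.
    have : #|nbr E x :\: [set a; b]| == 1.
      rewrite cardsD deg3 (setIidPr _) ?cards2 ?ab //.
      by apply/subsetP => z; rewrite !inE -mem_nbr => /orP[]/eqP->.
    case/cards1P => z Nz.
    have /setDP[zx] : z \in nbr E x :\: [set a; b] by rewrite Nz inE.
    rewrite !inE negb_or => /andP[za zb].
    apply: (@twin_not_deg3 v a b w x z) => //; try by rewrite eq_sym.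
    by rewrite -[LHS](setID _ [set a; b]) (setIidPr _) ?Nz //;
      apply/subsetP => t; rewrite !inE -mem_nbr => /orP[]/eqP->.
  by rewrite deg3 /bad deg3 eqxx /=; case: eqP => /= ?; lia.
have [[deg4 a4]|n44] : (#|nbr E x| = 4 /\ alpha x = 4) \/ ~ (#|nbr E x| = 4 /\ alpha x = 4).
- exact: EM.
- have beta0 : beta x = 0.
    apply/eqP; rewrite cards_eq0; apply/eqP/setP => v; rewrite !inE.
    apply/negP => /andP[bv tv].
    have [a [b [w [Nv [ab aw bw] [w2 u2] [Na Nb] [uw uv]]]]] := twin_split bv tv.
    have [ax bx] : a \in nbr E x /\ b \in nbr E x.
      by rewrite !(nbr_sym x) Na Nb !inE eqxx orbT.
    have sab : [set a; b] \subset nbr E x.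
      by apply/subsetP => z; rewrite !inE -mem_nbr => /orP[]/eqP->.
    have /cards2P[c [d [cd Nz]]] : #|nbr E x :\: [set a; b]| == 2.
      by rewrite cardsD deg4 (setIidPr _) ?cards2 ?ab.
    have NA : nbr E x :&: A = nbr E x.
      by apply/eqP; rewrite eqEcard subsetIl deg4 -/(alpha x) a4.
    have h z : z \in nbr E x -> #|nbr E z| = 2.
      by rewrite -NA => /setIP[_]; rewrite inA => /eqP.
    have /setDP[cx cab] : c \in nbr E x :\: [set a; b] by rewrite Nz !inE eqxx.
    have /setDP[dx dab] : d \in nbr E x :\: [set a; b] by rewrite Nz !inE eqxx orbT.
    move: cab dab; rewrite !inE !negb_or => /andP[ca cb] /andP[da db].
    apply: (@twin_not_deg4 v a b w x c d) => //; try (by rewrite eq_sym); try exact: h.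
    by rewrite -[LHS](setID _ [set a; b]) (setIidPr sab) Nz setUA.
  by rewrite deg4 a4 beta0; lia.
- by lia.
Qed.

Lemma critical_dense : 4 * #|cover E| <= 3 * #|E|.
Proof.
have -> : cover E = [set x | nbr E x != set0].
  apply/setP => x; rewrite inE; apply/bigcupP/set0Pn => [[e eE xe]|[y]].
    have /cards2P[a [b [_ eab]]] : #|e| == 2 by rewrite E2.
    move: xe; rewrite eab !inE => /orP[]/eqP ->.
      by exists b; rewrite mem_nbr -eab.
    by exists a; rewrite mem_nbr pairC -eab.
  by rewrite mem_nbr => h; exists [set x; y] => //; rewrite !inE eqxx.
have sum_alpha : \sum_x alpha x = 2 * #|A|.
  rewrite /alpha; transitivity (\sum_x \sum_(a in A) (a \in nbr E x : nat)).
    apply: eq_bigr => x _; rewrite -big_mkcondr sum1_card; apply: eq_card => a.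
    by rewrite [RHS]unfold_in /= !inE andbC.
  rewrite exchange_big /= mulnC -sum_nat_const; apply: eq_bigr => a.
  rewrite inA => /eqP <-; rewrite -sum1_card [RHS]big_mkcond /=.
  by apply: eq_bigr => x _; rewrite nbr_sym; case: (_ \in _).
have sum_bad : \sum_x (bad x : nat) <= \sum_u beta u.
  rewrite [leqRHS](eq_bigr (fun u => \sum_v (bad v && twin u v : nat))).
    rewrite exchange_big /=; apply: leq_sum => v _.
    have [bv|nbv] := boolP (bad v); last by [].
    by have [u tu] := bad_has_twin bv; rewrite (bigD1 u) //= tu.
  move=> u _; rewrite /beta -sum1_card big_mkcond /=; apply: eq_bigr => v _.
  by rewrite inE; case: (bad v && _).
pose V := [set x | nbr E x != set0].
have out x : x \notin V -> [/\ alpha x = 0, beta x = 0, #|nbr E x| = 0 & bad x = false].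
  rewrite inE negbK => /eqP N0; have := alpha_le x; have := double_beta_le x.
  by rewrite /bad N0 cards0; split; lia.
have : \sum_(x in V) (8 + alpha x + beta x) <=
       \sum_(x in V) (3 * #|nbr E x| + 2 * (x \in A) + bad x).
  by apply: leq_sum => x; rewrite inE; apply: local_charge.
have split3 (f g h : T -> nat) : \sum_(x in V) (f x + g x + h x) =
    \sum_(x in V) f x + \sum_(x in V) g x + \sum_(x in V) h x.
  by rewrite !big_split.
have eL := split3 (fun=> 8) alpha beta.
have eR := split3 (fun x => 3 * #|nbr E x|) (fun x => 2 * (x \in A)) (fun x => bad x : nat).
cbv beta in eL, eR; rewrite eL eR sum_nat_const {eL eR split3}.
have full (g : T -> nat) : (forall x, x \notin V -> g x = 0) ->
    \sum_(x in V) g x = \sum_x g x.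
  by move=> g0; rewrite [RHS](bigID (mem V)) /= [X in _ = _ + X]big1 ?addn0.
rewrite (full alpha); last by move=> x /out[].
rewrite (full beta); last by move=> x /out[].
rewrite [X in _ <= X + _ + _](full (fun x => 3 * #|nbr E x|)); last by move=> x /out[_ _ ->].
rewrite [X in _ <= _ + X + _](full (fun x => 2 * (x \in A))); last by move=> x /out[_ _ N0 _]; rewrite inA N0.
rewrite [X in _ <= _ + X](full (fun x => bad x : nat)); last by move=> x /out[_ _ _ ->].
have -> : \sum_x 3 * #|nbr E x| = 6 * #|E|.
  by rewrite -(mulnA 3 2) -handshake big_distrr.
have -> : \sum_x 2 * (x \in A) = 2 * #|A|.
  rewrite -sum1_card [in RHS]big_mkcond big_distrr /=.
  by apply: eq_bigr => x _; case: (x \in A).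
(* The terms 2|A| cancel and the total of [bad] is at most that of [beta], which leaves 8|V| <=
   6|E|. *)
rewrite sum_alpha; move: sum_bad.
move: (\sum_x _) (\sum_u beta u) #|A| #|V| #|E|; clear=> b t a v e.
lia.
Qed.

End OneCritical.
End Critical.

(** * Cycles as edge sets *)

Section Cycles.
Local Open Scope nat_scope.
Variables (T : finType) (l : nat).
Implicit Types (x : {ffun 'I_l -> T}).

Definition cyc x : {set {set T}} := [set [set x i; x (ordS i)] | i : 'I_l].

Definition is_cycle (C : {set {set T}}) : bool :=
  [exists x : {ffun 'I_l -> T}, injectiveb x && (C == cyc x)].

Lemma is_cycleP C : reflect (exists2 x : {ffun 'I_l -> T}, injective x & C = cyc x) (is_cycle C).
Proof.
apply: (iffP existsP) => [[x /andP[/injectiveP ix /eqP ->]]|[x ix ->]].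
  by exists x.
by exists x; rewrite eqxx andbT; apply/injectiveP.
Qed.

Hypothesis l3 : 2 < l.

Lemma modn_shift_neq (i : 'I_l) k : 0 < k < l -> (i + k) %% l != i.
Proof.
move=> /andP[k0 kl]; apply/eqP => h.
have : i + k == i + 0 %[mod l] by rewrite h addn0 modn_small.
by rewrite eqn_modDl mod0n modn_small // => /eqP; lia.
Qed.

Lemma ordS_neq (i : 'I_l) : ordS i != i.
Proof. by rewrite -val_eqE /= -addn1 modn_shift_neq //; lia. Qed.

Lemma ordSS_neq (i : 'I_l) : ordS (ordS i) != i.
Proof.
by rewrite -val_eqE /= -addn1 -[i.+1]addn1 modnDml -addnA modn_shift_neq //; lia.
Qed.

Lemma ordSSS_neq (i : 'I_l) : 3 < l -> ordS (ordS (ordS i)) != i.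
Proof.
move=> l4; rewrite -val_eqE /= -addn1 -[(_ %% l).+1]addn1 -[i.+1]addn1.
by rewrite modnDml -addnA modnDml -addnA modn_shift_neq //; lia.
Qed.

Lemma cyc_edge_inj x : injective x ->
  injective (fun i : 'I_l => [set x i; x (ordS i)]).
Proof.
move=> ix i j /setP e; have := e (x i); rewrite !inE eqxx /= => /esym/orP[/eqP/ix //|].
move/eqP/ix => eij; have := e (x (ordS i)); rewrite !inE eqxx orbT /= => /esym/orP[].
  by move/eqP/ix => h; have := ordSS_neq j; rewrite -eij h eqxx.
by move/eqP/ix => h; have := ordS_neq i; rewrite h -eij eqxx.
Qed.

Lemma card_cyc x : injective x -> #|cyc x| = l.
Proof. by move=> ix; rewrite card_imset ?card_ord //; apply: cyc_edge_inj. Qed.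

Lemma mem_cyc x (i : 'I_l) : [set x i; x (ordS i)] \in cyc x.
Proof. exact: imset_f. Qed.

Lemma cyc_two_sets x : injective x -> two_sets (cyc x).
Proof.
move=> ix e /imsetP[i _ ->]; rewrite cards2 (inj_eq ix) eq_sym.
by rewrite (negbTE (ordS_neq i)).
Qed.

Lemma cyc_edgeP x (i : 'I_l) v : injective x -> [set x i; v] \in cyc x ->
  v = x (ordS i) \/ v = x (ord_pred i).
Proof.
move=> ix /imsetP[j _ /setP e].
have := e (x i); rewrite !inE eqxx /= => /esym/orP[/eqP/ix h|/eqP/ix h]; subst.
  left; have := e (x (ordS j)); rewrite !inE eqxx orbT (inj_eq ix).
  by rewrite (negbTE (ordS_neq j)) /= => /eqP.
right; rewrite ordSK; have := e (x j); rewrite !inE eqxx (inj_eq ix) eq_sym.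
by rewrite (negbTE (ordS_neq j)) /= => /eqP.
Qed.

Lemma nbr_cyc x (i : 'I_l) : injective x ->
  nbr (cyc x) (x i) = [set x (ordS i); x (ord_pred i)].
Proof.
move=> ix; apply/setP => v; rewrite !inE; apply/idP/orP => [/cyc_edgeP|[]/eqP->].
- by move=> /(_ ix)[]->; rewrite eqxx; [left | right].
- exact: mem_cyc.
- by rewrite setUC -{2}[i]ord_predK mem_cyc.
Qed.

Lemma cycle_regular C v : is_cycle C -> nbr C v != set0 -> #|nbr C v| = 2.
Proof.
move=> /is_cycleP[x ix ->] /set0Pn[y]; rewrite inE => /imsetP[j _ /setP e].
have : v \in [set x j; x (ordS j)] by rewrite -e !inE eqxx.
have deg i : #|nbr (cyc x) (x i)| = 2.
  rewrite nbr_cyc // cards2 (inj_eq ix); case: eqP => // h.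
  by have := ordSS_neq (ord_pred i); rewrite ord_predK h eqxx.
by rewrite !inE => /orP[]/eqP->.
Qed.

Lemma cycle_triangle C u v w : 3 < l -> is_cycle C ->
  [set u; v] \in C -> [set v; w] \in C -> [set u; w] \in C -> False.
Proof.
move=> l4 /is_cycleP[x ix ->] uv vw uw.
have [i ui] : exists i, u = x i.
  have /imsetP[j _ /setP e] := uv.
  have : u \in [set x j; x (ordS j)] by rewrite -e !inE eqxx.
  by rewrite !inE => /orP[]/eqP->; eexists.
have nvw : v != w by move/(cyc_two_sets ix): vw; rewrite cards2; case: (v != w).
subst u.
have key j : [set x (ordS j); x (ord_pred j)] \in cyc x -> False.
  move=> /(cyc_edgeP ix)[/ix h|/ix].
    by have := ordSSS_neq (ord_pred j) l4; rewrite ord_predK -h eqxx.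
  rewrite ordSK => h; have := ordS_neq (ord_pred j).
  by rewrite ord_predK {1}h eqxx.
move: (cyc_edgeP ix uv) (cyc_edgeP ix uw) nvw vw => [->|->] [->|->]; rewrite ?eqxx // => _.
  exact: key.
by rewrite setUC; apply: key.
Qed.

(** The exploration enumerates a cycle from the arc through which it was found, so its
    parametrisation must be able to start at any position. *)
Lemma rotate_cycle x (i : 'I_l) : injective x -> exists x' : {ffun 'I_l -> T},
  [/\ injective x', cyc x' = cyc x &
    forall j : 'I_l, x' j = x (iter j (@ordS l) i)].
Proof.
move=> ix; pose x' : {ffun 'I_l -> T} := [ffun j : 'I_l => x (iter j (@ordS l) i)].
have iterE j : nat_of_ord (iter j (@ordS l) i) = (i + j) %% l.
  elim: j => [|j IH]; first by rewrite addn0 modn_small.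
  by rewrite iterS /= IH -addn1 modnDml addn1 addnS.
have S_ (j : 'I_l) : iter (ordS j) (@ordS l) i = ordS (iter j (@ordS l) i).
  by apply: val_inj; rewrite /= !iterE modnDmr addnS -addn1 -[in RHS]addn1 modnDml.
have inj_it : injective (fun j : 'I_l => iter j (@ordS l) i).
  move=> j k /(congr1 (@nat_of_ord l)); rewrite !iterE => /eqP; rewrite eqn_modDl !modn_small //.
  by move/eqP/val_inj.
exists x'; split=> [j k||j]; last by rewrite ffunE.
  by rewrite !ffunE => /ix/inj_it.
apply/eqP; rewrite eqEcard !card_cyc // ?leqnn ?andbT; last first.
  by move=> j k; rewrite !ffunE => /ix/inj_it.
apply/subsetP => e /imsetP[j _ ->]; rewrite !ffunE S_; exact: mem_cyc.
Qed.

Lemma isomorphic_cycle (J : graph T) : isomorphic J (cycle_graph l) ->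
  exists2 x : {ffun 'I_l -> T}, injective x & edges J = cyc x.
Proof.
move=> [f [injf fV fE]].
have surj (i : 'I_l) : exists v, (v \in verts J) && (f v == i).
  have : i \in verts (cycle_graph l) by rewrite inE.
  by rewrite -fV => /imsetP[v vJ ->]; exists v; rewrite vJ eqxx.
pose x : {ffun 'I_l -> T} := [ffun i => xchoose (surj i)].
have xP i : x i \in verts J /\ f (x i) = i.
  by rewrite ffunE; have /andP[? /eqP] := xchooseP (surj i).
have ix : injective x by move=> i j /(congr1 f); rewrite !(xP _).2.
exists x => //; apply/setP => e; apply/idP/imsetP => [eJ|[i _ {e}->]].
  have : [set f y | y in e] \in edges (cycle_graph l) by rewrite -fE imset_f.
  move=> /imsetP[i _ fe]; exists i => //; apply/setP => v; rewrite !inE.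
  have ev w : w \in e -> w \in verts J by apply: subsetP; apply: edge_sub_verts.
  apply/idP/orP => [ve|].
    have : f v \in [set f y | y in e] by rewrite imset_f.
    rewrite fe !inE => /orP[]/eqP fv; [left|right]; apply/eqP/injf;
      by [exact: ev | exact: (xP _).1 | rewrite (xP _).2].
  have h w j : w = x j -> j \in [set f y | y in e] -> w \in e.
    move=> -> /imsetP[y ye jy]; suff -> : x j = y by [].
    by apply: injf; [exact: (xP _).1 | exact: ev | rewrite (xP _).2].
  by case=> /eqP vE; apply: (h _ _ vE); rewrite fe !inE eqxx ?orbT.
have : [set i; ordS i] \in edges (cycle_graph l).
  by rewrite /edges /=; apply/imsetP; exists i => //; rewrite inE ordS_neq.
rewrite -fE => /imsetP[d eJ ee]; suff -> : [set x i; x (ordS i)] = d by [].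
have ev w : w \in d -> w \in verts J by apply: subsetP; apply: edge_sub_verts.
apply/eqP; rewrite eqEcard (edge_card2 eJ) cards2 (inj_eq ix) eq_sym ordS_neq /= andbT.
have h j : j \in [set f y | y in d] -> x j \in d.
  move=> /imsetP[y ye jy]; suff -> : x j = y by [].
  by apply: injf; [exact: (xP _).1 | exact: ev | rewrite (xP _).2].
by rewrite subUset !sub1set !h // -ee !inE eqxx ?orbT.
Qed.

Lemma rainbow_cycle_copy (K : Type) (G : graph T) (c : {set T} -> K) x :
  injective x -> verts G = setT -> cyc x \subset edges G ->
  {in cyc x &, injective c} ->
  exists J : graph T, [/\ subgraph J G, isomorphic J (cycle_graph l) & rainbow J c].
Proof.
move=> ix vG sxG rx.
have ax : graph_axiom ([set x i | i : 'I_l], cyc x).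
  apply/forall_inP => /= e ex; rewrite (cyc_two_sets ix ex) eqxx andbT.
  by move: ex => /imsetP[i _ ->]; rewrite subUset !sub1set !imset_f.
exists (Graph ax); split=> //.
  by rewrite /subgraph vG subsetT.
have l0 : 0 < l by lia.
pose f v := odflt (Ordinal l0) [pick i | x i == v].
have fx i : f (x i) = i.
  rewrite /f; case: pickP => [j /eqP/ix //|/(_ i)]; by rewrite eqxx.
exists f; split.
- by move=> _ _ /imsetP[i _ ->] /imsetP[j _ ->]; rewrite !fx => ->.
- apply/setP => i; rewrite inE; apply/imsetP; exists (x i); last by rewrite fx.
  exact: imset_f.
apply/setP => e; apply/imsetP/imsetP => [[d /imsetP[i _ ->] ->]|[i _ ->]].
  by exists i; rewrite ?inE ?ordS_neq // imsetU1 imset_set1 !fx.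
by exists [set x i; x (ordS i)]; rewrite ?mem_cyc // imsetU1 imset_set1 !fx.
Qed.

End Cycles.

(** * The 0-statement *)

Section Present.
Variables (R : realType) (X : finType) (p : R).
Hypothesis p01 : 0 <= p <= 1.

Definition present (S : {set X}) (o : {ffun X -> bool}) : bool :=
  [forall e in S, o e].

Lemma presentU S S' o : present (S :|: S') o = present S o && present S' o.
Proof.
apply/forall_inP/andP => [H|[/forall_inP H /forall_inP H'] e].
  by split; apply/forall_inP => e eS; apply: H; rewrite inE eS ?orbT.
by rewrite inE => /orP[/H|/H'].
Qed.

Lemma Ex_present (S : {set X}) :
  Ex (bernoulli_pmf p) (fun o => (present S o)%:R) = p ^+ #|S|.
Proof.
pose h (x : X) (b : bool) : R := if x \in S then b%:R else 1.
transitivity (Ex (bernoulli_pmf p) (fun o : {ffun X -> bool} => \prod_x h x (o x))).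
  apply: eq_Ex => o; rewrite /h -big_mkcond /=.
  case: (boolP (present S o)) => [/forall_inP H|/forall_inPn[e eS /negbTE oe]].
    by rewrite big1 // => e eS; rewrite H.
  by rewrite (bigD1 e) //= oe mul0r.
rewrite Ex_prod (bigID (mem S)) /= [X in _ * X]big1 ?mulr1.
  rewrite -prodr_const; apply: eq_bigr => e eS.
  by rewrite big_bool /h eS /= mulr1 mulr0 addr0.
move=> e /negbTE eS; rewrite -[RHS](bernoulli_law p01).2.
by apply: eq_bigr => b _; rewrite /h eS mulr1.
Qed.

End Present.

(** * The exploration and its possible steps *)

Section Exploration.
Local Open Scope nat_scope.
Variables (T : finType) (l : nat).
Hypothesis l3 : 2 < l.
Implicit Types (x : {ffun 'I_l -> T}) (D : seq (T * T)).

Lemma l_gt0 : 0 < l. Proof. by lia. Qed.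
Definition i0 : 'I_l := Ordinal l_gt0.
Definition i1 : 'I_l := ordS i0.

Lemma val_i1 : i1 = 1 :> nat.
Proof. by rewrite /= modn_small //; lia. Qed.

(** Both orientations are listed because a cycle is only rotated, never reversed, to make it start
    with a listed arc. *)
Definition arcs (x : {ffun 'I_l -> T}) : seq (T * T) :=
  [seq (x i, x (ordS i)) | i <- enum 'I_l] ++ [seq (x (ordS i), x i) | i <- enum 'I_l].

Definition es (D : seq (T * T)) : {set {set T}} := [set e in map (@edge_of T) D].
Definition vs (D : seq (T * T)) : {set T} := cover (es D).

Lemma es_cat D D' : es (D ++ D') = es D :|: es D'.
Proof. by apply/setP => e; rewrite !inE map_cat mem_cat. Qed.

Lemma es_arcs x : es (arcs x) = cyc x.
Proof.
apply/setP => e; rewrite inE map_cat mem_cat -!map_comp.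
apply/orP/imsetP => [[]/mapP[i _ ->]|[i _ ->]].
- by exists i.
- by exists i; rewrite // /edge_of /= setUC.
- by left; apply/mapP; exists i; rewrite ?mem_enum.
Qed.

Lemma size_arcs x : size (arcs x) = 2 * l.
Proof. by rewrite /arcs size_cat 2!size_map -cardE card_ord; lia. Qed.

Lemma vs_cat D D' : vs (D ++ D') = vs D :|: vs D'.
Proof. by rewrite /vs es_cat /cover bigcup_setU. Qed.

Lemma mem_vs D p : p \in D -> p.1 \in vs D /\ p.2 \in vs D.
Proof.
move=> pD; have eD : edge_of p \in es D by rewrite inE map_f.
by split; apply/bigcupP; exists (edge_of p); rewrite // !inE eqxx ?orbT.
Qed.

Lemma es_sub_vs D (e : {set T}) : e \in es D -> e \subset vs D.
Proof. exact: bigcup_sup. Qed.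

Lemma card_vs D : #|vs D| <= 2 * size D.
Proof.
elim: D => [|p D IH].
  have -> : vs [::] = set0.
    by apply/setP => v; rewrite inE; apply/negP => /bigcupP[e]; rewrite inE.
  by rewrite cards0.
rewrite -cat1s vs_cat (leq_trans (leq_card_setU _ _)) // size_cat mulnDr leq_add //.
have -> : vs [:: p] = edge_of p.
  apply/setP => v; apply/bigcupP/idP => [[e]|ve]; first by rewrite inE /= mem_seq1 => /eqP ->.
  by exists (edge_of p); rewrite // inE /= mem_head.
by rewrite cards2; case: (_ != _).
Qed.

Lemma vs_arcs x (i : 'I_l) : x i \in vs (arcs x).
Proof.
by apply/bigcupP; exists [set x i; x (ordS i)]; rewrite ?es_arcs ?mem_cyc // !inE eqxx.
Qed.

Lemma card_vs_arcs x : injective x -> #|vs (arcs x)| = l.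
Proof.
move=> ix; rewrite -[RHS]card_ord -(card_imset _ ix); congr #|pred_of_set _|.
apply/setP => v; apply/idP/imsetP => [|[i _ ->]]; last exact: vs_arcs.
rewrite /vs es_arcs => /bigcupP[e /imsetP[i _ ->]].
by rewrite !inE => /orP[]/eqP->; eexists.
Qed.

(** Beyond the end of [D] the default of [nth] would make the arc condition trivial; the index is
    always taken below [size D]. *)
Definition step_ok D j x :=
  [&& injectiveb x, (x i0, x i1) == nth (x i0, x i1) D j & ~~ (cyc x \subset es D)].

Variables M : nat.

(* Counts the ways to enlarge D by t present cycles, each through an arc of the current
   list and with an edge that is not in it. Always taking the arc of least index makes
   the indices nondecreasing, hence the lower bound q; this is what keeps the number of
   index sequences exponential in t. Only the outcomes with
   (M-1)v <= (M-2)e + r are counted. *)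
Fixpoint explorations (r t : nat) (D : seq (T * T)) (q : nat)
    (o : {ffun {set T} -> bool}) : nat :=
  if t is t'.+1 then
    \sum_(q <= j < size D) \sum_(x : {ffun 'I_l -> T} | step_ok D j x)
      present (cyc x) o * explorations r t' (D ++ arcs x) j o
  else M.-1 * #|vs D| <= M.-2 * #|es D| + r.

(** Truncated subtraction: it vanishes exactly when the final condition of [explorations] holds. For
    y <= 1 the power [y ^+ defect M r D] bounds the indicator of that condition, and it is the
    potential carried through the induction: density still to be gained is paid for in advance by
    powers of y. *)
Definition defect r D := M.-1 * #|vs D| - (M.-2 * #|es D| + r).

(** Applied to the positions of new vertices: each edge of the cycle touching one of them is new, so
    k > 0 new vertices bring at least k + 1 new edges. *)
Lemma ord_boundary (I : {set 'I_l}) : I != set0 -> i0 \notin I ->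
  #|I| < #|[set i | (i \in I) || (ordS i \in I)]|.
Proof.
move=> I0 nI; apply: proper_card; rewrite properE; apply/andP; split.
  by apply/subsetP => i iI; rewrite inE iI.
apply/negP => /subsetP sub; move/negP: I0; apply; apply/eqP/setC_inj; rewrite setC0.
apply: ordS_closed_setT; first by apply/set0Pn; exists i0; rewrite inE.
by move=> i; rewrite !inE; apply: contra => iI; apply: sub; rewrite inE iI orbT.
Qed.

Definition pattern D (x : {ffun 'I_l -> T}) : {set 'I_l} := [set i | x i \notin vs D].

Lemma new_vertices D x : injective x -> #|vs D| + #|pattern D x| <= #|vs (D ++ arcs x)|.
Proof.
move=> ix; rewrite vs_cat -(card_imset _ ix).
rewrite -cardsUI (_ : _ :&: _ = set0) ?cards0 ?addn0.
  apply/subset_leq_card/setUS/subsetP => v /imsetP[i _ ->]; exact: vs_arcs.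
apply/setP => v; rewrite !inE; apply/negP => /andP[vD /imsetP[i]].
by rewrite inE => nD e; move: nD; rewrite -e vD.
Qed.

(** Without new vertices the inequality comes from [step_ok], which asks for an edge outside [es D];
    otherwise it is [ord_boundary], position [i0] being old. *)
Lemma new_edges D j x : j < size D -> step_ok D j x ->
  #|es D| + #|pattern D x| < #|es (D ++ arcs x)|.
Proof.
move=> jD /and3P[/injectiveP ix /eqP xj nsub].
have aD : x i0 \in vs D.
  have /mem_vs[] : nth (x i0, x i1) D j \in D by rewrite mem_nth.
  by rewrite -xj.
rewrite es_cat es_arcs -(cardsID (es D) (es D :|: cyc x)).
rewrite (setIidPr _) ?subsetUl // ltn_add2l setDUl setDv set0U.
have [P0|P0] := eqVneq (pattern D x) set0.
  by rewrite P0 cards0 card_gt0 setD_eq0.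
have n0 : i0 \notin pattern D x by rewrite inE negbK.
apply: leq_trans (ord_boundary P0 n0) _.
rewrite -(card_imset _ (cyc_edge_inj l3 ix)); apply/subset_leq_card/subsetP => e.
case/imsetP => i; rewrite !inE => H ->; rewrite mem_cyc andbT.
apply/negP => eD; have {}eD : [set x i; x (ordS i)] \in es D by rewrite inE.
have := es_sub_vs eD; rewrite subUset !sub1set.
by case: (x i \in _) H => //= /negbTE ->.
Qed.

Lemma count_pattern D j (I : {set 'I_l}) : j < size D ->
  #|[set x | step_ok D j x && (pattern D x == I)]| <=
  #|T| ^ #|I| * #|vs D| ^ (l - 2 - #|I|).
Proof.
move=> jD; set P := [set x | _].
have [->|/set0Pn[y0]] := eqVneq P set0; first by rewrite cards0.
rewrite inE => /andP[/and3P[/injectiveP iy0 /eqP yj _] /eqP yI].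
have jin : nth (y0 i0, y0 i1) D j \in D by rewrite mem_nth.
have [a0 a1] := mem_vs jin; rewrite -yj /= in a0 a1.
pose F (i : 'I_l) : {set T} := if i == i0 then [set y0 i0] else if i == i1 then
  [set y0 i1] else if i \in I then setT else vs D.
apply: (@leq_trans #|family F|).
  apply/subset_leq_card/subsetP => x; rewrite inE.
  move=> /andP[/and3P[_ /eqP xj _] /eqP xI]; apply/familyP => i; rewrite /F.
  have e01 : (x i0, x i1) = (y0 i0, y0 i1) by rewrite xj yj; apply: set_nth_default.
  case: e01 => e0 e1.
  case: eqP => [->|_]; first by rewrite inE e0.
  case: eqP => [->|_]; first by rewrite inE e1.
  by rewrite -xI inE; case: (boolP (x i \in vs D)) => //=; rewrite inE.
have n10 : i1 != i0 by apply/eqP => /(congr1 (@nat_of_ord l)); rewrite val_i1.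
have I0 : i0 \notin I by rewrite -yI inE negbK.
have I1 : i1 \notin I by rewrite -yI inE negbK.
rewrite card_family foldrE big_map big_enum /=.
rewrite (bigD1 i0) //= (bigD1 i1) //= {1 2}/F !eqxx (negbTE n10) !cards1 !mul1n.
rewrite (bigID (mem I)) /=; apply: leq_mul.
  rewrite (eq_bigr (fun=> #|T|)); last first.
    by move=> i /andP[/andP[/negbTE h0 /negbTE h1] iI]; rewrite /F h0 h1 iI cardsT.
  rewrite prod_nat_const leq_eqVlt; apply/orP; left; apply/eqP; congr (_ ^ _).
  apply: eq_card => i; rewrite unfold_in /=.
  have [iI|] := boolP (i \in I); last by rewrite andbF.
  by rewrite andbT (memPn I0) // (memPn I1).
rewrite (eq_bigr (fun=> #|vs D|)); last first.
  by move=> i /andP[/andP[/negbTE h0 /negbTE h1] /negbTE iI]; rewrite /F h0 h1 iI.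
rewrite prod_nat_const leq_eqVlt; apply/orP; left; apply/eqP; congr (_ ^ _).
have -> : l - 2 - #|I| = #|~: (i0 |: (i1 |: I))|.
  have := cardsC (i0 |: (i1 |: I)); rewrite card_ord !cardsU1 !inE.
  rewrite eq_sym (negbTE n10) (negbTE I0) I1 /=.
  by move: #|~: _| #|I| => c k; lia.
by apply: eq_card => i; rewrite unfold_in /= !inE !negb_or andbA.
Qed.

End Exploration.

(** From h >= k + 1 one gets loss >= M - 2 - k. So loss = 0 forces k = l - 2: all vertices outside
    the given arc are new, and there is no choice of old vertices to pay for. The last inequality
    says that the defect drops by at most the loss. *)
Lemma step_arith M l k e e' v v' r :
  (2 < l)%N -> (l <= M)%N -> (k <= l - 2)%N -> (v + k <= v')%N -> (e + k < e')%N ->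
  let h := (e' - e)%N in let loss := (M.-2 * h - M.-1 * k)%N in
  [/\ M.-2 * h = M.-1 * k + loss, 0 < h, loss = 0 -> l - 2 - k = 0, e' = e + h &
      M.-1 * v - (M.-2 * e + r) <= loss + (M.-1 * v' - (M.-2 * e' + r))]%N.
Proof.
move=> l3 lM kl nv ne h loss.
have hk : (k.+1 <= h)%N by rewrite /h; lia.
have M12 : M.-1 = M.-2.+1 by lia.
have le1 : (M.-1 * k + (M.-2 - k) <= M.-2 * h)%N.
  have : (M.-2 * k.+1 <= M.-2 * h)%N by rewrite leq_mul2l hk orbT.
  by apply: leq_trans; rewrite M12 mulnS mulSn; lia.
have Eh : (M.-2 * h = M.-1 * k + loss)%N by rewrite /loss; lia.
have e'E : e' = (e + h)%N by rewrite /h; lia.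
split=> //; [by lia | by lia|].
have : (M.-1 * (v + k) <= M.-1 * v')%N by rewrite leq_mul2l nv orbT.
by rewrite e'E !mulnDr; lia.
Qed.

(** * Expected number of explorations *)

Section ExplorationBound.
Variables (R : realType) (T : finType) (l : nat).
Hypothesis l3 : (2 < l)%N.
Variable M : nat.
Hypothesis lM : (l <= M)%N.
Variables (p eps xx : R).
Hypothesis p01 : 0 <= p <= 1.
Hypothesis eps01 : 0 <= eps <= 1.
Hypothesis xx0 : 0 < xx.
Hypothesis pE : p = eps * xx ^+ M.-2.
Hypothesis nE : #|T|%:R * xx ^+ M.-1 = 1.
Variables (s : nat) (y : R).
Hypothesis s0 : (0 < s)%N.
Hypothesis yE : y = s%:R ^+ l * xx.
Hypothesis y1 : y <= 1.

Let y0 : 0 < y.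
Proof. by rewrite yE mulr_gt0 ?exprn_gt0 ?ltr0n. Qed.

Let s1 : 1 <= s%:R ^+ l :> R.
Proof. by rewrite exprn_ege1 // ler1n. Qed.

(* Adding k vertices and h edges to a cluster multiplies the expectation by n^k p^h, where
   p = eps n^(-(M-2)/(M-1)) and xx = n^(-1/(M-1)); this is eps times a power of xx, and
   the power, when positive, absorbs the choice of the old vertices of the cycle. *)
Lemma pow_trade k h m loss : (M.-2 * h = M.-1 * k + loss)%N -> (0 < h)%N ->
  (m <= l)%N -> (loss = 0 -> m = 0)%N ->
  p ^+ h * (#|T|%:R ^+ k * s%:R ^+ m) <= eps * y ^+ loss.
Proof.
move=> Eh h0 ml lm; have [e0 e1] := andP eps01.
rewrite pE exprMn -exprM Eh exprD.
have -> : eps ^+ h * (xx ^+ (M.-1 * k) * xx ^+ loss) * (#|T|%:R ^+ k * s%:R ^+ m) =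
   eps ^+ h * (#|T|%:R * xx ^+ M.-1) ^+ k * (xx ^+ loss * s%:R ^+ m).
  by rewrite exprMn -exprM; ring.
rewrite nE expr1n mulr1; apply: ler_pM.
- exact: exprn_ge0.
- by rewrite mulr_ge0 ?exprn_ge0 ?ler0n // ltW.
- case: h h0 {Eh} => // h _; by rewrite exprS ler_piMr //; apply: exprn_ile1.
rewrite yE exprMn mulrC ler_wpM2r //; first by rewrite exprn_ge0 // ltW.
case: (posnP loss) lm => [->|lp] lm; first by rewrite (lm erefl) !expr0.
apply: (@le_trans _ _ (s%:R ^+ l)); first by rewrite ler_weXn2l // ler1n.
by rewrite ler_eXnr.
Qed.

(** The factor 2^l counts the possible position sets of new vertices. For a fixed one, each new
    position has |T| choices and each old position outside the arc at most s; [pow_trade] balances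
    these against the new edges. *)
Lemma step_bound r (D : seq (T * T)) j : (j < size D)%N -> (#|vs D| <= s)%N ->
  \sum_(x : {ffun 'I_l -> T} | step_ok l3 D j x)
     p ^+ #|es (D ++ arcs x)| * y ^+ defect M r (D ++ arcs x) <=
  2 ^+ l * eps * (p ^+ #|es D| * y ^+ defect M r D).
Proof.
move=> jD vD; have [e0 e1] := andP eps01; have [p0 p1] := andP p01.
rewrite (partition_big (pattern D) xpredT) //=.
have -> : 2 ^+ l * eps * (p ^+ #|es D| * y ^+ defect M r D) =
    \sum_(I : {set 'I_l}) eps * (p ^+ #|es D| * y ^+ defect M r D).
  rewrite sumr_const -cardsT -powersetT card_powerset cardsT card_ord.
  by rewrite -[RHS]mulr_natl natrX -mulrA.
apply: ler_sum => I _.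
set c := eps * _; set P := [set x | step_ok l3 D j x && (pattern D x == I)].
have c0 : 0 <= c by rewrite !mulr_ge0 ?exprn_ge0 // ltW.
pose N := (#|T| ^ #|I| * s ^ (l - 2 - #|I|))%N.
apply: (@le_trans _ _ (\sum_(x in P) c / N%:R)); last first.
  rewrite sumr_const -[leLHS]mulr_natr mulrAC.
  have [->|/set0Pn[x xP]] := eqVneq P set0; first by rewrite cards0 mulr0 mul0r.
  have T0 : (0 < #|T|)%N by apply/card_gt0P; exists (x (i0 l3)).
  have N0 : (0 < N)%N by rewrite muln_gt0 !expn_gt0 T0 s0.
  rewrite ler_pdivrMr ?ltr0n // ler_wpM2l // ler_nat.
  apply: leq_trans (count_pattern l3 I jD) _.
  rewrite leq_mul2l; apply/orP; right.
  by case: (l - 2 - _)%N => [|e]; rewrite ?expn0 // leq_exp2r.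
rewrite [leRHS](eq_bigl (fun x => step_ok l3 D j x && (pattern D x == I))); last first.
  by move=> x; rewrite inE.
apply: ler_sum => x /andP[ok /eqP xI].
have T0 : (0 < #|T|)%N by apply/card_gt0P; exists (x (i0 l3)).
have N0 : (0 < N)%N by rewrite muln_gt0 !expn_gt0 T0 s0.
have ix : injective x by have /and3P[/injectiveP] := ok.
have nv := new_vertices D ix; have ne := new_edges jD ok; rewrite xI in nv ne.
have kl : (#|I| <= l - 2)%N.
  have n10 : i0 l3 != i1 l3.
    by apply/eqP => /(congr1 (@nat_of_ord l)); rewrite val_i1.
  have jin : nth (x (i0 l3), x (i1 l3)) D j \in D by rewrite mem_nth.
  have [a0 a1] := mem_vs jin; move: ok => /and3P[_ /eqP xj _].
  rewrite -xj /= in a0 a1.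
  have : I \subset ~: [set i0 l3; i1 l3].
    apply/subsetP => i; rewrite -xI !inE; apply: contraNN => /orP[]/eqP->; by [].
  move/subset_leq_card/leq_trans; apply.
  have := cardsC [set i0 l3; i1 l3]; rewrite cards2 n10 card_ord.
  by move: #|~: _| => cc; clear; lia.
set k := #|I| in nv ne kl N N0 *.
set v := #|vs D| in nv vD *; set e := #|es D| in ne c c0 *.
set v' := #|vs _| in nv; set e' := #|es (D ++ _)| in ne *.
have [] := step_arith r l3 lM kl nv ne.
set h := (e' - e)%N; set loss := (_ - _)%N => Eh h0 lossm e'E dl.
have := @pow_trade k h (l - 2 - k)%N loss Eh h0.
move=> /(_ (leq_trans (leq_subr _ _) (leq_subr _ _)) lossm).
rewrite ler_pdivlMr ?ltr0n // => le.
rewrite -/e' {1}e'E exprD natrM !natrX /c.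
have yd : y ^+ loss * y ^+ defect M r (D ++ arcs x) <= y ^+ defect M r D.
  by rewrite -exprD; apply: ler_wiXn2l => //; apply: ltW.
have regroup (x1 x2 x3 x4 : R) : x1 * x2 * x3 * x4 = x1 * ((x2 * x4) * x3) by ring.
rewrite regroup [leRHS]mulrCA.
rewrite ler_wpM2l ?exprn_ge0 //.
apply: le_trans (_ : _ <= eps * y ^+ loss * y ^+ defect M r (D ++ arcs x)) _.
  by rewrite ler_wpM2r ?exprn_ge0 // ltW.
by rewrite -mulrA ler_wpM2l.
Qed.

Lemma sum_halves q d a : (d <= a)%N ->
  \sum_(q <= j < d) 2 ^+ (a - j) <= 2 * 2 ^+ (a - q) :> R.
Proof.
move=> da; have [dq|qd] := leqP d q; first by rewrite big_geq // mulr_ge0 // exprn_ge0.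
have H k : (k <= d - q)%N ->
    \sum_(d - k <= j < d) 2 ^+ (a - j) <= 2 * 2 ^+ (a - (d - k)) :> R.
  elim: k => [|k IH] kd; first by rewrite subn0 big_geq // mulr_ge0 // exprn_ge0.
  rewrite big_ltn; last by lia.
  have -> : (d - k.+1).+1 = (d - k)%N by lia.
  have -> : (a - (d - k.+1) = (a - (d - k)).+1)%N by lia.
  have := IH ltac:(lia); rewrite exprS; lra.
by have := H (d - q)%N (leqnn _); rewrite subKn // ltnW.
Qed.

(** The power 2^(size D + 2 l t - q) is a potential for the nondecreasing indices, with exponent the
    final length of the list minus the current index. By [sum_halves] the choice of the next index
    then costs a factor 2, whatever the length; this turns 2^l eps into 2^(l+1) eps. The hypothesis
    on s bounds the vertices of every cluster that can arise. *)
Lemma Ex_explorations_le r t (D : seq (T * T)) q : (2 * (size D + 2 * l * t) <= s)%N ->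
  Ex (bernoulli_pmf p) (fun o => (present (es D) o * explorations l3 M r t D q o)%:R) <=
  p ^+ #|es D| * y ^+ defect M r D *
    (2 ^+ (size D + 2 * l * t - q) * (2 ^+ l.+1 * eps) ^+ t).
Proof.
have [e0 e1] := andP eps01; have [p0 p1] := andP p01.
elim: t D q => [|t IH] D q st.
  rewrite muln0 addn0 expr0 mulr1.
  apply: (@le_trans _ _ (p ^+ #|es D| * y ^+ defect M r D)); last first.
    rewrite ler_peMr //; last by rewrite exprn_ege1 // ler1n.
    by rewrite mulr_ge0 ?exprn_ge0 // ltW.
  rewrite -Ex_present // mulrC -ExZ; apply: (Ex_le (bernoulli_law p01)) => o /=.
  rewrite natrM mulrC; case: leqP => H /=; last by rewrite mul0r !mulr_ge0 ?exprn_ge0 // ltW.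
  by rewrite /defect (eqP (H : _ - _ == 0)%N) expr0.
have E o : (present (es D) o * explorations l3 M r t.+1 D q o)%:R =
   \sum_(q <= j < size D) \sum_(x : {ffun 'I_l -> T} | step_ok l3 D j x)
     (present (es (D ++ arcs x)) o * explorations l3 M r t (D ++ arcs x) j o)%:R :> R.
  rewrite /= big_distrr natr_sum; apply: eq_bigr => j _ /=.
  rewrite big_distrr natr_sum; apply: eq_bigr => x _ /=.
  by rewrite es_cat es_arcs presentU mulnA mulnb.
rewrite (eq_Ex _ E) Ex_sum; set a := (size D + 2 * l * t.+1)%N.
apply: (@le_trans _ _ (\sum_(q <= j < size D) 2 ^+ (a - j) *
   ((2 ^+ l.+1 * eps) ^+ t * (2 ^+ l * eps * (p ^+ #|es D| * y ^+ defect M r D))))).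
  rewrite [leLHS]big_nat_cond [leRHS]big_nat_cond.
  apply: ler_sum => j /andP[/andP[qj jD] _]; rewrite Ex_sum.
  apply: (@le_trans _ _ (\sum_(x : {ffun 'I_l -> T} | step_ok l3 D j x)
     2 ^+ (a - j) * (2 ^+ l.+1 * eps) ^+ t *
       (p ^+ #|es (D ++ arcs x)| * y ^+ defect M r (D ++ arcs x)))).
    apply: ler_sum => x _; apply: le_trans (IH _ _ _) _.
      by rewrite size_cat size_arcs; move: st; rewrite mulnS; lia.
    rewrite size_cat size_arcs //.
    have -> : (size D + 2 * l + 2 * l * t)%N = a by rewrite /a; lia.
    by rewrite mulrC.
  rewrite -mulr_sumr -mulrA ler_wpM2l ?exprn_ge0 // ler_wpM2l //.
    by rewrite exprn_ge0 // mulr_ge0 // exprn_ge0.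
  apply: step_bound jD _; apply: leq_trans (card_vs D) _; lia.
rewrite -mulr_suml; apply: le_trans (ler_wpM2r _ (@sum_halves q (size D) a _)) _.
- by rewrite !mulr_ge0 ?exprn_ge0 ?mulr_ge0 ?exprn_ge0 // ltW.
- by rewrite /a; lia.
have -> : (2 ^+ l.+1 * eps) ^+ t.+1 = 2 * 2 ^+ l * eps * (2 ^+ l.+1 * eps) ^+ t.
  by rewrite exprS {1}exprS.
have regroup (A B L e P : R) : 2 * A * (B * (L * e * P)) = P * (A * (2 * L * e * B)).
  by ring.
by rewrite regroup.
Qed.

Definition cycle_explorations r t (o : {ffun {set T} -> bool}) : nat :=
  \sum_(x : {ffun 'I_l -> T} | injectiveb x)
     present (cyc x) o * explorations l3 M r t (arcs x) 0 o.

Lemma Ex_cycle_explorations_le r t : (2 * (2 * l + 2 * l * t) <= s)%N ->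
  Ex (bernoulli_pmf p) (fun o => (cycle_explorations r t o)%:R) <=
  #|T|%:R ^+ l * p ^+ l * y ^+ (l - r) *
    (2 ^+ (2 * l + 2 * l * t) * (2 ^+ l.+1 * eps) ^+ t).
Proof.
have [e0 e1] := andP eps01; have [p0 p1] := andP p01.
move=> st; rewrite /cycle_explorations.
rewrite (eq_Ex _ (fun o => natr_sum _ _ _ _)) Ex_sum.
apply: (@le_trans _ _ (\sum_(x : {ffun 'I_l -> T} | injectiveb x)
   p ^+ l * y ^+ (l - r) * (2 ^+ (2 * l + 2 * l * t) * (2 ^+ l.+1 * eps) ^+ t))).
  apply: ler_sum => x /injectiveP ix.
  have := @Ex_explorations_le r t (arcs x) 0; rewrite es_arcs card_cyc // size_arcs // subn0.
  move/(_ st)/le_trans; apply.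
  rewrite /defect card_vs_arcs // es_arcs card_cyc //.
  have -> : (M.-1 * l - (M.-2 * l + r) = l - r)%N.
    by rewrite (_ : M.-1 = M.-2.+1) ?mulSn; lia.
  exact: lexx.
rewrite sumr_const -[leLHS]mulr_natl -!mulrA ler_wpM2r //.
  by rewrite !mulr_ge0 ?exprn_ge0 ?mulr_ge0 ?exprn_ge0 // ltW.
rewrite -natrX ler_nat; apply: leq_trans (max_card _) _.
by rewrite card_ffun card_ord.
Qed.

End ExplorationBound.

(** * Exploring a critical set *)

Section ZeroStatement.
Variables (T : finType) (l : nat).
Hypothesis l4 : (3 < l)%N.
Let l3 : (2 < l)%N := ltnW l4.
Variable M : nat.
Hypothesis M5 : (4 < M)%N.

Lemma arcs_sym (x : {ffun 'I_l -> T}) a b : (a, b) \in arcs x -> (b, a) \in arcs x.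
Proof.
rewrite /arcs !mem_cat.
case/orP => /mapP[i iI [-> ->]]; apply/orP; [right|left]; apply/mapP; exists i => //.
Qed.

(** By the last hypothesis the arcs of index below [q] are exhausted: cycles of [E] through them
    already lie in [es D]. Hence the least usable arc has index at least [q], and since new arcs are
    appended, choosing it makes all smaller ones exhausted for the enlarged list. *)
Lemma explore_critical (o : {ffun {set T} -> bool}) (E : {set {set T}}) r :
  (forall e, e \in E -> o e) -> two_sets E -> critical (@is_cycle T l) E ->
  (M.-1 * #|T| <= r)%N ->
  forall t (D : seq (T * T)) q, es D != set0 -> es D \subset E ->
  (forall a b, (a, b) \in D -> (b, a) \in D) ->
  (forall j (x : {ffun 'I_l -> T}), (j < q)%N -> (j < size D)%N -> injective x ->
     (x (i0 l3), x (i1 l3)) = nth (x (i0 l3), x (i1 l3)) D j ->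
     cyc x \subset E -> cyc x \subset es D) ->
  (exists2 t', (t' <= t)%N & (0 < explorations l3 M 0 t' D q o)%N) \/
  (0 < explorations l3 M r t D q o)%N.
Proof.
move=> oE E2 crit rT; elim=> [|t IH] D q D0 sDE sym inv.
  right; rewrite /= lt0b; apply: leq_trans (leq_addl _ _).
  by apply: leq_trans rT; rewrite leq_mul2l max_card orbT.
have [DE|nDE] := eqVneq (es D) E.
  left; exists 0%N => //=; rewrite lt0b addn0 /vs DE.
  have dens := critical_dense E2 crit (@cycle_regular _ _ l3)
    (fun C x y z => @cycle_triangle _ _ l3 C x y z l4).
  move: dens; move: #|cover E| #|E| => v e ve.
  have -> : M.-1 = M.-2.+1 by lia.
  rewrite -(leq_pmul2l (isT : 0 < 4)%N).
  (* The place where M >= 5 enters: 4v <= 3e then implies (M-1)v <= (M-2)e. *)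
  have : (3 * (M.-2.+1) <= 4 * M.-2)%N by lia.
  move: M.-2 => m hm.
  apply: (@leq_trans (3 * e * m.+1)); first by rewrite mulnCA mulnC leq_mul2r ve orbT.
  by rewrite -mulnA (mulnC e) mulnA mulnA leq_mul2r hm orbT.
have [C [CC sCE CD nCD]] : exists C, [/\ is_cycle l C, C \subset E, C :&: es D != set0
    & ~~ (C \subset es D)].
  by apply: (critical_connected crit) => //; rewrite properEneq nDE.
have good : exists j : nat, [exists x : {ffun 'I_l -> T}, [&& injectiveb x, (j < size D)%N,
    (x (i0 l3), x (i1 l3)) == nth (x (i0 l3), x (i1 l3)) D j, cyc x \subset E
    & ~~ (cyc x \subset es D)]].
  have /is_cycleP[z iz Cz] := CC; have /set0Pn[e] := CD.
  rewrite inE Cz => /andP[/imsetP[i _ ei] eD].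
  have [x [ix cx xE]] := rotate_cycle l3 i iz.
  have arcD : (x (i0 l3), x (i1 l3)) \in D.
    rewrite !xE val_i1 /=; move: eD; rewrite inE => /mapP[[a b] abD].
    rewrite ei => eab.
    have := edge_of_inj (eab : edge_of (z i, z (ordS i)) = edge_of (a, b)).
    rewrite /same_pair /=.
    by case/orP => /andP[/eqP-> /eqP->] //; apply: sym.
  exists (index (x (i0 l3), x (i1 l3)) D); apply/existsP; exists x.
  rewrite index_mem arcD nth_index // eqxx cx -Cz sCE nCD !andbT.
  exact/injectiveP.
case: (ex_minnP good) => j /existsP[x /and5P[/injectiveP ix jD /eqP xj xE xD]] minj.
have qj : (q <= j)%N.
  by rewrite leqNgt; apply: contra xD => jq; apply: (inv j).
have pr : present (cyc x) o by apply/forall_inP => e /(subsetP xE)/oE.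
have ok : step_ok l3 D j x by apply/and3P; split=> //; [exact/injectiveP | exact/eqP].
have pos r' t' : (0 < explorations l3 M r' t' (D ++ arcs x) j o)%N ->
    (0 < explorations l3 M r' t'.+1 D q o)%N.
  move=> h /=; rewrite (bigD1_seq j) ?mem_index_iota ?qj ?iota_uniq //=.
  by rewrite (bigD1 x) //= pr mul1n -addnA; apply: leq_trans (leq_addr _ _).
have [||||[t' tt ht]|ht] := IH (D ++ arcs x) j.
- by rewrite es_cat setU_eq0 negb_and D0.
- by rewrite es_cat es_arcs subUset sDE.
- move=> a b; by rewrite !(mem_cat _ D) => /orP[/sym -> //|h]; rewrite (arcs_sym h) orbT.
- move=> j' x' j'j _ ix'; rewrite nth_cat (ltn_trans j'j jD) => x'j x'E.
  rewrite es_cat; apply: subset_trans (subsetUl _ _); apply/negPn/negP => x'D.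
  suff /minj : [exists x : {ffun 'I_l -> T}, [&& injectiveb x, (j' < size D)%N,
    (x (i0 l3), x (i1 l3)) == nth (x (i0 l3), x (i1 l3)) D j', cyc x \subset E
    & ~~ (cyc x \subset es D)]] by rewrite leqNgt j'j.
  apply/existsP; exists x'; rewrite -x'j eqxx x'E x'D (ltn_trans j'j jD) !andbT.
  exact/injectiveP.
- by left; exists t'.+1 => //; apply: pos.
- by right; apply: pos.
Qed.

Lemma arrow_not_colourable (G : graph T) :
  rb_arrow G (cycle_graph l) -> ~ colourable (@is_cycle T l) (edges G).
Proof.
move=> GH [c [cp cn]].
have [e f eG fG ef ef0|J [JG /(isomorphic_cycle l3)[x ix Jx] rJ]] := GH nat c.
  exact: cp.
have /andP[_ sJG] := JG; rewrite Jx in sJG.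
have [|e [f [eC fC ef cef]]] := cn (cyc x) _ sJG; first by apply/is_cycleP; exists x.
by move/eqP: ef; apply; apply: rJ; rewrite ?Jx.
Qed.

(* Either the exploration stops at a whole critical set, which is so dense that r = 0, or
   it can be run for t steps, and then r is chosen so large that it is no condition. *)
Lemma arrow_explored (o : {ffun {set T} -> bool}) r t :
  rb_arrow (graph_of o) (cycle_graph l) -> (M.-1 * #|T| <= r)%N ->
  (0 < \sum_(0 <= t' < t.+1) cycle_explorations l3 M 0 t' o +
       cycle_explorations l3 M r t o)%N.
Proof.
move=> /arrow_not_colourable/exists_critical[E sE crit] rT.
have oE e : e \in E -> o e by move=> /(subsetP sE); rewrite mem_edges_graph_of => /andP[].
have E2 : two_sets E by move=> e /(subsetP sE)/edge_card2.
have [C CC sCE] : exists2 C, is_cycle l C & C \subset E.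
  apply: contrapT => H; case: crit => + _; apply.
  exists (fun e => enum_rank e : nat); split => [e f _ _ /eqP ef _|C CC sCE].
    by move/val_inj/enum_rank_inj.
  by case: H; exists C.
have /is_cycleP[x ix Cx] := CC; subst C.
have pr : present (cyc x) o by apply/forall_inP => e /(subsetP sCE)/oE.
have pos r' t' : (0 < explorations l3 M r' t' (arcs x) 0 o)%N ->
    (0 < cycle_explorations l3 M r' t' o)%N.
  move=> h; rewrite /cycle_explorations (bigD1 x) /=; last exact/injectiveP.
  by rewrite pr mul1n; apply: leq_trans (leq_addr _ _).
have [|||j|[t' tt ht]|ht] := explore_critical oE E2 crit rT t (D := arcs x) (q := 0).
- rewrite es_arcs; apply/set0Pn; exists [set x (i0 l3); x (i1 l3)]; exact: mem_cyc.
- by rewrite es_arcs.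
- exact: arcs_sym.
- by [].
- rewrite addn_gt0; apply/orP; left.
  rewrite (bigD1_seq t') ?mem_index_iota ?iota_uniq //=.
  by apply: leq_trans (leq_addr _ _); apply: pos.
- by rewrite addn_gt0 (pos _ _ ht) orbT.
Qed.

End ZeroStatement.

Lemma poly_le_exp2 b : exists K, forall t, ((t.+1) ^ b <= K * 2 ^ t)%N.
Proof.
case: b => [|b]; first by exists 1%N => t; rewrite expn0 mul1n expn_gt0.
exists (b.+1 ^ b.+1)%N => t.
apply: (@leq_trans ((b.+1 * 2 ^ (t %/ b.+1)) ^ b.+1)).
  rewrite leq_exp2r // (leq_trans (ltn_ceil t (ltn0Sn b))) // mulnC leq_mul2l /=.
  exact: ltn_expl.
rewrite expnMn leq_mul2l -expnM leq_exp2l // leq_trunc_div //.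
by rewrite orbT.
Qed.

(** * The probability bound of the 0-statement *)

Section ZeroBound.
Variables (R : realType) (l M : nat).
Hypotheses (l4 : (3 < l)%N) (lM : (l <= M)%N) (M5 : (4 < M)%N).
Let l3 : (2 < l)%N := ltnW l4.

Lemma sum_geometric_half t : \sum_(0 <= k < t) (2^-1 : R) ^+ k <= 2.
Proof.
have H : \sum_(0 <= k < t) (2^-1 : R) ^+ k = 2 - 2 * 2^-1 ^+ t.
  elim: t => [|t IH]; first by rewrite big_geq // expr0; lra.
  by rewrite big_nat_recr //= IH exprS; lra.
by rewrite H; have := @exprn_ge0 R t 2^-1 ltac:(lra); lra.
Qed.

Lemma arrow_prob_le : exists C K : nat, forall (n : nat) (p eps xx : R),
  (K <= n)%N -> 0 <= p <= 1 -> 0 < xx -> 0 <= eps -> C%:R * eps <= 1 ->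
  p = eps * xx ^+ M.-2 -> n%:R * xx ^+ M.-1 = 1 ->
  gnp_prob p (fun G : graph 'I_n => rb_arrow G (cycle_graph l)) <= C%:R * eps.
Proof.
have [K1 HK1] := poly_le_exp2 (l * l).
have [K2 HK2] := poly_le_exp2 (2 * (l * M.-1)).
pose A := ((4 * l) ^ (l * l) * K1)%N.
pose B := ((4 * l) ^ (2 * (l * M.-1)) * K2 * 2)%N.
(* By [powE] a step costs 2^(3l+1) eps. The additional factor 4 leaves room for a growth of 2^k
   together with geometric decay in [small], and for 4^t in [large]. *)
pose C0 := (2 ^ (3 * l).+3)%N; pose C1 := ((2 * A + 1) * 4 ^ l)%N.
exists (C0 + C1)%N, B.+1 => n p eps xx Bn p01 xx0 e0 Ce pE nE.
have C1e : 0 <= C1%:R * eps by rewrite mulr_ge0.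
have C0e : C0%:R * eps <= 1 by move: Ce; rewrite natrD mulrDl; lra.
have n0 : (0 < n)%N by apply: leq_ltn_trans Bn.
have e1 : eps <= 1.
  apply: le_trans C0e; rewrite ler_peMl // ler1n expn_gt0 //.
have eps01 : 0 <= eps <= 1 by rewrite e0.
have [p0 p1] := andP p01.
(* About log n steps: 2^t reaches n, yet all clusters stay of logarithmic size. *)
pose t := (trunc_log 2 n).+1.
have nt : (n <= 2 ^ t)%N by apply/ltnW/trunc_log_ltn.
have tn : (2 ^ t <= 2 * n)%N by rewrite expnS leq_mul2l /= trunc_logP.
(* Twice the number of arcs after k steps, 2 (2l + 2lk), as the expectation bound requires. *)
pose s k := (4 * l * k.+1)%N.
have s0 k : (0 < s k)%N by rewrite /s; lia.
have M12 : M.-1 = M.-2.+1 by lia.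
have sn : ((s t ^ l) ^ M.-1 <= n)%N.
  rewrite -(@leq_exp2r _ _ 2) //.
  have -> : (((s t ^ l) ^ M.-1) ^ 2 = s t ^ (2 * (l * M.-1)))%N.
    by rewrite -!expnM; congr (_ ^ _)%N; lia.
  rewrite /s (expnMn (4 * l)); apply: (@leq_trans ((4 * l) ^ (2 * (l * M.-1)) * (K2 * 2 ^ t))%N).
    by rewrite leq_mul2l HK2 orbT.
  apply: (@leq_trans (B * n)%N); last by rewrite expnS expn1 leq_mul2r (ltnW Bn) orbT.
  by rewrite /B -!mulnA !leq_mul2l tn !orbT.
have y1 k : (k <= t)%N -> (s k)%:R ^+ l * xx <= 1.
  move=> kt; apply: (@le_trans _ _ ((s t)%:R ^+ l * xx)).
    rewrite ler_wpM2r ?(ltW xx0) // lerXn2r ?nnegrE ?ler0n // ler_nat.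
    by rewrite leq_mul2l ltnS kt orbT.
  have M0 : (0 < M.-1)%N by lia.
  rewrite -(@expr_le1 _ M.-1) ?mulr_ge0 ?exprn_ge0 ?ler0n ?(ltW xx0) //.
  rewrite exprMn -[leRHS]nE ler_wpM2r ?exprn_ge0 ?(ltW xx0) //.
  by rewrite -!natrX ler_nat.
have nE' : #|'I_n|%:R * xx ^+ M.-1 = 1 by rewrite card_ord.
have bound r k : (k <= t)%N ->
    Ex (bernoulli_pmf p) (fun o : {ffun {set 'I_n} -> bool} =>
       (cycle_explorations l3 M r k o)%:R) <=
    n%:R ^+ l * p ^+ l * ((s k)%:R ^+ l * xx) ^+ (l - r) *
    (2 ^+ (2 * l + 2 * l * k) * (2 ^+ l.+1 * eps) ^+ k).
  move=> kt; have := @Ex_cycle_explorations_le R 'I_n l l3 M lM p eps xx p01 eps01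
    xx0 pE nE' (s k) _ (s0 k) erefl (y1 k kt) r k.
  by rewrite card_ord; apply; rewrite /s; lia.
have powE k : 2 ^+ (2 * l + 2 * l * k) * (2 ^+ l.+1 * eps) ^+ k =
    (4 ^ l)%:R * (2 ^+ (3 * l).+1 * eps) ^+ k :> R.
  have a1 : 2 ^+ (2 * l) = (4 ^ l)%:R :> R by rewrite -natrX (expnM 2 2 l).
  have a2 : 2 ^+ (2 * l * k) * (2 ^+ l.+1) ^+ k = (2 ^+ (3 * l).+1) ^+ k :> R.
    rewrite -!exprM -exprD; congr (_ ^+ _).
    by rewrite -mulnDl; congr (_ * _)%N; lia.
  by rewrite exprD a1 !exprMn -a2; ring.
have xx1 : xx <= 1.
  rewrite leNgt; apply/negP => x1; have : 1 < n%:R * xx ^+ M.-1.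
    have h : 1 < xx ^+ M.-1 by rewrite exprn_egt1 // M12.
    by apply: lt_le_trans h _; rewrite ler_peMl ?ler1n // exprn_ge0 // ltW.
  by rewrite nE ltxx.
(* With r = 0 the initial cycle has defect l, and its factor y^l turns n^l p^l into eps^l times a
   power of log n: no power of n is left, so even k = 0 is harmless. *)
have small k : (k <= t)%N ->
    Ex (bernoulli_pmf p) (fun o : {ffun {set 'I_n} -> bool} =>
       (cycle_explorations l3 M 0 k o)%:R) <= (A * 4 ^ l)%:R * eps * 2^-1 ^+ k.
  move=> kt; apply: le_trans (bound 0%N k kt) _; rewrite subn0 powE.
  have -> : n%:R ^+ l * p ^+ l * ((s k)%:R ^+ l * xx) ^+ l =
      eps ^+ l * (s k ^ (l * l))%:R.
    rewrite natrX exprM -!exprMn; congr (_ ^+ _).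
    have -> : n%:R * p * ((s k)%:R ^+ l * xx) =
       eps * (s k)%:R ^+ l * (n%:R * xx ^+ M.-1) by rewrite pE M12 exprS; ring.
    by rewrite nE mulr1.
  apply: (@le_trans _ _ (eps * (A * 2 ^ k)%:R *
      ((4 ^ l)%:R * (2 ^+ (3 * l).+1 * eps) ^+ k))).
    apply: ler_wpM2r; first by rewrite mulr_ge0 // exprn_ge0 // mulr_ge0 // exprn_ge0.
    apply: ler_pM => //; first exact: exprn_ge0.
      by rewrite -(prednK (ltnW (ltnW l3))) exprS ler_piMr // exprn_ile1.
    rewrite ler_nat /A /s (expnMn (4 * l)) -mulnA leq_mul2l; apply/orP; right; exact: HK1.
  have -> : eps * (A * 2 ^ k)%:R * ((4 ^ l)%:R * (2 ^+ (3 * l).+1 * eps) ^+ k) =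
     (A * 4 ^ l)%:R * eps * (2 ^+ (3 * l).+2 * eps) ^+ k.
    by rewrite [2 ^+ (3 * l).+2]exprS !exprMn !natrM !natrX; ring.
  have P0 : 0 <= 2 ^+ (3 * l).+2 * eps by rewrite mulr_ge0 // exprn_ge0.
  have P1 : 2 ^+ (3 * l).+2 * eps <= 2^-1.
    by move: C0e; rewrite /C0 natrX exprS -mulrA; lra.
  by rewrite ler_wpM2l ?mulr_ge0 // lerXn2r // nnegrE invr_ge0.
(* Here the potential may be trivial. The starting cycles contribute at most eps n^2 <= eps 4^t,
   because l <= 2(M-1), and the t steps absorb 4^t. *)
have large r : Ex (bernoulli_pmf p) (fun o : {ffun {set 'I_n} -> bool} =>
       (cycle_explorations l3 M r t o)%:R) <= (4 ^ l)%:R * eps.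
  apply: le_trans (bound r t (leqnn _)) _; rewrite powE.
  have np : n%:R ^+ l * p ^+ l <= eps * (4 ^ t)%:R.
    rewrite -exprMn (_ : n%:R * p = eps * (n%:R * xx ^+ M.-2)); last by rewrite pE; ring.
    rewrite exprMn; apply: ler_pM; rewrite ?exprn_ge0 ?mulr_ge0 ?exprn_ge0 ?(ltW xx0) //.
      by rewrite -(prednK (ltnW (ltnW l3))) exprS ler_piMr // exprn_ile1.
    apply: (@le_trans _ _ (n%:R ^+ 2)); last first.
      rewrite -natrX ler_nat (_ : 4 = 2 ^ 2)%N // -expnM mulnC expnM.
      by rewrite leq_exp2r.
    rewrite -(@ler_pM2r _ (xx ^+ l)) ?exprn_gt0 // -exprMn.
    have q : 1 = n%:R ^+ 2 * xx ^+ (M.-1 * 2) by rewrite exprM -exprMn nE expr1n.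
    rewrite -mulrA -exprSr -M12 nE expr1n [leLHS]q.
    rewrite ler_wpM2l ?exprn_ge0 //; apply: ler_wiXn2l => //; first exact: ltW.
    by lia.
  apply: (@le_trans _ _ (eps * (4 ^ t)%:R * ((4 ^ l)%:R * (2 ^+ (3 * l).+1 * eps) ^+ t))).
    apply: ler_wpM2r; first by rewrite mulr_ge0 // exprn_ge0 // mulr_ge0 // exprn_ge0.
    apply: le_trans np; rewrite ler_piMr ?mulr_ge0 ?exprn_ge0 //.
    by apply: exprn_ile1; [rewrite mulr_ge0 ?exprn_ge0 // ltW | exact: y1].
  have -> : eps * (4 ^ t)%:R * ((4 ^ l)%:R * (2 ^+ (3 * l).+1 * eps) ^+ t) =
     (4 ^ l)%:R * eps * (2 ^+ (3 * l).+3 * eps) ^+ t.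
    have -> : 2 ^+ (3 * l).+3 = 4 * 2 ^+ (3 * l).+1 :> R by rewrite !exprS; ring.
    by rewrite !exprMn !natrX; ring.
  have P0 : 0 <= 2 ^+ (3 * l).+3 * eps by rewrite mulr_ge0 // exprn_ge0.
  have P1 : 2 ^+ (3 * l).+3 * eps <= 1 by move: C0e; rewrite /C0 natrX.
  by rewrite ler_piMr ?mulr_ge0 //; apply: exprn_ile1.
rewrite gnp_probE //.
pose r := (M.-1 * n)%N.
apply: (@le_trans _ _ (Ex (bernoulli_pmf p) (fun o : {ffun {set 'I_n} -> bool} =>
   \sum_(0 <= k < t.+1) (cycle_explorations l3 M 0 k o)%:R +
   (cycle_explorations l3 M r t o)%:R))).
  apply: (Ex_le (bernoulli_law p01)) => o; rewrite -natr_sum -natrD ler_nat.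
  case: asboolP => // /(arrow_explored l4 M5) h.
  by apply: (h r t); rewrite card_ord.
rewrite ExD Ex_sum.
apply: (@le_trans _ _ (\sum_(0 <= k < t.+1) (A * 4 ^ l)%:R * eps * 2^-1 ^+ k +
   (4 ^ l)%:R * eps)).
  apply: lerD (large r); rewrite [leLHS]big_nat_cond [leRHS]big_nat_cond.
  by apply: ler_sum => k /andP[/andP[_ kt] _]; apply: small.
rewrite -mulr_sumr; have := sum_geometric_half t.+1 => hs.
apply: (@le_trans _ _ ((A * 4 ^ l)%:R * eps * 2 + (4 ^ l)%:R * eps)).
  by rewrite lerD2r ler_wpM2l // mulr_ge0.
have c0 : 0 <= C0%:R * eps by rewrite mulr_ge0.
have c1 : C1%:R * eps = (A * 4 ^ l)%:R * eps * 2 + (4 ^ l)%:R * eps.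
  have gen (a b : nat) : ((2 * a + 1) * b)%N%:R * eps = (a * b)%N%:R * eps * 2 + b%:R * eps.
    by rewrite !natrM natrD natrM; ring.
  exact: gen.
by rewrite natrD mulrDl -c1 lerDr.
Qed.

End ZeroBound.

Lemma powR_neg_ratio (R : realType) (M n : nat) : (2 < M)%N -> (0 < n)%N ->
  let xx : R := n%:R `^ (- (M%:R - 1)^-1) in
  [/\ 0 < xx, n%:R * xx ^+ M.-1 = 1 &
      n%:R `^ (- ((M%:R - 2) / (M%:R - 1))) = xx ^+ M.-2].
Proof.
move=> M2 n0 xx; have nR : 0 < n%:R :> R by rewrite ltr0n.
have M1 : (M.-1)%:R = M%:R - 1 :> R by rewrite -subn1 natrB //; lia.
have M22 : (M.-2)%:R = M%:R - 2 :> R by rewrite -subn2 natrB //; lia.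
have Mp : 0 < M%:R - 1 :> R by rewrite -M1 ltr0n; lia.
split; first exact: powR_gt0.
  rewrite -powR_mulrn ?powR_ge0 // -powRrM M1 mulNr mulVf ?gt_eqF // powR_inv1 ?ltW //.
  by rewrite divff // gt_eqF.
rewrite -powR_mulrn ?powR_ge0 // -powRrM M22; congr (_ `^ _).
by rewrite mulNr mulrC.
Qed.

Section ZeroLimit.
Variables (R : realType) (l M : nat).
Hypotheses (l4 : (3 < l)%N) (lM : (l <= M)%N) (M5 : (4 < M)%N).

Lemma arrow_prob_cvg0 (p : nat -> R) : (forall n, 0 <= p n <= 1) ->
  (p n / (n%:R `^ (- ((M%:R - 2) / (M%:R - 1)))) @[n --> \oo] --> (0 : R))%classic ->
  (gnp_prob (p n) (fun G : graph 'I_n => rb_arrow G (cycle_graph l))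
     @[n --> \oo] --> (0 : R))%classic.
Proof.
move=> p01 eps0; have [C [K HCK]] := arrow_prob_le R l4 lM M5.
set eps := (X in (X @ _ --> _)%classic) in eps0.
apply: (@squeeze_cvgr _ _ _ _ (fun=> 0) (fun n => C%:R * eps n)); last 2 first.
- exact: cvg_cst.
- by rewrite -(mulr0 C%:R); apply: cvgMr.
have C1 : 0 < (C%:R + 1)^-1 :> R by rewrite invr_gt0 ltr_wpDl.
near=> n.
have n0 : (0 < n)%N by near: n; exact: nbhs_infty_gt.
have Kn : (K <= n)%N by near: n; exact: nbhs_infty_ge.
have [xx0 nE phatE] := @powR_neg_ratio R M n (ltnW (ltnW M5)) n0.
have /andP[-> _] /= := gnp_prob_bounds (fun G : graph 'I_n => rb_arrow G (cycle_graph l)) (p01 n).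
have /andP[pn0 _] := p01 n.
have e0 : 0 <= eps n by rewrite divr_ge0 // powR_ge0.
apply: (HCK n _ _ _ Kn (p01 n) xx0 e0 _ _ nE).
  have : `|0 - eps n| < (C%:R + 1)^-1.
    by near: n; move/cvgrPdist_lt: eps0; apply.
  rewrite sub0r normrN ger0_norm // => /ltW.
  rewrite -[leRHS]mul1r ler_pdivlMr ?ltr_wpDl // => h; apply: le_trans h.
  by rewrite mulrC ler_wpM2l // lerDl.
by rewrite -phatE /eps divfK // gt_eqF // powR_gt0 // ltr0n.
Unshelve. all: by end_near.
Qed.

End ZeroLimit.

(** * The 1-statement for long cycles *)

Section Chains.
Local Open Scope nat_scope.
Variables (K m : nat).

Lemma ord_pred_boundary (I : {set 'I_K.+1}) : I != set0 -> ord_max \notin I ->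
  #|I| < #|[set i | (i \in I) || (ord_pred i \in I)]|.
Proof.
move=> I0 nI; apply: proper_card; rewrite properE; apply/andP; split.
  by apply/subsetP => i iI; rewrite inE iI.
apply/negP => /subsetP sub; move/negP: nI; apply.
rewrite (ordS_closed_setT I0) ?inE // => i iI.
by apply: sub; rewrite inE ordSK iI orbT.
Qed.

(** Choosing layer by layer, the r-th element of the current set for each r < d, gives distinct
    sequences. Since [ord_pred] sends [ord0] to [ord_max], the first set formally depends on the
    last choice; constancy of [S ord0] removes this. *)
Lemma chain_count (S : 'I_K.+1 -> 'I_m -> {set 'I_m}) (d : nat) :
  (forall a a', S ord0 a = S ord0 a') -> (forall i a, d <= #|S i a|) -> 0 < m ->
  d ^ K.+1 <=
  #|[set x : {ffun 'I_K.+1 -> 'I_m} | [forall i, x i \in S i (x (ord_pred i))]]|.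
Proof.
move=> S0 dS m0; pose a0 := Ordinal m0.
pose nx i a (r : 'I_d) := nth a0 (enum (S i a)) r.
pose fix f (w : {ffun 'I_K.+1 -> 'I_d}) (j : nat) : 'I_m :=
  if j is j'.+1 then nx (inord j) (f w j') (w (inord j)) else nx ord0 a0 (w ord0).
have nxS i a r : nx i a r \in S i a.
  by rewrite -mem_enum mem_nth // -cardE (leq_trans (ltn_ord r)).
have nx_inj i a : injective (nx i a).
  move=> r r' /eqP; rewrite nth_uniq ?enum_uniq -?cardE ?(leq_trans (ltn_ord _)) //.
  by move/eqP/val_inj.
pose F w : {ffun 'I_K.+1 -> 'I_m} := [ffun i : 'I_K.+1 => f w i].
have predE (i : 'I_K.+1) j : i = j.+1 :> nat -> ord_pred i = j :> nat.
  by move=> ij; rewrite /= ij addSn /= modnDr modn_small // -ij ltnW // ltn_ord.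
have -> : d ^ K.+1 = #|[set F w | w : {ffun 'I_K.+1 -> 'I_d}]|.
  rewrite card_imset ?card_ffun ?card_ord // => w w' /ffunP E.
  have fE (i : 'I_K.+1) : f w i = f w' i by have := E i; rewrite !ffunE.
  apply/ffunP => i; case: i => [[|j] ij].
    by have := fE ord0 => /= /nx_inj; rewrite (_ : ord0 = Ordinal ij) //; apply: val_inj.
  have := fE (Ordinal ij); have := fE (Ordinal (ltnW ij)); rewrite /= => -> /nx_inj.
  by rewrite (_ : inord j.+1 = Ordinal ij) //; apply: val_inj; rewrite /= inordK.
apply/subset_leq_card/subsetP => x /imsetP[w _ ->]; rewrite inE; apply/forallP => i.
rewrite !ffunE; case E: (nat_of_ord i) => [|j]; last rewrite (predE i j E) /=.
  have -> : i = ord0 by apply: val_inj.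
  by rewrite (S0 _ a0) nxS.
have -> : inord j.+1 = i by apply: val_inj; rewrite /= -E inord_val.
exact: nxS.
Qed.

(** Pairing each point that is not the representative of its fibre with that representative produces
    distinct colliding pairs. *)
Lemma card_image_ge (I J : finType) (A : {set I}) (f : I -> J) :
  #|A| <= #|f @: A| +
    #|[set z : I * I | [&& z.1 \in A, z.2 \in A, z.1 != z.2 & f z.1 == f z.2]]|.
Proof.
pose r x := odflt x [pick y in A | f y == f x].
have rP x : x \in A -> r x \in A /\ f (r x) = f x.
  by rewrite /r; case: pickP => [y /andP[yA /eqP]|] //=.
pose B := [set x in A | r x == x].
have AB : #|A| = #|B| + #|A :\: B|.
  rewrite -(cardsID B A); congr (_ + _); apply: eq_card => x.
  by rewrite !inE; case: (x \in A).
rewrite AB leq_add //.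
  rewrite -(@card_in_imset _ _ f) => [|x y].
    by apply/subset_leq_card/imsetS/subsetP => x; rewrite inE => /andP[].
  rewrite !inE => /andP[xA /eqP rx] /andP[yA /eqP ry] fxy.
  rewrite -rx -ry /r fxy; case: pickP => // /(_ y) /=; by rewrite yA eqxx.
rewrite -(@card_in_imset _ _ (fun x => (x, r x))) => [|x y _ _ []//].
apply/subset_leq_card/subsetP => z /imsetP[x]; rewrite !inE => /andP[nB xA] ->.
have [rA fr] := rP x xA; rewrite xA in nB.
by rewrite /= xA rA fr eqxx andbT eq_sym.
Qed.

Lemma subset_of_card (I : finType) (A : {set I}) s : s <= #|A| ->
  exists2 W : {set I}, W \subset A & #|W| = s.
Proof.
move=> sA; exists [set x in take s (enum A)].
  by apply/subsetP => x; rewrite inE => /mem_take; rewrite mem_enum.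
rewrite cardsE (card_uniqP _) ?take_uniq ?enum_uniq // size_takel //.
by rewrite -cardE.
Qed.

Lemma card_pairs (I J : finType) (W : {set I}) (P : I -> J -> bool) :
  #|[set z : I * J | (z.1 \in W) && P z.1 z.2]| = \sum_(a in W) #|[set b | P a b]|.
Proof.
rewrite -sum1_card.
transitivity (\sum_(a in W) \sum_(b | P a b) 1).
  by rewrite pair_big_dep /=; apply: eq_bigl => z; rewrite inE.
by apply: eq_bigr => a _; rewrite -sum1_card; apply: eq_bigl => b; rewrite inE.
Qed.

End Chains.

(* Vertices are split into U of size N, K+1 layers of size m and Z of size N. Rainbow cycles
   are closed up from a path through u in U, one vertex in each layer and z in Z: the
   edge into layer i has a colour of group i, the edges at z have groups > K. *)
Section Layers.
Local Open Scope nat_scope.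
Variables (T : finType) (N m K : nat).
Definition layered : finType := ('I_N + 'I_K.+1 * 'I_m + 'I_N)%type.
Variable vtx : layered -> T.
Hypothesis vtx_inj : injective vtx.

(** Every edge of the construction joins different ranks, so an unordered pair determines which end
    is which ([eg_inj]). *)
Definition rank (v : layered) : nat :=
  match v with inl (inl _) => 0 | inl (inr (i, _)) => i.+1 | inr _ => K.+2 end.

Definition eg (a b : layered) : {set T} := [set vtx a; vtx b].

Lemma eg_inj a b c d : rank a < rank b -> rank c < rank d -> eg a b = eg c d ->
  a = c /\ b = d.
Proof.
move=> ab cd E.
have /edge_of_inj : edge_of (vtx a, vtx b) = edge_of (vtx c, vtx d) := E.
rewrite /same_pair /= !(inj_eq vtx_inj) => /orP[/andP[/eqP-> /eqP->] //|].
by case/andP => /eqP ad /eqP bc; subst; lia.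
Qed.

Definition vU (u : 'I_N) : layered := inl (inl u).
Definition vL (i : 'I_K.+1) (a : 'I_m) : layered := inl (inr (i, a)).
Definition vZ (z : 'I_N) : layered := inr z.

Definition src (i : 'I_K.+1) (u : 'I_N) (a : 'I_m) : layered :=
  if i == ord0 then vU u else vL (ord_pred i) a.

Definition ste i u a b : {set T} := eg (src i u a) (vL i b).
Definition eZ a z : {set T} := eg (vL ord_max a) (vZ z).
Definition eC u z : {set T} := eg (vU u) (vZ z).
Definition pe u (x : {ffun 'I_K.+1 -> 'I_m}) i : {set T} := ste i u (x (ord_pred i)) (x i).

Lemma ord_pred_val (i : 'I_K.+1) : i != ord0 -> (ord_pred i).+1 = i.
Proof.
by case: i => [[|j] ij] //= _; rewrite modnDr modn_small // ltnW.
Qed.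

Lemma rank_src i u a : rank (src i u a) = i.
Proof. by rewrite /src; case: eqP => [->|/eqP/ord_pred_val] //=. Qed.

Lemma ste_inj i u a b i' u' a' b' : ste i u a b = ste i' u' a' b' ->
  [/\ i = i', b = b' & src i u a = src i' u' a'].
Proof. by move=> /eg_inj[||-> [-> ->]] //; rewrite !rank_src /=. Qed.

Lemma eZ_inj a z a' z' : eZ a z = eZ a' z' -> a = a' /\ z = z'.
Proof. by move=> /eg_inj[||[->] [->]] //=. Qed.

Lemma eC_inj u z u' z' : eC u z = eC u' z' -> u = u' /\ z = z'.
Proof. by move=> /eg_inj[||[->] [->]] //=. Qed.

Lemma pe_inj u x i j : pe u x i = pe u x j -> i = j.
Proof. by move=> /ste_inj[]. Qed.

Lemma ste_eC i u a b u' z : ste i u a b <> eC u' z.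
Proof. by move=> /eg_inj[||_ []] //=; rewrite rank_src. Qed.

Lemma eZ_eC a z u' z' : eZ a z <> eC u' z'.
Proof. by move=> /eg_inj[||[]] //=. Qed.

Lemma eg_card a b : rank a < rank b -> #|eg a b| = 2.
Proof.
move=> ab; rewrite cards2 (inj_eq vtx_inj); case: eqP => // e; subst.
by rewrite ltnn in ab.
Qed.

Section Colouring.
Variables (q : nat) (o : {ffun {set T} -> bool}) (g : {set T} -> 'I_q).

Definition good u (x : {ffun 'I_K.+1 -> 'I_m}) : bool :=
  [forall i, o (pe u x i) && (g (pe u x i) == i :> nat)].
Definition ends u : {set 'I_m} := [set x ord_max | x : {ffun 'I_K.+1 -> 'I_m} in [set x | good u x]].
Definition closable : {set 'I_N * 'I_N} := [set uz : 'I_N * 'I_N |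
  [exists a, [&& a \in ends uz.1, o (eZ a uz.2) & K < g (eZ a uz.2)]]].
(** The groups are ignored on purpose: collisions are bounded once for the random graph, and the
    bound holds for every later grouping. *)
Definition collisions u : {set {ffun 'I_K.+1 -> 'I_m} * {ffun 'I_K.+1 -> 'I_m}} :=
  [set z : {ffun 'I_K.+1 -> 'I_m} * {ffun 'I_K.+1 -> 'I_m} |
  [&& z.1 != z.2, z.1 ord_max == z.2 ord_max,
   [forall i, o (pe u z.1 i)] & [forall i, o (pe u z.2 i)]]].

Lemma ends_ge u d : 0 < m ->
  (forall i a, d <= #|[set b | o (ste i u a b) && (g (ste i u a b) == i :> nat)]|) ->
  d ^ K.+1 <= #|ends u| + #|collisions u|.
Proof.
move=> m0 dS.
apply: leq_trans (chain_count
  (S := fun i a => [set b | o (ste i u a b) && (g (ste i u a b) == i :> nat)]) _ dS m0) _.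
  by move=> a a'; apply/setP => b; rewrite !inE.
set A := [set x | _]; have -> : A = [set x | good u x].
  by apply/setP => x; rewrite !inE; apply: eq_forallb => i; rewrite inE.
apply: leq_trans (card_image_ge _ (fun x : {ffun 'I_K.+1 -> 'I_m} => x ord_max)) _.
rewrite leq_add2l; apply/subset_leq_card/subsetP => z; rewrite !inE.
case/and4P => /forallP g1 /forallP g2 -> -> /=.
by apply/andP; split; apply/forallP => i; [have /andP[] := g1 i | have /andP[] := g2 i].
Qed.

(** Otherwise there are b vertices z not closable with u. All edges from s ends of u to them have
    groups at most K, and there are at most s t4 of these, whereas the graph has more than t3 edges
    between any two sets of these sizes. *)
Lemma closable_row u s b t3 t4 :
  s <= #|ends u| ->
  (forall (W : {set 'I_m}) (B : {set 'I_N}), #|W| = s -> #|B| = b ->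
     t3 < #|[set az : 'I_m * 'I_N | [&& az.1 \in W, az.2 \in B & o (eZ az.1 az.2)]]|) ->
  (forall a, #|[set z | o (eZ a z) && (g (eZ a z) <= K)]| <= t4) ->
  s * t4 <= t3 -> N < #|[set z | (u, z) \in closable]| + b.
Proof.
move=> sW H3 H4 st; rewrite ltnNge; apply/negP => small.
have [W sWe cW] := subset_of_card sW.
have bB : b <= #|[set z | (u, z) \notin closable]|.
  have := cardsC [set z | (u, z) \in closable]; rewrite card_ord => h.
  rewrite (_ : [set z | (u, z) \notin closable] = ~: [set z | (u, z) \in closable]).
    by move: h small; move: #|~: _| #|[set z | _]| => r1 r2; clear; lia.
  by apply/setP => z; rewrite !inE.
have [B sB cB] := subset_of_card bB.
have := H3 W B cW cB; rewrite ltnNge => /negP; apply; apply: leq_trans st.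
rewrite -cW -sum_nat_const.
apply: (@leq_trans (\sum_(a in W) #|[set z | o (eZ a z) && (g (eZ a z) <= K)]|)); last first.
  by apply: leq_sum => a _; apply: H4.
rewrite -(card_pairs W (fun a z => o (eZ a z) && (g (eZ a z) <= K))).
apply/subset_leq_card/subsetP => [[a z]]; rewrite !inE /= => /and3P[aW zB oz].
rewrite aW oz /= leqNgt; apply/negP => gz.
have := subsetP sB z zB; rewrite !inE => /existsPn /(_ a).
by rewrite (subsetP sWe) // oz gz.
Qed.

(** By averaging, at least half of the vertices u have at most s collisions, hence at least s ends;
    each of them is closable with at least half of Z. *)
Lemma closable_ge d s b t3 t4 : 0 < m -> 2 * b <= N ->
  (forall i u a, d <= #|[set e | o (ste i u a e) && (g (ste i u a e) == i :> nat)]|) ->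
  2 * s <= d ^ K.+1 -> 2 * \sum_u #|collisions u| <= N * s ->
  (forall (W : {set 'I_m}) (B : {set 'I_N}), #|W| = s -> #|B| = b ->
     t3 < #|[set az : 'I_m * 'I_N | [&& az.1 \in W, az.2 \in B & o (eZ az.1 az.2)]]|) ->
  (forall a, #|[set z | o (eZ a z) && (g (eZ a z) <= K)]| <= t4) ->
  s * t4 <= t3 -> 0 < s -> N * N <= 4 * #|closable|.
Proof.
move=> m0 bN dS sd col H3 H4 st s0.
pose G := [set u | #|collisions u| <= s].
have G2 : N <= 2 * #|G|.
  have cG : #|G| + #|~: G| = N by rewrite cardsC card_ord.
  have : s * #|~: G| <= \sum_u #|collisions u|.
    rewrite mulnC -sum_nat_const [leqRHS](bigID (mem (~: G))) /=.
    apply: leq_trans (leq_addr _ _); apply: leq_sum => u.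
    by rewrite !inE -ltnNge; apply: ltnW.
  move: cG col; move: #|~: G| #|G| (\sum_u _) => h g1 c e1 e2 e3.
  have : s * (2 * h) <= s * N by rewrite mulnCA (mulnC s N); lia.
  by rewrite leq_pmul2l //; lia.
have row u : u \in G -> N <= 2 * #|[set z | (u, z) \in closable]|.
  rewrite inE => uG.
  have su : s <= #|ends u|.
    by have := ends_ge m0 (fun i a => dS i u a); move: sd uG; lia.
  by move: (closable_row su H3 H4 st) bN; move: #|[set z | _]| => r; clear; lia.
have cE : #|closable| = \sum_(u in [set: 'I_N]) #|[set z | (u, z) \in closable]|.
  rewrite -(card_pairs setT (fun u z => (u, z) \in closable)).
  by apply: eq_card => [[u z]]; rewrite [in RHS]in_set in_setT.
apply: (@leq_trans (4 * \sum_(u in G) #|[set z | (u, z) \in closable]|)); last first.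
  rewrite leq_mul2l cE /= big_mkcond [leqRHS]big_mkcond /=; apply: leq_sum => u _.
  by rewrite in_setT; case: (u \in G).
apply: (@leq_trans (2 * (N * #|G|))); first by rewrite mulnCA leq_mul2l G2 orbT.
rewrite (_ : 4 = 2 * 2) // -mulnA leq_mul2l /= mulnC -sum_nat_const big_distrr /=.
exact: leq_sum.
Qed.

(** The groups distinguish the path edges from one another and from the two edges at z; those two
    are adjacent, so properness distinguishes them. *)
Lemma rainbow_closing (C : Type) (c : {set T} -> C) (H : graph T) u z :
  (forall e, (e \in edges H) = o e && (#|e| == 2)) -> verts H = setT ->
  proper_colouring H c ->
  (forall e f, e \in edges H -> f \in edges H -> c e = c f -> g e = g f) ->
  (u, z) \in closable -> o (eC u z) -> K < g (eC u z) ->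
  exists J : graph T, [/\ subgraph J H, isomorphic J (cycle_graph K.+3) & rainbow J c].
Proof.
move=> HE HV cp gc; rewrite inE /= => /existsP[a /and3P[/imsetP[x]]].
rewrite inE => /forallP xg -> oZ gZ oC gC.
pose y (i : 'I_K.+3) : layered := if i == 0 :> nat then vU u else
  if i == K.+2 :> nat then vZ z else vL (inord i.-1) (x (inord i.-1)).
have rk i : rank (y i) = i.
  rewrite /y; case: eqP => [->|i0] //; case: eqP => [->|iK] //=.
  by rewrite inordK; have := ltn_ord i; lia.
have iy : injective (fun i => vtx (y i)).
  by move=> i j /vtx_inj e; apply: val_inj; rewrite /= -!rk e.
pose w : {ffun 'I_K.+3 -> T} := [ffun i => vtx (y i)].
have iw : injective w by move=> i j; rewrite !ffunE => /iy.
pose e (i : 'I_K.+3) : {set T} := [set w i; w (ordS i)].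
have ePath (i : 'I_K.+3) : i < K.+1 -> e i = pe u x (inord i).
  move=> iK; have Si : ordS i = i.+1 :> nat by rewrite /= modn_small // ltnS ltnW.
  rewrite /e /pe /ste /eg !ffunE; congr [set vtx _; vtx _].
    rewrite /y /src; case: eqP => [i0|i0].
      by rewrite (_ : inord i = ord0) ?eqxx //; apply: val_inj; rewrite /= i0 inordK.
    have -> : (i == K.+2 :> nat) = false by apply/eqP; lia.
    have n0 : inord i != ord0 :> 'I_K.+1.
      by apply/eqP => /(congr1 val); rewrite /= inordK //; apply: i0.
    rewrite (negbTE n0) (_ : inord i.-1 = ord_pred (inord i)) //.
    apply/val_inj/succn_inj; rewrite ord_pred_val // inordK //= inordK //; lia.
  by rewrite /y Si /= (_ : (i.+1 == K.+2) = false) //; apply/eqP; lia.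
have eL1 (i : 'I_K.+3) : i = K.+1 :> nat -> e i = eZ (x ord_max) z.
  move=> iK; have Si : ordS i = K.+2 :> nat by rewrite /= iK modn_small.
  rewrite /e /eZ /eg !ffunE; congr [set vtx _; vtx _].
    rewrite /y iK /= (_ : (K.+1 == K.+2) = false); last by apply/eqP; lia.
    by rewrite (_ : inord K = ord_max) //; apply: val_inj; rewrite /= inordK.
  by rewrite /y Si /= eqxx.
have eL2 (i : 'I_K.+3) : i = K.+2 :> nat -> e i = eC u z.
  move=> iK; have Si : ordS i = 0 :> nat by rewrite /= iK modnn.
  rewrite /e /eC /eg !ffunE setUC; congr [set vtx _; vtx _].
    by rewrite /y Si.
  by rewrite /y iK /= eqxx.
have cases (i : 'I_K.+3) : [\/ i < K.+1, i = K.+1 :> nat | i = K.+2 :> nat].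
  have := ltn_ord i; have [h|] := ltnP i K.+1; first by constructor 1.
  by rewrite leq_eqVlt => /predU1P[<-|h1 h2]; [constructor 2 | constructor 3; lia].
have gE (i : 'I_K.+3) : i < K.+1 -> g (e i) = i :> nat.
  by move=> iK; rewrite ePath //; have /andP[_ /eqP ->] := xg (inord i); rewrite inordK.
have gE2 (i : 'I_K.+3) : K.+1 <= i -> K < g (e i).
  by move=> iK; case: (cases i) => [|/eL1->|/eL2->] //; rewrite ltnNge iK.
have eE (i : 'I_K.+3) : e i \in edges H.
  rewrite HE; case: (cases i) => [iK|/eL1->|/eL2->].
  - rewrite ePath //; have /andP[-> _] := xg (inord i).
    by rewrite /pe /ste eg_card //= rank_src.
  - by rewrite oZ eg_card.
  - by rewrite oC eg_card.
have cinj i j : c (e i) = c (e j) -> i = j.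
  move=> cij; have gij := congr1 (@nat_of_ord q) (gc _ _ (eE i) (eE j) cij).
  have [iK|iK] := ltnP i K.+1; have [jK|jK] := ltnP j K.+1.
  - by apply: val_inj; rewrite /= -(gE i iK) -(gE j jK).
  - by have := gE2 j jK; rewrite -gij gE //; lia.
  - by have := gE2 i iK; rewrite gij gE //; lia.
  have main : c (eZ (x ord_max) z) <> c (eC u z).
    have l1 : K.+1 < K.+3 by []. have l2 : K.+2 < K.+3 by [].
    apply: cp.
    - by rewrite -(eL1 (Ordinal l1)).
    - by rewrite -(eL2 (Ordinal l2)).
    - exact/eqP/eZ_eC.
    - by apply/set0Pn; exists (vtx (vZ z)); rewrite !inE eqxx !orbT.
  case: (cases i) (cases j) => [i00|i1|i2] [j00|j1|j2]; try lia.
  - by apply: val_inj; rewrite /= i1 j1.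
  - by move: cij; rewrite eL1 // eL2.
  - by move: cij; rewrite eL2 // eL1 // => /esym.
  - by apply: val_inj; rewrite /= i2 j2.
apply: (@rainbow_cycle_copy _ _ _ _ _ _ w iw HV) => //.
- by apply/subsetP => f /imsetP[i _ ->]; apply: eE.
- by move=> _ _ /imsetP[i _ ->] /imsetP[j _ ->] /cinj ->.
Qed.

End Colouring.
End Layers.

(** * Random grouping of the colours *)

Section Union.
Variables (R : realType) (X Y : finType) (w : Y -> R).
Hypothesis lw : law w.

Lemma union_bound (I : finType) (bad : I -> {ffun X -> Y} -> bool) :
  \sum_i Ex w (fun o => (bad i o)%:R) < 1 -> exists o, forall i, ~~ bad i o.
Proof.
rewrite -Ex_sum => lt1.
have [|o nb] := @Ex_exists _ _ _ _ lw (fun o => [exists i, bad i o]).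
  apply: le_lt_trans lt1; apply: (Ex_le lw) => o.
  case: existsP => [[i bi]|_] /=; last by apply: sumr_ge0.
  by rewrite (bigD1 i) //= bi lerDl sumr_ge0.
by exists o => i; apply: contra nb => bi; apply/existsP; exists i.
Qed.

Lemma card_fiber (I J : finType) (f : I -> J) (A : {set I}) (P : pred J) :
  {in A &, injective f} ->
  #|[set x in f @: A | P x]| = #|[set b in A | P (f b)]|.
Proof.
move=> fi; rewrite -[RHS](@card_in_imset _ _ f) => [|x y].
  apply: eq_card => x; rewrite !inE; apply/andP/imsetP => [[/imsetP[b bA ->] Pb]|[b]].
    by exists b; rewrite // inE bA.
  by rewrite inE => /andP[bA Pb] ->; rewrite imset_f.
by rewrite !inE => /andP[xA _] /andP[yA _]; apply: fi.
Qed.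

Lemma lower_tail_fiber (I : finType) (f : I -> X) (A : {set I}) (P : pred Y) (a : R) :
  {in A &, injective f} -> a <= (\sum_(y | P y) w y) * #|A|%:R ->
  Ex w (fun o => (#|[set b in A | P (o (f b))]|%:R <= a / 4)%R%:R) <= expR (- (a / 4)).
Proof.
move=> fi aA; have := @lower_tail _ _ _ _ lw (f @: A) P a.
rewrite card_in_imset // => /(_ aA); congr (_ <= _); apply: eq_Ex => o.
by rewrite (card_fiber (fun x => P (o x)) fi).
Qed.

Lemma upper_tail_fiber (I : finType) (f : I -> X) (A : {set I}) (P : pred Y) (a : R) :
  {in A &, injective f} -> (\sum_(y | P y) w y) * #|A|%:R <= a ->
  Ex w (fun o => (4 * a <= #|[set b in A | P (o (f b))]|%:R)%R%:R) <= expR (- a).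
Proof.
move=> fi aA; have := @upper_tail _ _ _ _ lw (f @: A) P a.
rewrite card_in_imset // => /(_ aA); congr (_ <= _); apply: eq_Ex => o.
by rewrite (card_fiber (fun x => P (o x)) fi).
Qed.

End Union.

Section Uniform.
Variables (R : realType) (q : nat).
Hypothesis q0 : (0 < q)%N.

Definition uniform : 'I_q -> R := fun=> q%:R^-1.

Lemma uniform_law : law uniform.
Proof.
split=> [y|]; first by rewrite invr_ge0.
by rewrite sumr_const card_ord -[LHS]mulr_natr mulVf // pnatr_eq0 -lt0n.
Qed.

Lemma uniform_prob (P : pred 'I_q) : \sum_(y | P y) uniform y = #|P|%:R / q%:R.
Proof. by rewrite sumr_const mulr_natl. Qed.

End Uniform.

Section Grouping.
Variables (R : realType) (T : finType) (N m K q : nat).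
Variable vtx : layered N m K -> T.
Hypothesis vtx_inj : injective vtx.
Hypothesis Kq : (K < q)%N.
Variables (C : Type) (c : {set T} -> C) (H : graph T) (o : {ffun {set T} -> bool}).
Hypothesis HE : forall e, (e \in edges H) = o e && (#|e| == 2%N).
Hypothesis cp : proper_colouring H c.

Let q0 : (0 < q)%N := leq_ltn_trans (leq0n K) Kq.

(** A stand-in for the colour of [e]: the colour type is arbitrary, while the classes live in a
    finite type and can index a product measure. *)
Let colour_class (e : {set T}) : {set {set T}} := [set f in edges H | `[< c f = c e >]].

Lemma colour_class_eq e f : e \in edges H -> colour_class e = colour_class f -> c e = c f.
Proof.
move=> eH ef; have : e \in colour_class e by rewrite inE eH; apply/asboolP.
by rewrite ef inE => /andP[_ /asboolP].
Qed.

(** Makes the Chernoff bounds applicable to each star: its edges have distinct colours, hence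
    independent groups. *)
Lemma star_colours_inj (I : finType) (e : I -> {set T}) v : injective e ->
  (forall i, v \in e i) ->
  {in [set i | e i \in edges H] &, injective (fun i => colour_class (e i))}.
Proof.
move=> ei ve i j; rewrite !inE => iH jH /colour_class_eq cij.
apply/eqP/negPn/negP => nij; apply: (cp iH jH _ _ (cij iH)).
  by rewrite (inj_eq ei).
by apply/set0Pn; exists v; rewrite inE !ve.
Qed.

(** Each colour receives a uniform random group; the last hypothesis is the union bound over all
    stars, which have about A1/q edges in a given group or at most a share (K+1)/q of A2 in the
    groups up to K. *)
Lemma exists_grouping (A1 A2 : R) :
  (forall i u a, A1 <= #|[set b | o (ste vtx i u a b)]|%:R) ->
  (forall a, #|[set z | o (eZ vtx a z)]|%:R <= A2) ->
  (forall u, #|[set z | o (eC vtx u z)]|%:R <= A2) ->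
  (K.+1 * N * m)%:R * expR (- (A1 / q%:R / 4)) +
    (m + N)%:R * expR (- (K.+1%:R / q%:R * A2)) < 1 ->
  exists g : {set T} -> 'I_q,
   [/\ (forall e f, e \in edges H -> f \in edges H -> c e = c f -> g e = g f),
    (forall i u a, A1 / q%:R / 4 <=
       #|[set b | o (ste vtx i u a b) && (g (ste vtx i u a b) == i :> nat)]|%:R),
    (forall a, #|[set z | o (eZ vtx a z) && (g (eZ vtx a z) <= K)%N]|%:R <=
       4 * (K.+1%:R / q%:R * A2)) &
    (forall u, #|[set z | o (eC vtx u z) && (g (eC vtx u z) <= K)%N]|%:R <=
       4 * (K.+1%:R / q%:R * A2))].
Proof.
move=> H1 H2 H3 lt1.
have ul := uniform_law R q0.
have qR : 0 < q%:R :> R by rewrite ltr0n.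
have cardK : #|[pred y : 'I_q | (y <= K)%N]| = K.+1.
  rewrite -[RHS]card_ord -(card_imset _ (_ : injective (widen_ord Kq))).
    apply: eq_card => y; rewrite inE; apply/idP/imsetP => [yK|[j _ ->]]; last first.
      by rewrite /= -ltnS.
    by exists (Ordinal (yK : (y < K.+1)%N)) => //; apply: val_inj.
  by move=> i j /(congr1 (@nat_of_ord q)) /= /val_inj.
have probK : \sum_(y : 'I_q | (y <= K)%N) @uniform R q y = K.+1%:R / q%:R.
  by rewrite uniform_prob; congr (_%:R / _); apply: cardK.
have prob1 (i : 'I_K.+1) : \sum_(y : 'I_q | y == i :> nat) @uniform R q y = q%:R^-1.
  by rewrite (big_pred1 (widen_ord Kq i)).
pose star1 (t : 'I_K.+1 * 'I_N * 'I_m) (b : 'I_m) := ste vtx t.1.1 t.1.2 t.2 b.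
pose bad1 (t : 'I_K.+1 * 'I_N * 'I_m) (h : {ffun {set {set T}} -> 'I_q}) : bool :=
  #|[set b in [set b | star1 t b \in edges H] |
     h (colour_class (star1 t b)) == t.1.1 :> nat]|%:R <= A1 / q%:R / 4.
pose bad2 (a : 'I_m) (h : {ffun {set {set T}} -> 'I_q}) : bool :=
  4 * (K.+1%:R / q%:R * A2) <= #|[set z in [set z | eZ vtx a z \in edges H] |
     (h (colour_class (eZ vtx a z)) <= K)%N]|%:R.
pose bad3 (u : 'I_N) (h : {ffun {set {set T}} -> 'I_q}) : bool :=
  4 * (K.+1%:R / q%:R * A2) <= #|[set z in [set z | eC vtx u z \in edges H] |
     (h (colour_class (eC vtx u z)) <= K)%N]|%:R.
pose bad (t : 'I_K.+1 * 'I_N * 'I_m + ('I_m + 'I_N)) h :=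
  match t with inl t => bad1 t h | inr (inl a) => bad2 a h | inr (inr u) => bad3 u h end.
have starE i u a b : (ste vtx i u a b \in edges H) = o (ste vtx i u a b).
  by rewrite HE eg_card ?rank_src ?eqxx ?andbT.
have zE a z : (eZ vtx a z \in edges H) = o (eZ vtx a z).
  by rewrite HE eg_card ?eqxx ?andbT.
have cE u z : (eC vtx u z \in edges H) = o (eC vtx u z).
  by rewrite HE eg_card ?eqxx ?andbT.
have [|h hb] := @union_bound R {set {set T}} 'I_q (@uniform R q) ul _ bad.
  apply: le_lt_trans lt1; rewrite !big_sumType /=; apply: lerD.
    apply: (@le_trans _ _ (\sum_(t : 'I_K.+1 * 'I_N * 'I_m) expR (- (A1 / q%:R / 4)))).
      apply: ler_sum => [[[i u] a]] _.
      apply: (@lower_tail_fiber R _ _ _ ul _ (fun b => colour_class (star1 (i, u, a) b))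
        [set b | star1 (i, u, a) b \in edges H] (fun y : 'I_q => y == i :> nat) (A1 / q%:R)).
        apply: (@star_colours_inj _ _ (vtx (src i u a))); last by move=> b; rewrite !inE eqxx.
        by move=> b b' /(ste_inj vtx_inj)[].
      rewrite prob1 mulrC ler_pM2l ?invr_gt0 //.
      apply: le_trans (H1 i u a) _; rewrite ler_nat; apply/subset_leq_card/subsetP => b.
      by rewrite !inE starE.
    by rewrite sumr_const -[leLHS]mulr_natl !card_prod !card_ord.
  apply: (@le_trans _ _ (\sum_(t : 'I_m + 'I_N) expR (- (K.+1%:R / q%:R * A2)))); last first.
    by rewrite sumr_const -[leLHS]mulr_natl card_sum !card_ord.
  rewrite big_sumType /=; apply: lerD; apply: ler_sum => i _.
    apply: (@upper_tail_fiber R _ _ _ ul _ (fun z => colour_class (eZ vtx i z))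
      [set z | eZ vtx i z \in edges H] (fun y : 'I_q => (y <= K)%N)).
      have ie : injective (eZ vtx i) by move=> b b' /(eZ_inj vtx_inj)[].
      have ve b : vtx (vL N ord_max i) \in eZ vtx i b by rewrite !inE eqxx.
      exact: (star_colours_inj ie ve).
    rewrite probK ler_pM2l ?divr_gt0 ?ltr0n //.
    apply: le_trans (H2 i); rewrite ler_nat; apply/subset_leq_card/subsetP => b.
    by rewrite !inE zE.
  apply: (@upper_tail_fiber R _ _ _ ul _ (fun z => colour_class (eC vtx i z))
    [set z | eC vtx i z \in edges H] (fun y : 'I_q => (y <= K)%N)).
    have ie : injective (eC vtx i) by move=> b b' /(eC_inj vtx_inj)[].
    have ve b : vtx (vU m K i) \in eC vtx i b by rewrite !inE eqxx.
    exact: (star_colours_inj ie ve).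
  rewrite probK ler_pM2l ?divr_gt0 ?ltr0n //.
  apply: le_trans (H3 i); rewrite ler_nat; apply/subset_leq_card/subsetP => b.
  by rewrite !inE cE.
exists (fun e => h (colour_class e)); split.
- move=> e f _ _ cef; congr (h _); apply/setP => d; rewrite !inE.
  by congr (_ && `[< _ >]); rewrite cef.
- move=> i u a; have := hb (inl (i, u, a)); rewrite /bad /bad1 -ltNge => /ltW.
  move/le_trans; apply; rewrite ler_nat; apply/subset_leq_card/subsetP => b.
  by rewrite !inE /star1 /= starE.
- move=> a; have := hb (inr (inl a)); rewrite /bad /bad2 -ltNge => /ltW.
  apply: le_trans; rewrite ler_nat; apply/subset_leq_card/subsetP => b.
  by rewrite !inE zE.
- move=> u; have := hb (inr (inr u)); rewrite /bad /bad3 -ltNge => /ltW.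
  apply: le_trans; rewrite ler_nat; apply/subset_leq_card/subsetP => b.
  by rewrite !inE cE.
Qed.

End Grouping.

Section ConstructionEdges.
Variables (T : finType) (N m K : nat) (vtx : layered N m K -> T).

Definition construction_edges : {set {set T}} :=
  [set e | [exists t : 'I_K.+1 * 'I_N * 'I_m * 'I_m, e == ste vtx t.1.1.1 t.1.1.2 t.1.2 t.2]
         || [exists t : 'I_m * 'I_N, e == eZ vtx t.1 t.2]].

(** A quadruple (i, u, a, b) determines its edge without [a] if i = 0 and without [u] otherwise. The
    bound is linear in m, so a small ratio m/N makes it small against N^2. *)
Lemma card_construction_edges : (m <= N)%N ->
  (#|construction_edges| <= K.+3 * N * m)%N.
Proof.
move=> mN; have [m_gt0|m0] := boolP (0 < m)%N; last first.
  have em (a : 'I_m) : False by have := leq_ltn_trans (leq0n a) (ltn_ord a); apply/negP.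
  rewrite (_ : construction_edges = set0) ?cards0 //.
  apply/setP => e; rewrite !inE; apply/negP => /orP[]/existsP[].
    by move=> t; case: (em t.2).
  by move=> t; case: (em t.1).
have N_gt0 : (0 < N)%N by apply: leq_trans mN.
pose u0 := Ordinal N_gt0; pose a0 := Ordinal m_gt0.
apply: (@leq_trans #|[set ste vtx ord0 t.1 a0 t.2 | t : 'I_N * 'I_m] :|:
   ([set ste vtx t.1.1 u0 t.1.2 t.2 | t : 'I_K.+1 * 'I_m * 'I_m] :|:
    [set eZ vtx t.1 t.2 | t : 'I_m * 'I_N])|).
  apply/subset_leq_card/subsetP => e; rewrite inE => /orP[]/existsP[].
    move=> [[[i u] a] b] /eqP ->; rewrite !inE /=; have [->|i0] := eqVneq i ord0.
      by apply/orP; left; apply/imsetP; exists (u, b).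
    apply/orP; right; apply/orP; left; apply/imsetP; exists (i, a, b) => //.
    by rewrite /ste /src (negbTE i0).
  move=> [a z] /eqP ->; rewrite !inE; apply/orP; right; apply/orP; right.
  by apply/imsetP; exists (a, z).
apply: leq_trans (leq_card_setU _ _) _.
apply: (@leq_trans (N * m + (K.+1 * m * m + m * N))).
  apply: leq_add; first by apply: leq_trans (leq_imset_card _ _) _; rewrite cardT -cardE card_prod !card_ord.
  apply: leq_trans (leq_card_setU _ _) _.
  by apply: leq_add; apply: leq_trans (leq_imset_card _ _) _; rewrite cardT -cardE !card_prod !card_ord.
have : (K.+1 * m * m <= K.+1 * N * m)%N by rewrite leq_mul2r leq_mul2l mN !orbT.
by rewrite (mulnC m N) !mulSn !mulnDl; lia.
Qed.

End ConstructionEdges.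

(** * Colliding paths and closing edges in the random graph *)

Section Events.
Variables (R : realType) (T : finType) (N m K : nat).
Variable vtx : layered N m K -> T.
Hypothesis vtx_inj : injective vtx.
Variable p : R.
Hypothesis p01 : 0 <= p <= 1.
Let bl := bernoulli_law p01.
Let p0 : 0 <= p. Proof. by have /andP[] := p01. Qed.
Local Notation path := ({ffun 'I_K.+1 -> 'I_m}).
Local Notation D := (m%:R * p).

Definition path_edges u (x : path) : {set {set T}} := [set pe vtx u x i | i : 'I_K.+1].

Lemma pe_eq u (x x' : path) i j : pe vtx u x i = pe vtx u x' j ->
  [/\ i = j, x i = x' i & i != ord0 -> x (ord_pred i) = x' (ord_pred i)].
Proof.
move=> /(ste_inj vtx_inj)[ij xi s]; subst j; split=> // i0.
by move: s; rewrite /src (negbTE i0) => -[].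
Qed.

(** An edge of the second path with an end at a position of [I] is not on the first path. By
    [ord_pred_boundary] there are more than |I| of them; going round from position 0 to [ord_max] is
    harmless because the paths agree at the end. *)
Lemma path_edges_union u (x x' : path) (I : {set 'I_K.+1}) :
  I = [set i | x i != x' i] -> I != set0 -> x ord_max = x' ord_max ->
  (K.+1 + #|I|.+1 <= #|path_edges u x :|: path_edges u x'|)%N.
Proof.
move=> IE I0 xm; have nI : ord_max \notin I by rewrite IE inE xm eqxx.
have -> : path_edges u x :|: path_edges u x' =
    path_edges u x :|: (path_edges u x' :\: path_edges u x).
  by apply/setP => e; rewrite !inE; case: (e \in path_edges u x).
rewrite cardsU (_ : _ :&: _ = set0) ?cards0 ?subn0; last first.
  by apply/setP => e; rewrite !inE; case: (e \in path_edges u x); rewrite ?andbF.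
apply: leq_add.
  by rewrite card_imset ?card_ord // => i j /(pe_inj vtx_inj).
apply: leq_trans (ord_pred_boundary I0 nI) _.
rewrite -(@card_imset _ _ (pe vtx u x')); last by move=> i j /(pe_inj vtx_inj).
apply/subset_leq_card/subsetP => e /imsetP[i]; rewrite inE => iI ->.
rewrite inE imset_f // andbT; apply/negP => /imsetP[j _ /pe_eq[ij xi xp]].
move: iI; rewrite IE !inE xi eqxx /=; have [i0|i0] := eqVneq i ord0.
  have -> : ord_pred i = ord_max by rewrite i0; apply: val_inj; rewrite /= modn_small.
  by rewrite xm eqxx.
by rewrite xp ?eqxx.
Qed.

Lemma count_differing (x : path) (I : {set 'I_K.+1}) :
  (#|[set x' : path | [set i | x i != x' i] == I]| <= m ^ #|I|)%N.
Proof.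
pose F (i : 'I_K.+1) : {set 'I_m} := if i \in I then setT else [set x i].
apply: (@leq_trans #|family F|).
  apply/subset_leq_card/subsetP => x'; rewrite inE => /eqP IE; apply/familyP => i.
  by rewrite /F -IE inE; case: eqVneq => [->|_] /=; rewrite inE.
rewrite card_family foldrE big_map big_enum /= (bigID (mem I)) /=.
rewrite (eq_bigr (fun=> m)); last by move=> i iI; rewrite /F iI cardsT card_ord.
rewrite [X in (_ * X)%N]big1 ?muln1; last by move=> i /negbTE iI; rewrite /F iI cards1.
by rewrite prod_nat_const.
Qed.

(** For fixed u there are m^(K+1) paths. A second path differing from the first on I has at most
    m^|I| choices and needs p^(|I|+1) more. Here |I| <= K, D >= 1, and at most 2^(K+1) sets I
    occur. *)
Lemma Ex_collisions_le : 1 <= D ->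
  Ex (bernoulli_pmf p) (fun o => (\sum_u #|collisions vtx o u|)%:R) <=
  N%:R * (2 ^+ K.+1 * D ^+ (2 * K).+1 * p).
Proof.
move=> D1.
have cE o : (\sum_u #|collisions vtx o u|)%:R =
    \sum_(u : 'I_N) \sum_(x : path) \sum_(x' : path | (x != x') && (x ord_max == x' ord_max))
      (present (path_edges u x :|: path_edges u x') o)%:R :> R.
  rewrite natr_sum; apply: eq_bigr => u _; rewrite pair_big_dep /= -sum1_card natr_sum.
  rewrite big_mkcond [RHS]big_mkcond /=; apply: eq_bigr => -[x x'] _; rewrite !inE /=.
  have prE y : present (path_edges u y) o = [forall i, o (pe vtx u y i)].
    apply/forall_inP/forallP => [H i|H e /imsetP[i _ ->]] //.
    by apply: H; apply: imset_f.
  by rewrite presentU !prE; case: (x != x'); case: (_ == _) => //=; case: (_ && _).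
rewrite (eq_Ex _ cE) Ex_sum.
apply: (@le_trans _ _ (\sum_(u : 'I_N) (2 ^+ K.+1 * D ^+ (2 * K).+1 * p))); last first.
  by rewrite sumr_const card_ord -[leLHS]mulr_natl.
apply: ler_sum => u _; rewrite Ex_sum.
apply: (@le_trans _ _ (\sum_(x : path) (2 ^+ K.+1 * (p ^+ K.+1 * D ^+ K * p)))); last first.
  rewrite sumr_const card_ffun !card_ord -[leLHS]mulr_natl natrX.
  rewrite [leRHS](_ : _ = m%:R ^+ K.+1 * (2 ^+ K.+1 * (p ^+ K.+1 * D ^+ K * p))) //.
  rewrite (_ : (2 * K).+1 = K.+1 + K)%N; last by lia.
  by rewrite exprD [D ^+ K.+1]exprMn; ring.
apply: ler_sum => x _; rewrite Ex_sum.
rewrite (partition_big (fun x' : path => [set i | x i != x' i])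
   (fun I : {set 'I_K.+1} => (I != set0) && (ord_max \notin I))) /=; last first.
  move=> x' /andP[nx /eqP xm]; rewrite inE xm eqxx andbT; apply/set0Pn.
  have [i xi] : exists i, x i != x' i.
    by apply/existsP; apply: contraNT nx => /existsPn H; apply/eqP/ffunP => i;
      apply/eqP/negPn/H.
  by exists i; rewrite inE.
apply: (@le_trans _ _ (\sum_(I : {set 'I_K.+1} | (I != set0) && (ord_max \notin I))
   p ^+ K.+1 * D ^+ K * p)); last first.
  rewrite sumr_const -[leLHS]mulr_natl ler_wpM2r //.
    by rewrite !mulr_ge0 ?exprn_ge0 ?mulr_ge0.
  rewrite -natrX ler_nat; apply: leq_trans (max_card _) _.
  by rewrite -cardsT -powersetT card_powerset cardsT card_ord.
apply: ler_sum => I /andP[I0 Im].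
apply: (@le_trans _ _ (\sum_(x' in [set x' : path | [set i | x i != x' i] == I])
   p ^+ (K.+1 + #|I|.+1))).
  rewrite [leRHS](eq_bigl (fun x' : path => [set i | x i != x' i] == I)); last first.
    by move=> x'; rewrite inE.
  rewrite big_mkcond [leRHS]big_mkcond; apply: ler_sum => x' _.
  case: (eqVneq [set i | x i != x' i] I) => [IE|_]; last by rewrite andbF.
  rewrite andbT; case: ifP => [/andP[nx /eqP xm]|_]; last exact: exprn_ge0.
  rewrite Ex_present //; apply: ler_wiXn2l => //; first by have /andP[] := p01.
  by apply: path_edges_union => //; rewrite IE.
rewrite sumr_const -[leLHS]mulr_natl.
apply: (@le_trans _ _ ((m ^ #|I|)%:R * p ^+ (K.+1 + #|I|.+1))).
  by rewrite ler_wpM2r ?exprn_ge0 // ler_nat count_differing.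
have -> : (m ^ #|I|)%:R * p ^+ (K.+1 + #|I|.+1) = p ^+ K.+1 * D ^+ #|I| * p.
  by rewrite natrX exprD exprMn [p ^+ #|I|.+1]exprS; ring.
rewrite ler_wpM2r // ler_wpM2l ?exprn_ge0 // ler_weXn2l //.
by have := max_card (mem (ord_max |: I)); rewrite cardsU1 Im card_ord add1n ltnS.
Qed.

End Events.

Section Closing.
Variables (R : realType) (T : finType) (N m K q : nat).
Variable vtx : layered N m K -> T.
Hypothesis vtx_inj : injective vtx.
Variable p : R.
Hypothesis p01 : 0 <= p <= 1.
Hypothesis q0 : (0 < q)%N.
Let bl := bernoulli_law p01.
Let p0 : 0 <= p. Proof. by have /andP[] := p01. Qed.

Lemma ste_construction i u a b : ste vtx i u a b \in construction_edges vtx.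
Proof. by rewrite inE; apply/orP; left; apply/existsP; exists (i, u, a, b). Qed.

Lemma eZ_construction a z : eZ vtx a z \in construction_edges vtx.
Proof. by rewrite inE; apply/orP; right; apply/existsP; exists (a, z). Qed.

Lemma closable_ext (o o' : {ffun {set T} -> bool}) (g g' : {set T} -> 'I_q) :
  (forall e, e \in construction_edges vtx -> o e = o' e) ->
  (forall e, e \in construction_edges vtx -> o e -> g e = g' e) ->
  closable vtx o g = closable vtx o' g'.
Proof.
move=> oo gg.
have gd u x : good vtx o g u x = good vtx o' g' u x.
  apply: eq_forallb => i; have h := ste_construction i u (x (ord_pred i)) (x i).
  rewrite -(oo _ h); case E: (o (pe vtx u x i)) => //=.
  by rewrite gg.
have ee u : ends vtx o g u = ends vtx o' g' u.
  apply/setP => a; apply/imsetP/imsetP => -[x xg ->]; exists x => //;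
    by move: xg; rewrite !inE gd.
apply/setP => uz; rewrite !inE; apply: eq_existsb => a; rewrite ee.
have h := eZ_construction a uz.2; rewrite -(oo _ h).
by case E: (o _) => //=; rewrite gg.
Qed.

Definition closing_edges : {set {set T}} :=
  [set e | [exists t : 'I_N * 'I_N, e == eC vtx t.1 t.2]].

Lemma construction_not_closing e :
  e \in construction_edges vtx -> e \in closing_edges = false.
Proof.
move=> H; apply/negbTE/negP; rewrite inE => /existsP[[u z] /eqP ez]; move: H; rewrite ez inE.
case/orP => /existsP[t /eqP E].
  exact: (ste_eC vtx_inj (esym E)).
exact: (eZ_eC vtx_inj (esym E)).
Qed.

(* The closing edges are independent of the construction edges, and only the groups of
   the construction edges present matter: a union bound over at most q^t groupings. *)
Lemma closing_failure_prob (t : R) :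
  Ex (bernoulli_pmf p) (fun o =>
    ((#|[set e in construction_edges vtx | o e]|%:R <= t)%R &&
     [exists g : {ffun {set T} -> 'I_q}, (N * N <= 4 * #|closable vtx o g|)%N &&
       (#|[set uz in closable vtx o g | o (eC vtx uz.1 uz.2)]|%:R <=
          p * (N * N)%:R / 4 / 4)%R])%:R) <=
  expR (q%:R * t - p * (N * N)%:R / 4 / 4).
Proof.
set ev := (fun o : {ffun {set T} -> bool} => _).
pose op (e : {set T}) (b1 b2 : bool) := if e \in closing_edges then b2 else b1.
rewrite -(@Ex_two_copies _ _ _ _ _ (bernoulli_pmf p) (bernoulli_pmf p) (bernoulli_pmf p) op);
  last first.
  move=> e y; rewrite big_mkcond -(pair_bigA _ (fun a b =>
     if op e a b == y then bernoulli_pmf p a * bernoulli_pmf p b else 0)) /=.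
  by rewrite big_bool !big_bool /bernoulli_pmf /op /=;
     case: (e \in closing_edges); case: y => /=; ring.
rewrite -[leRHS](Ex_cst {set T} bl); apply: (Ex_le bl) => o1.
pose S := [set e in construction_edges vtx | o1 e].
pose d0 : 'I_q := Ordinal q0.
(* Groupings normalised to [d0] away from the construction edges present in the first sample; there
   are q^|S| of them. *)
pose Gam := [set g : {ffun {set T} -> 'I_q} | g \in pffun_on d0 (mem S) predT].
have [tS|tS] := leP (#|S|%:R : R) t; last first.
  rewrite (_ : Ex _ _ = 0) ?expR_ge0 //; apply: big1 => o2 _.
  rewrite /ev (_ : [set e in construction_edges vtx | _] = S); last first.
    apply/setP => e; rewrite [LHS]in_set [RHS]in_set ffunE /op.
    by case: (boolP (e \in construction_edges vtx)) => //= ec; rewrite construction_not_closing.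
  by rewrite leNgt tS /= mulr0.
pose cnt (g : {ffun {set T} -> 'I_q}) (o2 : {ffun {set T} -> bool}) : bool :=
  (N * N <= 4 * #|closable vtx o1 g|)%N &&
  (#|[set uz in closable vtx o1 g | o2 (eC vtx uz.1 uz.2)]|%:R <= p * (N * N)%:R / 4 / 4)%R.
apply: (@le_trans _ _ (\sum_(g in Gam) Ex (bernoulli_pmf p) (fun o2 => (cnt g o2)%:R))).
  rewrite -Ex_sum; apply: (Ex_le bl) => o2; rewrite /ev.
  set o := [ffun x => _].
  have oo e : e \in construction_edges vtx -> o e = o1 e.
    by move=> ec; rewrite ffunE /op construction_not_closing.
  case: andP => [[_ /existsP[g /andP[g1 g2]]]|_] /=; last by apply: sumr_ge0.
  pose g' : {ffun {set T} -> 'I_q} := [ffun e => if e \in S then g e else d0].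
  have gE : closable vtx o g = closable vtx o1 g'.
    by apply: closable_ext => // e ec oe; rewrite ffunE inE ec -(oo _ ec) oe.
  have g'G : g' \in Gam.
    rewrite inE; apply/pffun_onP; split=> //.
    by apply/supportP => f fS; rewrite ffunE; case: ifP fS => //= ->.
  rewrite (bigD1 g') //= (_ : cnt g' o2 = true) ?lerDl ?sumr_ge0 //.
  rewrite /cnt -gE g1 /=; apply: le_trans g2; rewrite ler_nat.
  apply/subset_leq_card/subsetP => uz; rewrite !inE => /andP[-> /=].
  rewrite ffunE /op (_ : (_ \in closing_edges) = true) //.
  by rewrite inE; apply/existsP; exists uz.
apply: (@le_trans _ _ (\sum_(g in Gam) expR (- (p * (N * N)%:R / 4 / 4)))).
  apply: ler_sum => g _; case: (leqP (N * N) (4 * #|closable vtx o1 g|)) => NP; last first.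
    rewrite (_ : Ex _ _ = 0) ?expR_ge0 //; apply: big1 => o2 _.
    by rewrite /cnt leqNgt NP /= mulr0.
  have := @lower_tail_fiber R _ _ _ bl _ (fun uz : 'I_N * 'I_N => eC vtx uz.1 uz.2)
    (closable vtx o1 g) id (p * (N * N)%:R / 4).
  rewrite bernoulli_true => H; apply: le_trans (H _ _).
  - by apply: (Ex_le bl) => o2; rewrite ler_nat /cnt NP.
  - by move=> [u z] [u' z'] _ _ /(eC_inj vtx_inj)[/= -> ->].
  - rewrite -mulrA ler_wpM2l // ler_pdivrMr // mulrC -natrM ler_nat //.
rewrite sumr_const -[leLHS]mulr_natl expRD; apply: ler_pM => //; rewrite ?expR_ge0 //.
apply: (@le_trans _ _ (expR q%:R ^+ #|S|)).
  have -> : #|Gam| = (q ^ #|S|)%N.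
    rewrite /Gam cardsE card_pffun_on; congr (_ ^ _)%N.
    by rewrite -[RHS]card_ord; apply: eq_card.
  rewrite natrX lerXn2r ?nnegrE ?expR_ge0 //.
  by apply: le_trans (expR_ge1Dx _); rewrite lerDr.
by rewrite -expRM_natr ler_expR ler_wpM2l.
Qed.

End Closing.

Lemma half_bounds N : (1 < N)%N -> (2 * N./2 <= N)%N /\ (N <= 4 * N./2)%N.
Proof. by move=> N2; split; lia. Qed.

Lemma exists_injection (V : finType) n : (#|V| <= n)%N -> exists f : V -> 'I_n, injective f.
Proof.
move=> card; exists (fun v => widen_ord card (enum_rank v)) => v w /(congr1 (@nat_of_ord n)) /=.
by move/val_inj/enum_rank_inj.
Qed.

(** * Failure probability for long cycles *)

Section OneBound.
Variables (R : realType) (n N m K s d : nat) (p : R).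
(** Then 4 (K+1)/q times 4 N p equals N p / 16. So the edges to Z of groups up to K number at most s
    N p / 16 from s ends, which is at most p s b / 4 for b = N./2, and at most p N^2 / 16 from U,
    the threshold for closing edges. *)
Let q := (256 * K.+1)%N.
Hypothesis p01 : 0 <= p <= 1.
Hypothesis fit : (2 * N + K.+1 * m <= n)%N.
Hypotheses (m0 : (0 < m)%N) (mN : (m <= N)%N) (N2 : (1 < N)%N) (s0 : (0 < s)%N).
Hypothesis mp1 : 1 <= m%:R * p.
Hypothesis dmp : d%:R <= m%:R * p / 4 / q%:R / 4.
Hypothesis sd : (2 * s <= d ^ K.+1)%N.
Hypothesis ps : 64 <= s%:R * p.
Hypothesis group_lt1 : (K.+1 * N * m)%:R * expR (- (m%:R * p / 4 / q%:R / 4)) +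
  (m + N)%:R * expR (- (K.+1%:R / q%:R * (4 * (N%:R * p)))) < 1.
Local Notation a5 := ((K.+3 * N * m)%:R * p).

(** The terms bound, in order: too many collisions (Markov, with 1/s replaced by p), a vertex with
    few neighbours in the next layer, a vertex with many neighbours in Z, sets W and B with few
    edges between them, too many construction edges, and a grouping with many closable pairs but few
    closing edges. *)
Lemma arrow_failure_le :
  1 - gnp_prob p (fun G : graph 'I_n => rb_arrow G (cycle_graph K.+3)) <=
  2 ^+ K.+2 * (m%:R * p) ^+ (2 * K).+1 * p ^+ 2 +
  (K.+1 * N * m)%:R * expR (- (m%:R * p / 4)) +
  (m + N)%:R * expR (- (N%:R * p)) +
  (2 ^ (m + N))%:R * expR (- (p * (s * N./2)%:R / 4)) +
  expR (- a5) +
  expR (q%:R * (4 * a5) - p * (N * N)%:R / 4 / 4).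
Proof.
have [vtx vtx_inj] : exists vtx : layered N m K -> 'I_n, injective vtx.
  by apply: exists_injection; rewrite !card_sum card_prod !card_ord; apply: leq_trans fit; lia.
have bl := bernoulli_law p01; have [p0 p1] := andP p01.
have q0 : (0 < q)%N by [].
have Kq : (K < q)%N by rewrite /q; lia.
pose b := N./2.
pose i1 (o : {ffun {set 'I_n} -> bool}) : bool :=
  (N * s)%:R <= 2 * (\sum_u #|collisions vtx o u|)%:R :> R.
pose i2 t (o : {ffun {set 'I_n} -> bool}) : bool :=
  #|[set e in [set: 'I_m] | o (ste vtx t.1.1 t.1.2 t.2 e)]|%:R <= m%:R * p / 4.
pose i3 a (o : {ffun {set 'I_n} -> bool}) : bool :=
  4 * (N%:R * p) <= #|[set z in [set: 'I_N] | o (eZ vtx a z)]|%:R.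
pose i3' u (o : {ffun {set 'I_n} -> bool}) : bool :=
  4 * (N%:R * p) <= #|[set z in [set: 'I_N] | o (eC vtx u z)]|%:R.
pose i4 (WB : {set 'I_m} * {set 'I_N}) (o : {ffun {set 'I_n} -> bool}) : bool :=
  (#|WB.1| == s) && (#|WB.2| == b) &&
  (#|[set az in setX WB.1 WB.2 | o (eZ vtx az.1 az.2)]|%:R <= p * (s * b)%:R / 4).
pose i5 (o : {ffun {set 'I_n} -> bool}) : bool :=
  4 * a5 <= #|[set e in construction_edges vtx | o e]|%:R.
pose i6 (o : {ffun {set 'I_n} -> bool}) : bool :=
  (#|[set e in construction_edges vtx | o e]|%:R <= 4 * a5)%R &&
     [exists g : {ffun {set 'I_n} -> 'I_q}, (N * N <= 4 * #|closable vtx o g|)%N &&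
       (#|[set uz in closable vtx o g | o (eC vtx uz.1 uz.2)]|%:R <=
          p * (N * N)%:R / 4 / 4)%R].
have arrow o : ~~ i1 o -> (forall t, ~~ i2 t o) -> (forall a, ~~ i3 a o) ->
    (forall u, ~~ i3' u o) -> (forall WB, ~~ i4 WB o) -> ~~ i5 o -> ~~ i6 o ->
    rb_arrow (graph_of o) (cycle_graph K.+3).
  move=> n1 n2 n3 n3' n4 n5 n6 C c cp.
  have qR : 0 < q%:R :> R by rewrite ltr0n.
  have Kq' : K.+1%:R / q%:R = 256^-1 :> R.
    by rewrite /q natrM invfM mulrA mulrAC divff ?mul1r // pnatr_eq0.
  have [g [gc g1 g2 g3]] := exists_grouping vtx_inj Kq (mem_edges_graph_of o) cp
    (A1 := m%:R * p / 4) (A2 := 4 * (N%:R * p))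
    ltac:(move=> i u a; have := n2 (i, u, a); rewrite /i2 -ltNge => /ltW;
      by move/le_trans; apply; rewrite ler_nat; apply/subset_leq_card/subsetP => e; rewrite !inE)
    ltac:(move=> a; have := n3 a; rewrite /i3 -ltNge => /ltW;
      by apply: le_trans; rewrite ler_nat; apply/subset_leq_card/subsetP => e; rewrite !inE)
    ltac:(move=> u; have := n3' u; rewrite /i3' -ltNge => /ltW;
      by apply: le_trans; rewrite ler_nat; apply/subset_leq_card/subsetP => e; rewrite !inE)
    group_lt1.
  have e16 : 4 * (K.+1%:R / q%:R * (4 * (N%:R * p))) = N%:R * p / 16 :> R.
    by rewrite Kq'; lra.
  rewrite e16 in g2 g3.
  pose t4 := \max_(a : 'I_m) #|[set z | o (eZ vtx a z) && (g (eZ vtx a z) <= K)%N]|.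
  have t4R : t4%:R <= N%:R * p / 16.
    rewrite /t4; apply: (big_ind (fun k : nat => k%:R <= N%:R * p / 16)) => //.
      by rewrite divr_ge0 // mulr_ge0.
    by move=> x y hx hy; rewrite /maxn; case: ifP.
  have [b2 b4] := half_bounds N2.
  have close : (N * N <= 4 * #|closable vtx o g|)%N.
    apply: (closable_ge (d := d) (s := s) (b := b) (t3 := (s * t4)%N) (t4 := t4)) => //.
    - by move=> i u a; rewrite -(ler_nat R); apply: le_trans (g1 i u a).
    - by move: n1; rewrite /i1 -ltNge -natrM ltr_nat => /ltnW.
    - move=> W B cW cB; rewrite -(ltr_nat R).
      have := n4 (W, B); rewrite /i4 /= cW cB !eqxx /= -ltNge => h.
      apply: le_lt_trans (lt_le_trans h _).
        rewrite natrM; apply: (@le_trans _ _ (s%:R * (N%:R * p / 16))).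
          by rewrite ler_wpM2l.
        have bR : N%:R <= 4 * b%:R :> R by rewrite -natrM ler_nat.
        rewrite natrM (_ : p * (s%:R * b%:R) / 4 = s%:R * (4 * b%:R * p / 16)); last by lra.
        by rewrite ler_wpM2l // ler_wpM2r // ler_wpM2r.
      rewrite ler_nat; apply/subset_leq_card/subsetP => az; rewrite !inE.
      by rewrite -andbA.
    - by move=> a; apply: (@leq_bigmax _ (fun a => #|[set z | o (eZ vtx a z) && (g (eZ vtx a z) <= K)%N]|)).
  (* If every present closing edge over a closable pair had group at most K, there would be at most
     N times N p / 16 of them, contradicting [n6]. *)
  have [uz uzP] : exists uz, [&& uz \in closable vtx o g, o (eC vtx uz.1 uz.2) &
      (K < g (eC vtx uz.1 uz.2))%N].
    apply/existsP; apply: contraNT n6 => /existsPn H; rewrite /i6.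
    move: n5; rewrite /i5 -ltNge => /ltW -> /=.
    apply/existsP; exists [ffun e => g e].
    have cE : closable vtx o [ffun e => g e] = closable vtx o g.
      by apply: closable_ext => // e _ _; rewrite ffunE.
    rewrite cE close /=.
    apply: (@le_trans _ _ (\sum_(u in [set: 'I_N]) #|[set z | o (eC vtx u z) && (g (eC vtx u z) <= K)%N]|)%:R).
      rewrite ler_nat -card_pairs; apply/subset_leq_card/subsetP => -[u z].
      rewrite !(in_set, inE) => /andP[uzc ouz] /=; have := H (u, z).
      by rewrite [(u, z) \in _]inE uzc /= ouz /= -leqNgt.
    rewrite natr_sum; apply: (@le_trans _ _ (\sum_(u in [set: 'I_N]) (N%:R * p / 16))).
      by apply: ler_sum => u _; apply: g3.
    by rewrite sumr_const cardsT card_ord -[leLHS]mulr_natl natrM; lra.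
  case/and3P: uzP; case: uz => u z uzc ouz gz.
  exact: (rainbow_closing vtx_inj (mem_edges_graph_of o) erefl cp gc uzc ouz gz).
rewrite gnp_probE // -{1}(Ex_cst {set 'I_n} bl 1).
have -> : Ex (bernoulli_pmf p) (fun _ : {ffun {set 'I_n} -> bool} => 1) - Ex (bernoulli_pmf p)
     (fun o : {ffun {set 'I_n} -> bool} => `[< rb_arrow (graph_of o) (cycle_graph K.+3) >]%:R) =
   Ex (bernoulli_pmf p) (fun o : {ffun {set 'I_n} -> bool} =>
     1 - `[< rb_arrow (graph_of o) (cycle_graph K.+3) >]%:R).
  apply/eqP; rewrite subr_eq; apply/eqP; rewrite -ExD.
  by apply: eq_Ex => o; rewrite subrK.
apply: (@le_trans _ _ (Ex (bernoulli_pmf p) (fun o : {ffun {set 'I_n} -> bool} =>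
   (i1 o)%:R + \sum_t (i2 t o)%:R + (\sum_a (i3 a o)%:R + \sum_u (i3' u o)%:R) +
   \sum_WB (i4 WB o)%:R + (i5 o)%:R + (i6 o)%:R))).
  apply: (Ex_le bl) => o.
  have s2 : 0 <= \sum_t (i2 t o)%:R :> R by apply: sumr_ge0.
  have s3 : 0 <= \sum_a (i3 a o)%:R :> R by apply: sumr_ge0.
  have s3' : 0 <= \sum_u (i3' u o)%:R :> R by apply: sumr_ge0.
  have s4 : 0 <= \sum_WB (i4 WB o)%:R :> R by apply: sumr_ge0.
  have [c1 c5 c6] : [/\ 0 <= (i1 o)%:R :> R, 0 <= (i5 o)%:R :> R & 0 <= (i6 o)%:R :> R] by [].
  have one (I : finType) (F : I -> bool) : (exists i, F i) -> 1 <= \sum_i (F i)%:R :> R.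
    by move=> [i Fi]; rewrite (bigD1 i) //= Fi lerDl sumr_ge0.
  case: asboolP => [_|na]; first by rewrite subrr !addr_ge0.
  rewrite subr0; apply: contrapT => lt1; apply: na; apply: arrow.
  - by apply/negP => h; apply: lt1; have : (i1 o)%:R = 1 :> R by [rewrite h]; lra.
  - by move=> t; apply/negP => h; apply: lt1; have := one _ (i2^~ o) (ex_intro _ t h); lra.
  - by move=> t; apply/negP => h; apply: lt1; have := one _ (i3^~ o) (ex_intro _ t h); lra.
  - by move=> t; apply/negP => h; apply: lt1; have := one _ (i3'^~ o) (ex_intro _ t h); lra.
  - by move=> t; apply/negP => h; apply: lt1; have := one _ (i4^~ o) (ex_intro _ t h); lra.
  - by apply/negP => h; apply: lt1; have : (i5 o)%:R = 1 :> R by [rewrite h]; lra.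
  - by apply/negP => h; apply: lt1; have : (i6 o)%:R = 1 :> R by [rewrite h]; lra.
rewrite !ExD !Ex_sum.
have NR : 0 < N%:R :> R by rewrite ltr0n ltnW.
have sR : 0 < s%:R :> R by rewrite ltr0n.
have inN (I : finType) (f : 'I_N -> I) : injective f -> {in [set: 'I_N] &, injective f}.
  by move=> h x y _ _; apply: h.
apply: lerD; [apply: lerD; [apply: lerD; [apply: lerD; [apply: lerD|]|]|]|].
- apply: le_trans (@markov _ _ _ _ bl (fun o => 2 * (\sum_u #|collisions vtx o u|)%:R) (N * s)%:R _ _) _.
  + by rewrite ltr0n muln_gt0 s0 ltnW.
  + by move=> o; rewrite mulr_ge0.
  rewrite ExZ ler_pdivrMr ?ltr0n ?muln_gt0 ?s0 ?(ltnW N2) //.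
  apply: le_trans (ler_wpM2l _ (Ex_collisions_le vtx_inj p01 mp1)) _ => //.
  pose X := 2 ^+ K.+1 * (m%:R * p) ^+ (2 * K).+1 * p.
  have X0 : 0 <= X by rewrite !mulr_ge0 ?exprn_ge0 ?mulr_ge0.
  have -> : 2 ^+ K.+2 * (m%:R * p) ^+ (2 * K).+1 * p ^+ 2 * (N * s)%:R =
     2 * N%:R * X * (s%:R * p) by rewrite /X natrM [2 ^+ K.+2]exprS expr2; ring.
  rewrite -/X [leLHS]mulrA.
  have sp1 : 1 <= s%:R * p by move: ps; lra.
  have NX : 0 <= 2 * N%:R * X by apply: mulr_ge0 => //; apply: mulr_ge0.
  by rewrite ler_peMr.
- apply: (@le_trans _ _ (\sum_(t : 'I_K.+1 * 'I_N * 'I_m) expR (- (m%:R * p / 4)))).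
    apply: ler_sum => [[[i u] a]] _.
    apply: (@lower_tail_fiber R _ _ _ bl _ (fun e => ste vtx i u a e) setT id).
      by move=> x y _ _ /(ste_inj vtx_inj)[].
    by rewrite bernoulli_true cardsT card_ord mulrC.
  by rewrite sumr_const -[leLHS]mulr_natl !card_prod !card_ord.
- rewrite natrD mulrDl; apply: lerD.
    apply: (@le_trans _ _ (\sum_(a : 'I_m) expR (- (N%:R * p)))).
      apply: ler_sum => a _; apply: (@upper_tail_fiber R _ _ _ bl _ (eZ vtx a) setT id).
        by apply: inN => x y /(eZ_inj vtx_inj)[].
      by rewrite bernoulli_true cardsT card_ord mulrC.
    by rewrite sumr_const -[leLHS]mulr_natl card_ord.
  apply: (@le_trans _ _ (\sum_(a : 'I_N) expR (- (N%:R * p)))).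
    apply: ler_sum => a _; apply: (@upper_tail_fiber R _ _ _ bl _ (eC vtx a) setT id).
      by apply: inN => x y /(eC_inj vtx_inj)[].
    by rewrite bernoulli_true cardsT card_ord mulrC.
  by rewrite sumr_const -[leLHS]mulr_natl card_ord.
- apply: (@le_trans _ _ (\sum_(WB : {set 'I_m} * {set 'I_N}) expR (- (p * (s * N./2)%:R / 4)))).
    apply: ler_sum => -[W B] _; rewrite /i4 /=.
    have [/andP[/eqP cW /eqP cB]|_] := boolP ((#|W| == s) && (#|B| == b)); last first.
      by rewrite (_ : Ex _ _ = 0) ?expR_ge0 //; apply: big1 => o _; rewrite mulr0.
    apply: (@lower_tail_fiber R _ _ _ bl _ (fun az : 'I_m * 'I_N => eZ vtx az.1 az.2) (setX W B) id).
      by move=> [x1 x2] [y1 y2] _ _ /(eZ_inj vtx_inj)[/= -> ->].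
    by rewrite bernoulli_true cardsX cW cB.
  rewrite sumr_const -[leLHS]mulr_natl card_prod -!cardsT -!powersetT !card_powerset.
  by rewrite !cardsT !card_ord expnD.
- have := @upper_tail_fiber R _ _ _ bl _ id (construction_edges vtx) id a5.
  apply; first by move=> x y.
  rewrite bernoulli_true mulrC ler_wpM2r // ler_nat.
  exact: (card_construction_edges vtx mN).
- exact: (closing_failure_prob vtx_inj p01 q0).
Qed.

End OneBound.

Lemma expRN_le_pow (R : realType) (j : nat) (x : R) : 0 < x ->
  expR (- x) <= (j.+1)`!%:R / x ^+ j.+1.
Proof.
move=> x0; have := @expR_ge1Dxn R x j (ltW x0).
have f0 : 0 < (j.+1)`!%:R :> R by rewrite ltr0n fact_gt0.
have xj : 0 < x ^+ j.+1 by rewrite exprn_gt0.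
move=> h; have {}h : x ^+ j.+1 / (j.+1)`!%:R <= expR x by apply: le_trans h; lra.
rewrite expRN -[leRHS]invf_div lef_pV2 ?posrE ?expR_gt0 ?divr_gt0 //.
Qed.

Lemma split_sizes k C0 n : (k <= C0)%N -> (64 < C0)%N -> (12 * C0 <= n)%N ->
  let N := (n %/ 3)%N in let m := (N %/ C0)%N in
  [/\ 2 * N + k * m <= n, 0 < m, m <= N, 64 < N & [/\ n <= 6 * C0 * m, C0 * m <= N & N <= n]]%N.
Proof.
move=> kC C64 n12 N m.
have h1 : (n < 3 * N.+1)%N by rewrite mulnC ltn_ceil.
have h2 : (N < C0 * m.+1)%N by rewrite mulnC ltn_ceil // (leq_trans _ C64).
have h3 : (3 * N <= n)%N by rewrite mulnC leq_trunc_div.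
have h4 : (C0 * m <= N)%N by rewrite mulnC leq_trunc_div.
have m0 : (0 < m)%N.
  rewrite lt0n; apply/eqP => m0; move: h2 h1 n12 C64; rewrite m0 muln1.
  by clear; lia.
have km : (k * m <= N)%N by apply: leq_trans h4; rewrite leq_mul2r kC orbT.
have mN : (m <= N)%N.
  by apply: leq_trans h4; rewrite leq_pmull // (leq_trans _ C64).
have nm : (n <= 6 * C0 * m)%N.
  have h5 : (C0 <= C0 * m)%N by rewrite leq_pmulr.
  move: h1 h2; rewrite (mulnS C0) -mulnA; move: (C0 * m)%N h5 => a; clear; lia.
split=> //.
- by apply: leq_trans h3; rewrite (_ : 3 = 2 + 1)%N // mulnDl mul1n leq_add2l.
- by move: h1 n12 C64; move: N {m h2 h3 h4 m0 km mN nm} => a; clear; lia.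
- split=> //; apply: leq_trans h3; exact: leq_pmull.
Qed.

Lemma leR_pow2 (R : realType) (a : nat) : (2 ^ a)%:R <= expR a%:R :> R.
Proof.
rewrite natrX -[a%:R]mulr1 expRM_natl lerXn2r ?nnegrE ?expR_ge0 //.
exact: expR1_ge2.
Qed.

(** * Choice of the parameters *)

Section OneAsymptotics.
Variables (R : realType) (K : nat).
Let A := (4 * K + 6)%N.
Let E := (A * K.+2)%N.

(** The collision term (np)^(2K+1) p^2: the powers of y combine to y^(-A), while lam contributes at
    most y^(2K+3). The choice of [A] leaves a factor 1/y to spare. *)
Lemma two_star_term (y lam : R) : 1 <= y -> 0 <= lam <= y ->
  (lam * y ^+ A) ^+ (2 * K).+1 * (lam / y ^+ (A * K.+1)) ^+ 2 <= y^-1.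
Proof.
move=> y1 /andP[l0 ly]; have y0 : 0 < y by apply: lt_le_trans y1.
have yX a : y ^+ a != 0 by rewrite gt_eqF // exprn_gt0.
have -> : (lam * y ^+ A) ^+ (2 * K).+1 * (lam / y ^+ (A * K.+1)) ^+ 2 =
    lam ^+ (2 * K + 3) / y ^+ A.
  rewrite exprMn expr_div_n -!exprM.
  have -> : (A * K.+1 * 2 = A * (2 * K).+1 + A)%N by lia.
  have -> : (2 * K + 3 = (2 * K).+1 + 2)%N by lia.
  rewrite !exprD; move: (y ^+ (A * _)) (y ^+ A) (yX (A * (2 * K).+1)%N) (yX A) => u v u0 v0.
  by field; rewrite ?u0 ?v0 ?yX ?gt_eqF.
rewrite ler_pdivrMr ?exprn_gt0 // mulrC.
apply: (@le_trans _ _ (y ^+ (2 * K + 3))); first by rewrite lerXn2r ?nnegrE // ltW.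
rewrite ler_pdivlMr // -exprSr ler_weXn2l //.
by rewrite /A; lia.
Qed.

(* With n = y^E, the threshold n^(-(K+1)/(K+2)) of the cycle of length K+3 is y^(-A(K+1)). *)
Lemma arrow_failure_small : exists C Lam Y0 : R, forall (n : nat) (y lam p : R),
  Y0 <= y -> Lam <= lam -> lam <= y -> n%:R = y ^+ E -> p = lam / y ^+ (A * K.+1) ->
  0 <= p <= 1 ->
  1 - gnp_prob p (fun G : graph 'I_n => rb_arrow G (cycle_graph K.+3)) <= C / y.
Proof.
have [q qE] : {q : nat | q = (256 * K.+1)%N} by exists (256 * K.+1)%N.
(* The ratio N/m. With this value the exponent q times 4 (K+3) N m p of the union bound over
   groupings is at most N^2 p / 32, half of the exponent N^2 p / 16 gained from the closing
   edges. *)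
have [C0 C0E] : {C0 : nat | C0 = (128 * q * K.+3)%N} by exists (128 * q * K.+3)%N.
have q4 : (4 <= q)%N by rewrite qE mulnS; lia.
have KC0 : (K.+1 <= C0)%N.
  by rewrite C0E; apply: (@leq_trans K.+3); [lia | rewrite leq_pmull // muln_gt0 (leq_trans _ q4)].
have C064 : (64 < C0)%N.
  rewrite C0E -mulnA; apply: (@leq_trans 128) => //; rewrite leq_pmulr // muln_gt0.
  by rewrite (leq_trans _ q4).
have q256 : K.+1%:R / q%:R = 256^-1 :> R.
  have k0 : K.+1%:R != 0 :> R by rewrite pnatr_eq0.
  have -> : q%:R = 256%:R * K.+1%:R :> R by rewrite qE natrM.
  by rewrite invfM mulrCA divff // mulr1.
have q0 : 0 < q%:R :> R by rewrite ltr0n (leq_trans _ q4).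
have q4R : 4 <= q%:R :> R by rewrite ler_nat.
have C00 : 0 < C0%:R :> R by rewrite ltr0n (leq_trans _ C064).
(* m >= c n, so [c3 * mu] is below the group degree m p / (16 q); [c2] is half of [c3] and allows
   for rounding that degree down to [d]. *)
pose c : R := (6 * C0%:R)^-1; pose c2 : R := c / (32 * q%:R); pose c3 : R := c / (16 * q%:R).
have c0 : 0 < c by rewrite invr_gt0 mulr_gt0.
have c20 : 0 < c2 by rewrite divr_gt0 // mulr_gt0.
have c30 : 0 < c3 by rewrite divr_gt0 // mulr_gt0.
pose C4 : R := (2 * E).+1`!%:R / c3 ^+ (2 * E).+1.
have C40 : 0 <= C4 by rewrite divr_ge0 // exprn_ge0 // ltW.
exists (2 ^+ K.+2 + (K + 6)%:R * C4), (1 + 130 / c2 ^+ K.+1),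
  (1 + 12 * C0%:R + c2^-1 + (K + 3)%:R * C4) => n y lam p Yy Ll ly nE pE p01.
have c2k : 0 < c2 ^+ K.+1 by rewrite exprn_gt0.
have c2i : 0 < c2^-1 by rewrite invr_gt0.
have KC4 : 0 <= (K + 3)%:R * C4 by rewrite mulr_ge0.
have L0 : 0 < 130 / c2 ^+ K.+1 by rewrite divr_gt0.
have y1 : 1 <= y by lra.
have y0 : 0 < y by lra.
have yC : (K + 3)%:R * C4 < y by lra.
have lam1 : 1 <= lam by lra.
have lam0 : 0 < lam by lra.
have yX a : 0 < y ^+ a by rewrite exprn_gt0.
have yge a : (0 < a)%N -> y <= y ^+ a by move=> a0; rewrite ler_eXnr.
have pp : 0 < p by rewrite pE divr_gt0.
have [p0 p1] := andP p01.
have A0 : (0 < A)%N by rewrite /A addn_gt0 orbT.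
have n12 : (12 * C0 <= n)%N.
  rewrite -(ler_nat R) natrM nE; apply: le_trans (yge E _); first by lra.
  by rewrite muln_gt0 A0.
have [fit m0 mN N64 [nm C0m Nn]] := split_sizes KC0 C064 n12.
set N := (n %/ 3)%N in fit m0 mN N64 nm C0m Nn.
set m := (N %/ C0)%N in fit m0 mN nm C0m.
pose mu := n%:R * p.
have muE : mu = lam * y ^+ A.
  rewrite /mu nE pE (_ : E = A * K.+1 + A)%N; last by rewrite /E [in LHS]mulnS addnC.
  by rewrite exprD; field; rewrite gt_eqF.
have muy : y <= mu.
  by rewrite muE; apply: le_trans (yge A A0) _; rewrite ler_peMl // ltW.
have mu0 : 0 < mu by apply: lt_le_trans muy.
pose D := m%:R * p.
have cD : c * mu <= D.
  rewrite /mu /D mulrA ler_wpM2r // /c mulrC ler_pdivrMr ?mulr_gt0 // mulrC.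
  by rewrite -(natrM R 6) -natrM ler_nat.
have DE : m%:R * p / 4 / q%:R / 4 = D / (16 * q%:R) by rewrite /D; field; rewrite gt_eqF.
have D16 : c3 * mu <= D / (16 * q%:R).
  by rewrite /c3 mulrAC ler_pM2r // invr_gt0 mulr_gt0.
have D32 : c2 * mu <= D / (32 * q%:R).
  by rewrite /c2 mulrAC ler_pM2r // invr_gt0 mulr_gt0.
have c2mu : 1 <= c2 * mu.
  have h : c2^-1 <= mu by apply: le_trans muy; move: Yy KC4 C00; clear -R K A E; lra.
  by rewrite -ler_pdivrMl // mulr1.
have DD : D / (16 * q%:R) = 2 * (D / (32 * q%:R)) by field; rewrite gt_eqF.
pose d := Num.truncn (D / (16 * q%:R)).
have D0 : 0 <= D by rewrite mulr_ge0.
have d_le : d%:R <= D / (16 * q%:R) by rewrite truncn_le divr_ge0 // mulr_ge0 // ltW.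
have d_ge : c2 * mu <= d%:R.
  have t0 : 0 <= D / (16 * q%:R) by rewrite divr_ge0 // mulr_ge0 // ltW.
  have /andP[_] := truncn_itv t0.
  by rewrite -/d -(natr1 d); move: DD D32 c2mu; clear -R K A E; lra.
(* Of order 1/p: large enough for p s b / 4 to beat the 2^(m+N) pairs of sets W and B. *)
pose s := (Num.truncn (64 / p)).+1.
have p64 : 0 <= 64 / p by rewrite divr_ge0.
have /andP[s1 s2] := truncn_itv p64; rewrite -/s in s2.
have ps : 64 <= s%:R * p by rewrite -ler_pdivrMr // ltW.
have s3 : s%:R <= 65 / p.
  rewrite /s -(natr1 (Num.truncn _)); apply: (@le_trans _ _ (64 / p + 1 / p)); last by rewrite -mulrDl; lra.
  by apply: lerD => //; rewrite ler_pdivlMr // mul1r.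
(* Here lam has to be large: mu^(K+1) p = lam^(K+2), so the paths from u reach 2s ends as soon as
   130 <= c2^(K+1) lam^(K+2). *)
have sd : (2 * s <= d ^ K.+1)%N.
  rewrite -(ler_nat R) natrM natrX; apply: (@le_trans _ _ ((c2 * mu) ^+ K.+1)); last first.
    by rewrite lerXn2r ?nnegrE ?ler0n // mulr_ge0 ?ltW.
  apply: (@le_trans _ _ (130 / p)); first by move: s3; clear -R K A E; lra.
  rewrite ler_pdivrMr // (exprMn _ c2) muE (exprMn _ lam) -exprM.
  have -> : c2 ^+ K.+1 * (lam ^+ K.+1 * y ^+ (A * K.+1)) * p = c2 ^+ K.+1 * lam ^+ K.+2.
    by rewrite pE [lam ^+ K.+2]exprSr; field; rewrite gt_eqF.
  have h : 130 / c2 ^+ K.+1 <= lam ^+ K.+2.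
    by apply: (@le_trans _ _ lam); [move: Ll; clear -R K A E; lra | rewrite ler_eXnr].
  by move: h; rewrite ler_pdivrMr // mulrC.
(* All exponential terms below are at most [e], with coefficients O(n^2); this suffices because mu
   >= y and n is a fixed power of y. *)
pose e := expR (- (c3 * mu)); have e0 : 0 < e by apply: expR_gt0.
have n1 : 1 <= n%:R :> R by rewrite ler1n (leq_trans _ Nn) // (leq_trans _ N64).
have X : n%:R ^+ 2 * e <= C4 / y.
  apply: (@le_trans _ _ (n%:R ^+ 2 * expR (- (c3 * y)))).
    by rewrite ler_wpM2l ?exprn_ge0 // ler_expR lerN2 ler_pM2l.
  have := expRN_le_pow (2 * E) (mulr_gt0 c30 y0) => h.
  apply: le_trans (ler_wpM2l (exprn_ge0 2 (ler0n R n)) h) _.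
  rewrite nE exprMn -exprM (mulnC E) [y ^+ (2 * E).+1]exprSr /C4.
  rewrite le_eqVlt; apply/orP; left; apply/eqP; field.
  by rewrite !gt_eqF // exprn_gt0.
have small x : c3 * mu <= x -> expR (- x) <= e by move=> h; rewrite ler_expR lerN2.
have Dx x : D / (16 * q%:R) <= x -> expR (- x) <= e.
  by move=> h; apply: small; apply: le_trans h.
have NpD : D <= N%:R * p by rewrite ler_wpM2r // ler_nat.
have qq : D / (16 * q%:R) <= D / 64.
  by rewrite ler_wpM2l // lef_pV2 ?posrE ?mulr_gt0 //; move: q4R; clear -R K A E; lra.
have e1 : expR (- (m%:R * p / 4 / q%:R / 4)) <= e by apply: Dx; rewrite DE.
have e2 : expR (- (m%:R * p / 4)) <= e by apply: Dx; move: qq D0; rewrite -/D; clear -R K A E; lra.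
have e3 : expR (- (N%:R * p)) <= e by apply: Dx; move: qq D0 NpD; clear -R K A E; lra.
have Nn2 (a b : nat) : (a <= n)%N -> (b <= n)%N -> (a * b)%:R <= n%:R ^+ 2 :> R.
  by move=> an bn; rewrite -natrX ler_nat expnS expn1 leq_mul.
have mn : (m <= n)%N by apply: leq_trans mN Nn.
have nn2 : n%:R <= n%:R ^+ 2 :> R by rewrite ler_eXnr.
have co1 : (K.+1 * N * m)%:R <= K.+1%:R * n%:R ^+ 2 :> R.
  by rewrite -mulnA natrM ler_wpM2l // Nn2.
have co2 : (m + N)%:R <= 2 * n%:R ^+ 2 :> R.
  rewrite natrD; have : m%:R <= n%:R :> R by rewrite ler_nat.
  have : N%:R <= n%:R :> R by rewrite ler_nat.
  by move: nn2; clear -R K A E; lra.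
have bnd a b z : 0 <= b -> a <= b * n%:R ^+ 2 -> z <= e -> 0 <= z -> a * z <= b * (C4 / y).
  move=> b0 ab ze z0; apply: (@le_trans _ _ (b * n%:R ^+ 2 * e)).
    apply: (@le_trans _ _ (b * n%:R ^+ 2 * z)); first exact: ler_wpM2r.
    by rewrite ler_wpM2l // mulr_ge0 // exprn_ge0.
  by rewrite -mulrA ler_wpM2l.
have one_n2 : 1 <= 1 * n%:R ^+ 2 :> R by rewrite mul1r; move: nn2 n1; clear -R K A E; lra.
have N2 : (1 < N)%N by apply: leq_trans N64.
have group : (K.+1 * N * m)%:R * expR (- (m%:R * p / 4 / q%:R / 4)) +
    (m + N)%:R * expR (- (K.+1%:R / q%:R * (4 * (N%:R * p)))) < 1.
  have e4 : expR (- (K.+1%:R / q%:R * (4 * (N%:R * p)))) <= e.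
    apply: Dx; apply: le_trans qq _.
    by rewrite q256; move: NpD D0; clear -R K A E; lra.
  have b1 := bnd _ _ _ (ler0n R K.+1) co1 e1 (expR_ge0 _).
  have b2 := bnd _ _ _ (ler0n R 2) co2 e4 (expR_ge0 _).
  apply: le_lt_trans (lerD b1 b2) _; rewrite -mulrDl -natrD addn2 -[K.+3]addn3.
  by rewrite mulrA ltr_pdivrMr // mul1r.
have mp1 : 1 <= m%:R * p.
  rewrite -/D; have h : 1 <= D / (32 * q%:R) by apply: le_trans D32.
  by move: h; rewrite ler_pdivlMr ?mulr_gt0 //; move: q4R; clear -R K A E; lra.
have dd : d%:R <= m%:R * p / 4 / q%:R / 4 by rewrite DE.
rewrite qE in group dd.
apply: le_trans (arrow_failure_le p01 fit m0 mN N2 (ltn0Sn _) mp1 dd sd ps group) _.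
rewrite -qE.
have -> : (2 ^+ K.+2 + (K + 6)%:R * C4) / y = 2 ^+ K.+2 / y + K.+1%:R * (C4 / y) +
    2 * (C4 / y) + 1 * (C4 / y) + 1 * (C4 / y) + 1 * (C4 / y).
  by rewrite natrD -natr1; ring.
have Npe x : N%:R * p <= x -> expR (- x) <= e.
  by move=> h; apply: Dx; apply: le_trans h; move: qq D0 NpD; clear -R K A E; lra.
have NR : 64 <= N%:R :> R by rewrite ler_nat ltnW.
apply: lerD; [apply: lerD; [apply: lerD; [apply: lerD; [apply: lerD|]|]|]|].
- rewrite -mulrA ler_wpM2l ?exprn_ge0 //.
  apply: (@le_trans _ _ (mu ^+ (2 * K).+1 * p ^+ 2)).
    rewrite ler_wpM2r ?exprn_ge0 // lerXn2r ?nnegrE ?mulr_ge0 // ler_wpM2r // ler_nat //.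
  by rewrite muE pE; apply: two_star_term => //; rewrite ltW.
- exact: bnd co1 e2 (expR_ge0 _).
- exact: bnd co2 e3 (expR_ge0 _).
- apply: (@le_trans _ _ (1 * expR (- (2 * N%:R)))).
    rewrite mul1r; apply: (@le_trans _ _ (expR (2 * N%:R) * expR (- (p * (s * N./2)%:R / 4)))).
      rewrite ler_wpM2r ?expR_ge0 //; apply: le_trans (leR_pow2 _ _) _.
      rewrite ler_expR natrD; have : m%:R <= N%:R :> R by rewrite ler_nat.
      by clear -R K A E; lra.
    rewrite -expRD ler_expR natrM.
    have [_ b4] := half_bounds N2.
    have b4R : N%:R <= 4 * (N./2)%:R :> R by rewrite -natrM ler_nat.
    have : 64 * (N./2)%:R <= s%:R * p * (N./2)%:R :> R by rewrite ler_wpM2r.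
    by move: b4R; clear -R K A E; lra.
  apply: bnd => //.
  apply: Npe; apply: (@le_trans _ _ N%:R); first by rewrite ler_piMr.
  by move: NR; clear -R K A E; lra.
- rewrite -[leLHS]mul1r; apply: bnd => //.
  apply: Dx; apply: (@le_trans _ _ D); first by move: qq D0; clear -R K A E; lra.
  rewrite ler_wpM2r // ler_nat leq_pmull // muln_gt0 /=.
  exact: ltnW.
- rewrite -[leLHS]mul1r; apply: bnd => //.
  rewrite -[X in expR X]opprK; apply: Npe.
  have C0mR : C0%:R * m%:R <= N%:R :> R by rewrite -natrM ler_nat.
  have eC : q%:R * (4 * ((K.+3 * N * m)%:R * p)) = C0%:R * m%:R * (N%:R * p) / 32.
    by rewrite C0E !natrM; field.
  have Np0 : 0 <= N%:R * p by rewrite mulr_ge0.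
  have : C0%:R * m%:R * (N%:R * p) <= N%:R * (N%:R * p) by rewrite ler_wpM2r.
  have : 64 * (N%:R * p) <= N%:R * (N%:R * p) by rewrite ler_wpM2r.
  rewrite eC natrM (_ : p * (N%:R * N%:R) = N%:R * (N%:R * p)); last by ring.
  by move: (N%:R * (N%:R * p)) (C0%:R * m%:R * (N%:R * p)) => u v; move: Np0; clear -R K A E; lra.
Qed.

End OneAsymptotics.

Lemma gnp_prob_cvg1 (R : realType) (P : forall n, graph 'I_n -> Prop) (p : nat -> R) :
  (forall n, 0 <= p n <= 1) ->
  (forall eps : R, 0 < eps ->
    \forall n \near \oo%classic, 1 - gnp_prob (p n) (P n) <= eps) ->
  (gnp_prob (p n) (P n) @[n --> \oo] --> (1 : R))%classic.
Proof.
move=> p01 h; apply/cvgrPdist_le => eps eps0; near=> n.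
have /andP[_ le1] := gnp_prob_bounds (P n) (p01 n).
rewrite ger0_norm ?subr_ge0 //; near: n; exact: h.
Unshelve. all: by end_near.
Qed.

Lemma near_powR_ge (R : realType) (B a : R) : 0 < a ->
  \forall n \near \oo%classic, B <= n%:R `^ a.
Proof.
move=> a0; near=> n; pose b := Num.max B 1.
have b0 : 0 <= b by rewrite le_max ler01 orbT.
apply: (@le_trans _ _ b); first by rewrite le_max lexx.
have -> : b = (b `^ a^-1) `^ a by rewrite -powRrM mulVf ?gt_eqF // powRr1.
apply: ge0_ler_powR; rewrite ?nnegrE ?powR_ge0 ?(ltW a0) //.
apply/ltW/(lt_le_trans (truncnS_gt _)); rewrite ler_nat.
by near: n; exact: nbhs_infty_ge.
Unshelve. all: by end_near.
Qed.

Lemma arrow_prob_cvg1 (R : realType) (l : nat) (p : nat -> R) : (2 < l)%N ->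
  (forall n, 0 <= p n <= 1) ->
  (p n / (n%:R `^ (- ((l%:R - 2) / (l%:R - 1)))) @[n --> \oo] --> +oo)%classic ->
  (gnp_prob (p n) (fun G : graph 'I_n => rb_arrow G (cycle_graph l))
     @[n --> \oo] --> (1 : R))%classic.
Proof.
case: l => [|[|[|K]]] // _ p01 pinf; apply: gnp_prob_cvg1 => // eps eps0.
have [C [Lam [Y0 small]]] := @arrow_failure_small R K.
set A := (4 * K + 6)%N in small; set E := (A * K.+2)%N in small.
have E0 : 0 < E%:R :> R by rewrite ltr0n muln_gt0 /A addn_gt0 orbT.
pose y n : R := n%:R `^ E%:R^-1.
have [K1 K2] : K.+3%:R - 2 = K.+1%:R :> R /\ K.+3%:R - 1 = K.+2%:R :> R.
  by rewrite -!natr1; split; ring.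
rewrite K1 K2 in pinf.
set ratio := (X in (X @ _ --> _)%classic) in pinf.
have Einv : 0 < E%:R^-1 :> R by rewrite invr_gt0.
near=> n.
have n0 : (0 < n)%N by near: n; exact: nbhs_infty_gt.
have nR : 0 < n%:R :> R by rewrite ltr0n.
have y0 : 0 < y n by apply: powR_gt0.
have yE : n%:R = y n ^+ E :> R.
  by rewrite -powR_mulrn ?powR_ge0 // -powRrM mulVf ?gt_eqF // powRr1 ?ltW.
have yA : n%:R `^ (- (K.+1%:R / K.+2%:R)) = (y n ^+ (A * K.+1))^-1 :> R.
  rewrite powRN; congr (_^-1); rewrite -powR_mulrn ?powR_ge0 // -powRrM.
  congr (_ `^ _); rewrite /E !natrM; field.
  by apply/andP; split; rewrite -?natrD pnatr_eq0 -lt0n ?/A addn_gt0 ?orbT.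
have Yy : Y0 <= y n by near: n; apply: near_powR_ge.
have Ly : Lam <= y n by near: n; apply: near_powR_ge.
have Cy : C / eps <= y n by near: n; apply: near_powR_ge.
have Lr : Lam <= ratio n by near: n; move/cvgryPge: pinf; apply.
have ph0 : 0 < (y n ^+ (A * K.+1))^-1 by rewrite invr_gt0 exprn_gt0.
have rE : ratio n = p n / (y n ^+ (A * K.+1))^-1 by rewrite /ratio yA.
have /andP[pn0 pn1] := p01 n.
(* The quantitative bound assumes lam <= y; for larger p it is applied to a smaller probability, and
   monotonicity of the arrow does the rest. *)
pose lam := Num.min (ratio n) (y n).
have p'p : lam / y n ^+ (A * K.+1) <= p n.
  by rewrite -ler_pdivlMr // -rE ge_min lexx.
have p'0 : 0 <= lam / y n ^+ (A * K.+1).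
  by rewrite mulr_ge0 ?(ltW ph0) // le_min (ltW y0) rE divr_ge0 // ltW.
apply: (@le_trans _ _ (C / y n)); last by rewrite ler_pdivrMr // mulrC -ler_pdivrMr.
apply: le_trans (small n (y n) lam _ Yy _ _ yE erefl _).
- by rewrite lerD2l lerN2; apply: gnp_rb_mono.
- by rewrite le_min Lr Ly.
- by rewrite ge_min lexx orbT.
- by rewrite p'0 (le_trans p'p).
Unshelve. all: by end_near.
Qed.

(** * The 1-statement for the 4-cycle *)

Section FourCycle.
Variables (T : finType) (K : Type) (G : graph T) (c : {set T} -> K).
Hypotheses (vG : verts G = setT) (cp : proper_colouring G c).

Lemma rainbow_four_cycle (u v w z : T) : uniq [:: u; v; w; z] ->
  [set u; v] \in edges G -> [set v; w] \in edges G -> [set w; z] \in edges G ->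
  [set z; u] \in edges G ->
  c [set u; v] <> c [set w; z] -> c [set v; w] <> c [set z; u] ->
  exists J : graph T, [/\ subgraph J G, isomorphic J (cycle_graph 4) & rainbow J c].
Proof.
move=> un uv vw wz zu c02 c13.
pose y : {ffun 'I_4 -> T} := [ffun i : 'I_4 => nth u [:: u; v; w; z] i].
pose E := nth set0 [:: [set u; v]; [set v; w]; [set w; z]; [set z; u]].
have yE (i : 'I_4) : [set y i; y (ordS i)] = E i.
  by rewrite !ffunE; case: i => [[|[|[|[|]]]]].
have iy : injective y.
  move=> i j; rewrite !ffunE => /eqP; rewrite nth_uniq //=.
  by move/eqP/val_inj.
have EG (i : 'I_4) : E i \in edges G by case: i => [[|[|[|[|]]]]].
have adj (i : 'I_4) : c (E i) <> c (E (ordS i)).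
  apply: (cp (EG i) (EG (ordS i))).
    by rewrite -!yE (inj_eq (cyc_edge_inj _ iy)) // eq_sym ordS_neq.
  by rewrite -!yE; apply/set0Pn; exists (y (ordS i)); rewrite !inE eqxx ?orbT.
have [c01 c12 c23 c30] : [/\ c (E 0%N) <> c (E 1%N), c (E 1%N) <> c (E 2%N),
    c (E 2%N) <> c (E 3%N) & c (E 3%N) <> c (E 0%N)].
  by split; [apply: (adj (@Ordinal 4 0 _))|apply: (adj (@Ordinal 4 1 _))|
    apply: (adj (@Ordinal 4 2 _))|apply: (adj (@Ordinal 4 3 _))].
apply: (@rainbow_cycle_copy _ 4 _ _ _ _ y) => //.
  by apply/subsetP => e /imsetP[i _ ->]; rewrite yE.
move=> e f /imsetP[i _ ->] /imsetP[j _ ->]; rewrite !yE => ce; congr (E _).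
case: i j ce => [[|[|[|[|]]]] //= _] [[|[|[|[|]]]] //= _] // /esym ce;
  by [case: c30|case: c01|case: c02|case: c12|case: c13|case: c23].
Qed.

(* A non-rainbow cycle a x_0 b x_j forces c(a x_0) = c(b x_j) or
   c(a x_j) = c(b x_0); by properness each of the two happens for at most one j. *)
Lemma rainbow_C4_of_K24 (a b : T) (x : 'I_4 -> T) : injective x -> a != b ->
  (forall i, x i != a /\ x i != b) ->
  (forall i, [set a; x i] \in edges G /\ [set b; x i] \in edges G) ->
  exists J : graph T, [/\ subgraph J G, isomorphic J (cycle_graph 4) & rainbow J c].
Proof.
move=> ix ab xab xG; apply: contrapT => noJ.
have dicho (j : 'I_4) : j != ord0 ->
    c [set a; x ord0] = c [set b; x j] \/ c [set a; x j] = c [set b; x ord0].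
  move=> j0; apply: contrapT => /not_orP[h1 h2]; apply: noJ.
  have [[a0 b0] [aj bj]] := (xG ord0, xG j).
  apply: (@rainbow_four_cycle a (x ord0) b (x j)) => //; rewrite 1?(setUC [set x _]) //.
    rewrite /= !inE !negb_or ab (xab _).2 (eq_sym a) (xab _).1 (eq_sym a) (xab _).1.
    by rewrite (eq_sym b) (xab _).2 (inj_eq ix) eq_sym j0.
  by rewrite (setUC [set x j]) => /esym.
have inj_at (d : T) (i j : 'I_4) : (forall i, [set d; x i] \in edges G) ->
    (forall i, x i != d) -> c [set d; x i] = c [set d; x j] -> i = j.
  move=> dG xd cij; apply/eqP; apply: contraPT cij => ij; apply: (cp (dG i) (dG j)).
    apply/eqP => /setP/(_ (x i)); rewrite !inE eqxx orbT (negbTE (xd i)) /=.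
    by rewrite (inj_eq ix) (negbTE ij).
  by apply/set0Pn; exists d; rewrite !inE eqxx.
have aG i := (xG i).1; have bG i := (xG i).2.
have xa i := (xab i).1; have xb i := (xab i).2.
have [[d1 d2] d3] := (dicho (@Ordinal 4 1 isT) isT, dicho (@Ordinal 4 2 isT) isT,
  dicho (@Ordinal 4 3 isT) isT).
have A i j : c [set a; x ord0] = c [set b; x i] -> c [set a; x ord0] = c [set b; x j] -> i = j.
  by move=> -> ; apply: inj_at.
have B i j : c [set a; x i] = c [set b; x ord0] -> c [set a; x j] = c [set b; x ord0] -> i = j.
  by move=> <- /esym; apply: inj_at.
by case: d1 d2 d3 => h1 [] h2 [] h3; first [have := A _ _ h1 h2 | have := A _ _ h2 h3 | have := A _ _ h1 h3
  | have := B _ _ h1 h2 | have := B _ _ h2 h3 | have := B _ _ h1 h3]; move/(congr1 val).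
Qed.

End FourCycle.

(** * The second moment method for complete bipartite graphs *)

Section Agreement.
Variables (R : realType) (X : finType) (m : nat).
Implicit Types (s : {ffun X -> 'I_m}) (A : {set X}).

Definition agree s s' : {set X} := [set x | s x == s' x].

Lemma sum_agree A s :
  (\sum_(s' : {ffun X -> 'I_m}) (A \subset agree s s')%:R) * m%:R ^+ #|A| =
  m%:R ^+ #|X| :> R.
Proof.
pose F x (a : 'I_m) : R := ((x \in A) ==> (s x == a))%:R.
have -> : \sum_(s' : {ffun X -> 'I_m}) (A \subset agree s s')%:R = \prod_x \sum_a F x a.
  rewrite bigA_distr_bigA; apply: eq_bigr => s' _; rewrite /F.
  case: (boolP (_ \subset _)) => [/subsetP h|/subsetPn[x xA xs]].
    by rewrite big1 // => x _; case: (boolP (x \in A)) => //= /h; rewrite inE => ->.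
  by rewrite (bigD1 x) //= xA /=; rewrite inE in xs; rewrite (negbTE xs) mul0r.
rewrite -[in LHS]prodr_const [X in _ * X]big_mkcond -big_split /= -prodr_const.
apply: eq_bigr => x _; rewrite /F; case: (x \in A) => /=.
  by rewrite (bigD1 (s x)) //= eqxx big1 ?addr0 ?mul1r // => a; rewrite eq_sym => /negbTE ->.
by rewrite sumr_const card_ord mulr1.
Qed.

End Agreement.

Section SecondMoment.
Variables (R : realType) (I J T : finType) (m : nat) (p : R).
Variable vtx : (I * 'I_m) + (J * 'I_m) -> T.
Hypotheses (vtx_inj : injective vtx) (p0 : 0 < p) (p1 : p <= 1) (m0 : (0 < m)%N).
(** One vertex from each of |I| + |J| disjoint parts, so that placements need no injectivity
    condition and sums over them factor. *)
Let placement := ({ffun I -> 'I_m} * {ffun J -> 'I_m})%type.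
Implicit Types (f g : placement).

Definition bip_edge (v : I * 'I_m) (w : J * 'I_m) : {set T} :=
  [set vtx (inl v); vtx (inr w)].

Lemma bip_edge_inj v w v' w' : bip_edge v w = bip_edge v' w' -> v = v' /\ w = w'.
Proof.
move=> /setP h; have := h (vtx (inr w)); have := h (vtx (inl v)).
rewrite !inE !eqxx orbT => /esym/orP[]/eqP/vtx_inj // [->].
by move=> /esym/orP[]/eqP/vtx_inj // [->].
Qed.

Definition bip_copy f : {set {set T}} :=
  [set bip_edge (ij.1, f.1 ij.1) (ij.2, f.2 ij.2) | ij : I * J].

Lemma card_bip_copy f : #|bip_copy f| = (#|I| * #|J|)%N.
Proof. by rewrite card_imset ?card_prod // => -[i j] [i' j'] /bip_edge_inj[[-> _] [-> _]]. Qed.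

Lemma card_bip_copyU f g : ((#|I| * #|J|) + (#|I| * #|J|) <=
  #|bip_copy f :|: bip_copy g| + #|agree f.1 g.1| * #|agree f.2 g.2|)%N.
Proof.
rewrite -{1}(card_bip_copy f) -(card_bip_copy g) -cardsUI leq_add2l -cardsX.
apply: leq_trans (leq_imset_card
  (fun ij : I * J => bip_edge (ij.1, f.1 ij.1) (ij.2, f.2 ij.2)) _).
apply/subset_leq_card/subsetP => e /setIP[/imsetP[ij _ ->] /imsetP[ij' _]].
move=> /bip_edge_inj[[e1 e1'] [e2 e2']].
by apply/imsetP; exists ij => //; rewrite !inE e1' e2' e1 e2 !eqxx.
Qed.

Let p01 : 0 <= p <= 1. Proof. by rewrite ltW. Qed.
Let bl : law (bernoulli_pmf p). Proof. exact: bernoulli_law. Qed.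
Let count (o : {ffun {set T} -> bool}) : R := \sum_f (present (bip_copy f) o)%:R.
Let mu : R := m%:R ^+ (#|I| + #|J|) * p ^+ (#|I| * #|J|).
Let ratio (AB : {set I} * {set J}) : R :=
  (m%:R ^+ (#|AB.1| + #|AB.2|) * p ^+ (#|AB.1| * #|AB.2|))^-1.

Lemma Ex_bip_count : Ex (bernoulli_pmf p) count = mu.
Proof.
rewrite Ex_sum (eq_bigr (fun=> p ^+ (#|I| * #|J|))); last first.
  by move=> f _; rewrite Ex_present // card_bip_copy.
rewrite sumr_const card_prod !card_ffun card_ord -expnD -[LHS]mulr_natl.
by rewrite natrX.
Qed.

(** Two copies share at most ab edges, where a and b are the sizes of their agreement sets. Summing
    over all pairs [AB] contained in these sets, and not only over the sets themselves, enlarges the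
    sum but makes it computable by [sum_agree]. *)
Lemma Ex_bip_count_sqr : Ex (bernoulli_pmf p) (fun o => count o ^+ 2) <=
  mu ^+ 2 * \sum_AB ratio AB.
Proof.
have pX k : 0 < p ^+ k by apply: exprn_gt0.
have mX k : 0 < m%:R ^+ k :> R by rewrite exprn_gt0 // ltr0n.
have -> : Ex (bernoulli_pmf p) (fun o => count o ^+ 2) =
    \sum_f \sum_g p ^+ #|bip_copy f :|: bip_copy g|.
  transitivity (Ex (bernoulli_pmf p) (fun o => \sum_f \sum_g
      (present (bip_copy f :|: bip_copy g) o)%:R)).
    apply: eq_Ex => o; rewrite expr2 big_distrl; apply: eq_bigr => f _.
    by rewrite big_distrr; apply: eq_bigr => g _; rewrite presentU /= -natrM mulnb.
  rewrite Ex_sum; apply: eq_bigr => f _; rewrite Ex_sum; apply: eq_bigr => g _.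
  exact: Ex_present.
pose q := p ^+ (#|I| * #|J|) ^+ 2.
have q0 : 0 < q by rewrite exprn_gt0.
pose w f g (AB : {set I} * {set J}) : R :=
  (AB.1 \subset agree f.1 g.1)%:R * (AB.2 \subset agree f.2 g.2)%:R.
apply: (@le_trans _ _ (\sum_f \sum_g \sum_AB w f g AB * (q / p ^+ (#|AB.1| * #|AB.2|)))).
  apply: ler_sum => f _; apply: ler_sum => g _.
  rewrite (bigD1 (agree f.1 g.1, agree f.2 g.2)) //= {1}/w !subxx !mul1r.
  apply: (@le_trans _ _ (q / p ^+ (#|agree f.1 g.1| * #|agree f.2 g.2|))).
    rewrite ler_pdivlMr // -exprD /q expr2 -exprD ler_wiXn2l ?p1 ?(ltW p0) //.
    exact: card_bip_copyU.
  rewrite lerDl sumr_ge0 // => AB _.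
  by rewrite !mulr_ge0 ?invr_ge0 ?(ltW q0) ?(ltW (pX _)).
rewrite (eq_bigr (fun f => \sum_AB \sum_g w f g AB * (q / p ^+ (#|AB.1| * #|AB.2|)))); last first.
  by move=> f _; apply: exchange_big.
rewrite exchange_big big_distrr /=; apply: ler_sum => AB _.
rewrite (eq_bigr (fun=> m%:R ^+ (#|I| + #|J|) / m%:R ^+ (#|AB.1| + #|AB.2|) *
    (q / p ^+ (#|AB.1| * #|AB.2|)))); last first.
  move=> f _; rewrite -big_distrl /=; congr (_ * _).
  rewrite /w -(pair_bigA _ (fun (s : {ffun I -> 'I_m}) (t : {ffun J -> 'I_m}) =>
    (AB.1 \subset agree f.1 s)%:R * (AB.2 \subset agree f.2 t)%:R)) /= -big_distrlr /=.
  rewrite !exprD -(sum_agree R AB.1 f.1) -(sum_agree R AB.2 f.2) mulrACA.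
  by rewrite mulfK // mulf_neq0 // gt_eqF.
rewrite sumr_const card_prod !card_ffun card_ord -expnD -[leLHS]mulr_natl natrX.
rewrite /mu /ratio /q le_eqVlt; apply/orP; left; apply/eqP.
by rewrite exprMn invfM expr2; ring.
Qed.

(** Chebyshev's inequality: if no copy is present, the squared deviation is mu^2. The pair of empty
    sets contributes exactly mu^2 to the bound on the second moment, which cancels. *)
Lemma bip_copy_failure :
  Ex (bernoulli_pmf p) (fun o => (~~ [exists f, present (bip_copy f) o])%:R) <=
  \sum_(AB | AB != (set0, set0)) ratio AB.
Proof.
have mu0 : 0 < mu by rewrite mulr_gt0 ?exprn_gt0 // ltr0n.
have mu2 : 0 < mu ^+ 2 by rewrite exprn_gt0.
rewrite -(ler_pM2l mu2) -ExZ.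
apply: (@le_trans _ _ (Ex (bernoulli_pmf p) (fun o => count o ^+ 2 +
    (- 2 * mu) * count o + mu ^+ 2))).
  apply: (Ex_le bl) => o.
  have -> : count o ^+ 2 + - 2 * mu * count o + mu ^+ 2 = (count o - mu) ^+ 2 by ring.
  case: (boolP [exists f, _]) => [_|/existsPn none]; first by rewrite mulr0 sqr_ge0.
  rewrite mulr1 /count big1 ?sub0r ?sqrrN // => f _.
  by rewrite (negbTE (none f)).
rewrite !ExD ExZ Ex_cst // Ex_bip_count.
have := Ex_bip_count_sqr; rewrite (bigD1 (set0, set0)) //= /ratio /= !cards0 !mul1r.
by rewrite expr0 invr1 mulrDr mulr1 => h; move: (\sum_(_ | _) _) h => S h; nra.
Qed.

End SecondMoment.

Lemma C4_failure_le (R : realType) (n m : nat) (p : R) :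
  0 < p -> p <= 1 -> (0 < m)%N -> (6 * m <= n)%N ->
  1 - gnp_prob p (fun G : graph 'I_n => rb_arrow G (cycle_graph 4)) <=
  \sum_(AB : {set 'I_2} * {set 'I_4} | AB != (set0, set0))
    (m%:R ^+ (#|AB.1| + #|AB.2|) * p ^+ (#|AB.1| * #|AB.2|))^-1.
Proof.
move=> p0 p1 m0 mn; have p01 : 0 <= p <= 1 by rewrite ltW.
have bl := bernoulli_law p01.
have [vtx vtx_inj] : exists vtx : ('I_2 * 'I_m) + ('I_4 * 'I_m) -> 'I_n, injective vtx.
  by apply: exists_injection; rewrite card_sum !card_prod !card_ord -mulnDl.
apply: le_trans (bip_copy_failure vtx_inj p0 p1 m0).
rewrite gnp_probE // lerBlDl -ExD -[leLHS](Ex_cst {set 'I_n} bl 1); apply: (Ex_le bl) => o.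
case: (boolP [exists f, _]) => [/existsP[f pf]|_]; last by rewrite lerDr.
case: asboolP => [_|[]]; first by rewrite addr0.
move=> K c cp.
have vG : verts (graph_of o) = setT by [].
apply: (rainbow_C4_of_K24 vG cp (a := vtx (inl (ord0, f.1 ord0)))
  (b := vtx (inl (ord_max, f.1 ord_max))) (x := fun j => vtx (inr (j, f.2 j)))) => //.
- by move=> j j' /vtx_inj[].
- by rewrite (inj_eq vtx_inj).
- by move=> j; rewrite !(inj_eq vtx_inj).
- have edge i j : bip_edge vtx (i, f.1 i) (j, f.2 j) \in edges (graph_of o).
    rewrite mem_edges_graph_of cards2 (inj_eq vtx_inj) andbT.
    by move/forall_inP: pf; apply; apply/imsetP; exists (i, j).
  by move=> j; split; apply: edge.
Qed.

(** With n = z^4 and p = w / z^3, the quantity n^(a+b) p^(ab) is z^(4(a+b)-3ab) w^(ab). Within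
    K_{2,4} one has 3ab <= 4(a+b), with equality for a = 2, b = 4, where only w helps; if ab = 0,
    only z does. The 12 is the loss from n to M. *)
Lemma K24_overlap_le (R : realType) (a b : nat) (z w M : R) :
  (a <= 2)%N -> (b <= 4)%N -> (0 < a + b)%N -> 1 <= z -> 1 <= w -> 0 < M ->
  z ^+ 4 <= 12 * M ->
  (M ^+ (a + b) * (w / z ^+ 3) ^+ (a * b))^-1 <= 12 ^+ 6 * (z^-1 + w^-1).
Proof.
move=> a2 b4 ab0 z1 w1 M0 zM.
have z0 : 0 < z by lra.
have w0 : 0 < w by lra.
have zX k : 0 < z ^+ k by apply: exprn_gt0.
have wX k : 0 < w ^+ k by apply: exprn_gt0.
have MX k : 0 < M ^+ k by apply: exprn_gt0.
pose r := z ^+ (3 * (a * b)) / (z ^+ (4 * (a + b)) * w ^+ (a * b)).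
have r0 : 0 <= r by rewrite divr_ge0 ?mulr_ge0 ?(ltW (zX _)) ?(ltW (wX _)).
have rle : r <= z^-1 + w^-1.
  have le0 (x y : R) : 0 < y -> x <= x + y^-1 by move=> y0; rewrite lerDl invr_ge0 ltW.
  rewrite /r; have [ab|ab] := posnP (a * b)%N.
    rewrite ab muln0 !expr0 mul1r mulr1; apply: le_trans (le0 _ _ w0).
    by rewrite lef_pV2 ?posrE // ler_eXnr // muln_gt0.
  rewrite addrC; apply: le_trans (le0 _ _ z0).
  rewrite invfM mulrA; apply: (@le_trans _ _ (1 * (w ^+ (a * b))^-1)).
    rewrite ler_wpM2r ?invr_ge0 ?(ltW (wX _)) // ler_pdivrMr // mul1r ler_weXn2l //.
    by move: a2 b4 ab; clear; case: a => [|[|[|]]] //; case: b => [|[|[|[|[|]]]]].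
  by rewrite mul1r lef_pV2 ?posrE // ler_eXnr.
apply: (@le_trans _ _ (12 ^+ (a + b) * r)).
  rewrite -[leLHS]mul1r ler_pdivrMr; last by rewrite mulr_gt0 // exprn_gt0 // divr_gt0.
  rewrite /r expr_div_n -!exprM.
  have -> : 12 ^+ (a + b) * (z ^+ (3 * (a * b)) / (z ^+ (4 * (a + b)) * w ^+ (a * b))) *
      (M ^+ (a + b) * (w ^+ (a * b) / z ^+ (3 * (a * b)))) =
      (12 * M) ^+ (a + b) / z ^+ (4 * (a + b)).
    rewrite exprMn; move: (zX (3 * (a * b))%N) (zX (4 * (a + b))%N) (wX (a * b)%N).
    move: (z ^+ _) (z ^+ _) (w ^+ _) (12 ^+ _) (M ^+ _) => t u v x y t0 u0 v0.
    by field; rewrite !gt_eqF.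
  rewrite ler_pdivlMr // mul1r exprM lerXn2r ?nnegrE ?(ltW (zX _)) //.
  by rewrite mulr_ge0 // ltW.
apply: ler_pM => //.
by rewrite ler_weXn2l ?ler1n //; lia.
Qed.

Lemma C4_prob_cvg1 (R : realType) (p : nat -> R) : (forall n, 0 <= p n <= 1) ->
  (p n / (n%:R `^ (- (3 / 4))) @[n --> \oo] --> +oo)%classic ->
  (gnp_prob (p n) (fun G : graph 'I_n => rb_arrow G (cycle_graph 4))
     @[n --> \oo] --> (1 : R))%classic.
Proof.
move=> p01 pinf; apply: gnp_prob_cvg1 => // eps eps0.
set ratio := (X in (X @ _ --> _)%classic) in pinf.
pose z n : R := n%:R `^ 4^-1.
(* 64 pairs of subsets of the two sides, each with the factor 12^6 of [K24_overlap_le]. *)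
pose C : R := 64 * 12 ^+ 6.
have C0 : 0 < C by rewrite mulr_gt0 // exprn_gt0.
near=> n.
have n12 : (12 <= n)%N by near: n; exact: nbhs_infty_ge.
have nR : 0 < n%:R :> R by rewrite ltr0n (leq_trans _ n12).
have zE : z n ^+ 4 = n%:R by rewrite -powR_mulrn ?powR_ge0 // -powRrM mulVf // powRr1 ?ltW.
have z0 : 0 < z n by apply: powR_gt0.
have z3 : n%:R `^ (- (3 / 4)) = (z n ^+ 3)^-1 :> R.
  rewrite powRN; congr (_^-1); rewrite -powR_mulrn ?powR_ge0 // -powRrM.
  by congr (_ `^ _); rewrite mulrC.
have z1 : 1 <= z n by near: n; apply: near_powR_ge.
have ze : 2 * C / eps <= z n by near: n; apply: near_powR_ge.
have w1 : 1 <= ratio n by near: n; move/cvgryPge: pinf; apply.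
have we : 2 * C / eps <= ratio n by near: n; move/cvgryPge: pinf; apply.
have pE : p n = ratio n / z n ^+ 3.
  by rewrite /ratio z3 invrK mulfK // gt_eqF // exprn_gt0.
have [_ pn1] := andP (p01 n).
have w0 : 0 < ratio n by lra.
have pn0 : 0 < p n by rewrite pE divr_gt0 // exprn_gt0.
pose m := (n %/ 6)%N.
have [m0 m6 m12] : [/\ (0 < m)%N, (6 * m <= n)%N & (n <= 12 * m)%N].
  by move: n12; rewrite /m; clear; split; lia.
apply: le_trans (C4_failure_le pn0 pn1 m0 m6) _.
apply: (@le_trans _ _ (\sum_(AB : {set 'I_2} * {set 'I_4} | AB != (set0, set0))
    12 ^+ 6 * ((z n)^-1 + (ratio n)^-1))).
  apply: ler_sum => -[A B] /= AB; rewrite pE; apply: K24_overlap_le => //.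
  - by rewrite -[X in (_ <= X)%N](card_ord 2) max_card.
  - by rewrite -[X in (_ <= X)%N](card_ord 4) max_card.
  - rewrite addn_gt0 !card_gt0; apply: contraNT AB.
    by rewrite negb_or !negbK => /andP[/eqP -> /eqP ->].
  - by rewrite ltr0n.
  - by rewrite zE -natrM ler_nat.
have inv_le (x : R) : 0 < x -> 2 * C / eps <= x -> C * x^-1 <= eps / 2.
  by move=> x0; rewrite !ler_pdivrMr //; lra.
have zi : 0 <= (z n)^-1 by rewrite invr_ge0 ltW.
have wi : 0 <= (ratio n)^-1 by rewrite invr_ge0 ltW.
have S0 : 0 <= 12 ^+ 6 * ((z n)^-1 + (ratio n)^-1) :> R.
  by rewrite mulr_ge0 ?exprn_ge0 // addr_ge0.
rewrite sumr_const -[leLHS]mulr_natl.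
apply: (@le_trans _ _ (C * ((z n)^-1 + (ratio n)^-1))).
  rewrite /C -mulrA ler_wpM2r // ler_nat; apply: leq_trans (max_card _) _.
  by rewrite card_prod -!cardsT -!powersetT !card_powerset !cardsT !card_ord.
by rewrite mulrDr; have := inv_le _ z0 ze; have := inv_le _ w0 we; lra.
Unshelve. all: by end_near.
Qed.

(** * The threshold *)

Section CycleDensity.
Variable l : nat.
Hypothesis l3 : (2 < l)%N.

Let idf : {ffun 'I_l -> 'I_l} := [ffun i => i].

Let idf_inj : injective idf.
Proof. by move=> i j; rewrite !ffunE. Qed.

Lemma edges_cycle_graph : edges (cycle_graph l) = cyc idf.
Proof.
apply/setP => e; apply/imsetP/imsetP => -[i iP ->]; exists i => //.
- by rewrite !ffunE.
- by rewrite inE ordS_neq.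
- by rewrite !ffunE.
Qed.

Lemma card_edges_cycle_graph : #|edges (cycle_graph l)| = l.
Proof. by rewrite edges_cycle_graph card_cyc. Qed.

Lemma card_edges_sub_cycle (J : graph 'I_l) : subgraph J (cycle_graph l) ->
  verts J != set0 -> (#|edges J| <= #|verts J| - (#|verts J| < l))%N.
Proof.
move=> /andP[_ /subsetP sE] V0.
pose S := [set i in verts J | ordS i \in verts J].
have eS : (#|edges J| <= #|S|)%N.
  apply: leq_trans (leq_imset_card (fun i => [set idf i; idf (ordS i)]) _).
  apply/subset_leq_card/subsetP => e eJ.
  have := sE _ eJ; rewrite edges_cycle_graph => /imsetP[i _ eE].
  apply/imsetP; exists i => //; have := edge_sub_verts eJ.
  by rewrite eE subUset !sub1set !inE !ffunE.
have SV : S \subset verts J by apply/subsetP => i; rewrite inE => /andP[].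
have [vl|] := boolP (#|verts J| < l)%N; last by rewrite subn0 (leq_trans eS) // subset_leq_card.
rewrite subn1 -ltnS prednK ?card_gt0 //; apply: leq_ltn_trans eS _.
apply: proper_card; rewrite properEneq SV andbT; apply: contraTneq vl => SE.
rewrite (ordS_closed_setT V0); first by rewrite cardsT card_ord ltnn.
by move=> i; rewrite -{1}SE inE => /andP[].
Qed.

(** A subgraph missing a vertex of the cycle has fewer edges than vertices, hence density at most 1,
    below that of the whole cycle. *)
Lemma max_two_density_cycle (R : realType) :
  max_two_density R (cycle_graph l) = (l%:R - 1) / (l%:R - 2).
Proof.
have l2 : 0 < l%:R - 2 :> R by rewrite subr_gt0 (ltr_nat R 2).
have tdE : two_density R (cycle_graph l) = (l%:R - 1) / (l%:R - 2).
  by rewrite /two_density card_edges_cycle_graph cardsT card_ord.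
rewrite /max_two_density tdE; apply/eqP; rewrite eq_le bigmax_ge_id andbT.
apply: bigmax_le => // J /andP[sJ v3]; rewrite /two_density.
have V0 : verts J != set0 by rewrite -card_gt0 (leq_trans _ v3).
have v2 : 0 < #|verts J|%:R - 2 :> R by rewrite subr_gt0 (ltr_nat R 2).
have := card_edges_sub_cycle sJ V0.
have [vl|lv] := ltnP #|verts J| l.
  rewrite subn1 => ev; apply: (@le_trans _ _ 1); last by rewrite ler_pdivlMr // mul1r lerD2l lerN2 (ler_nat R 1 2).
  rewrite ler_pdivrMr // mul1r.
  have : (#|edges J|%:R + 1 <= #|verts J|%:R :> R).
    by rewrite natr1 ler_nat -(ltn_predK v3).
  by lra.
have -> : #|verts J| = l by apply/eqP; rewrite eqn_leq lv -[X in (_ <= X)%N]card_ord max_card.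
by rewrite subn0 => ev; rewrite ler_pM2r ?invr_gt0 // lerD2r ler_nat.
Qed.

End CycleDensity.

Theorem theorem4 (R : realType) :
  (forall l : nat, (5 <= l)%N ->
     (forall n : nat,
        n%:R `^ (- (1 / max_two_density R (cycle_graph l))) =
        n%:R `^ (- ((l%:R - 2) / (l%:R - 1))) :> R) /\
     is_threshold
       (fun n : nat => n%:R `^ (- (1 / max_two_density R (cycle_graph l))) : R)
       (fun (n : nat) (G : graph 'I_n) => rb_arrow G (cycle_graph l))) /\
  is_threshold
    (fun n : nat => n%:R `^ (- (3 / 4)) : R)
    (fun (n : nat) (G : graph 'I_n) => rb_arrow G (cycle_graph 4)).
Proof.
split=> [l l5|p p01].
  have -> : 1 / max_two_density R (cycle_graph l) = (l%:R - 2) / (l%:R - 1).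
    by rewrite max_two_density_cycle ?div1r ?invf_div // ltnW // ltnW.
  split=> // p p01; split; first by apply: arrow_prob_cvg1 => //; rewrite ltnW // ltnW.
  by apply: arrow_prob_cvg0 => //; rewrite ltnW.
split; first exact: C4_prob_cvg1.
move=> h; apply: (@arrow_prob_cvg0 R 4 5) => //.
by have -> : (5%:R - 2) / (5%:R - 1) = 3 / 4 :> R by field.
Qed.
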